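(* Let $$Z(s)=\frac{a_3s^3+a_2s^2+a_1s+a_0}{d_3s^3+d_2s^2+d_1s+d_0}$$ with $a_i,d_j>0$ for $i,j=0,1,2,3$, McMillan degree $\delta(Z(s))=3$, and no pole or zero on $j\mathbb{R}\cup\infty$. Then $Z(s)$ is realizable as the impedance of a five-element non-series-parallel network if and only if at least one of the following conditions holds (where a condition involving quantities defined with signs $\pm$ is required to hold for at least one choice of these signs, the same choice being used throughout the condition): (7a) $\mathcal{B}_{13}>0$, $\mathcal{B}_{23}>0$, $\mathcal{B}_{13}(a_2d_2-\mathcal{B}_{23})-a_2^2d_0d_3=0$, and $\mathcal{B}_{13}\mathcal{B}_{23}\Delta_1-a_2^2a_3^2d_0^2=0$. (7b) $\mathcal{B}_{13}<0$, $\mathcal{B}_{23}<0$, $\mathcal{B}_{13}(a_2d_2+\mathcal{B}_{23})+a_0a_3d_2^2=0$, and $\mathcal{B}_{13}\mathcal{B}_{23}\Delta_2-a_0^2d_2^2d_3^2=0$. (7c) $\mathcal{B}_{13}<0$, $\mathcal{B}_{12}<0$, $\mathcal{B}_{13}(a_1d_1+\mathcal{B}_{12})+a_1^2d_0d_3=0$, and $\mathcal{B}_{13}\mathcal{B}_{12}\Delta_1-a_0^2a_1^2d_3^2=0$. (7d) $\mathcal{B}_{13}>0$, $\mathcal{B}_{12}>0$, $\mathcal{B}_{13}(a_1d_1-\mathcal{B}_{12})-a_0a_3d_1^2=0$, and $\mathcal{B}_{13}\mathcal{B}_{12}\Delta_2-a_3^2d_1^2d_0^2=0$. (8.1) $\mathcal{B}_{33}=0$,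 $\mathcal{B}_{11}\mathcal{B}_{13}>0$, and with $\Lambda=\Lambda_{1a}$: $a_0^2a_3\Lambda^3-a_0a_3d_1\Lambda^2+a_2d_0d_3\Lambda-d_0d_3^2=0$ and $a_0^3\mathcal{M}_{13}\Lambda^3+a_0(2\mathcal{B}_{11}\mathcal{M}_{13}-a_1a_3d_0^2)\Lambda^2+\mathcal{B}_{11}(d_3\mathcal{B}_{11}-a_3d_0d_1)\Lambda+a_3d_0^3d_3=0$. (8.2) $\mathcal{B}_{33}\ne0$, $(\mathcal{B}_{13}^2-\mathcal{B}_{11}\mathcal{B}_{33})(\mathcal{M}_{13}^2-\mathcal{B}_{11}\mathcal{B}_{33})\ge0$, $a_0^2\Lambda_{1b}>\max\{0,-\mathcal{B}_{11}\}$, and the two equations displayed in (8.1) hold with $\Lambda=\Lambda_{1b}$. (8.3) $\mathcal{B}_{33}=0$, $\mathcal{B}_{11}\mathcal{B}_{13}>0$, and with $\Lambda=\Lambda_{2a}$: $d_0^2d_3\Lambda^3-a_1d_0d_3\Lambda^2+a_0a_3d_2\Lambda-a_0a_3^2=0$ and $d_0^3\mathcal{M}_{13}\Lambda^3-d_0(2\mathcal{B}_{11}\mathcal{M}_{13}+a_0^2d_1d_3)\Lambda^2+\mathcal{B}_{11}(a_3\mathcal{B}_{11}+a_0a_1d_3)\Lambda+a_0^3a_3d_3=0$. (8.4) $\mathcal{B}_{33}\ne0$, $(\mathcal{B}_{13}^2-\mathcal{B}_{11}\mathcal{B}_{33})(\mathcal{M}_{13}^2-\mathcal{B}_{11}\mathcal{B}_{33})\ge0$,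 $d_0^2\Lambda_{2b}>\max\{0,\mathcal{B}_{11}\}$, and the two equations displayed in (8.3) hold with $\Lambda=\Lambda_{2b}$. (9.1) $a_3d_0-4a_0d_3\ge0$, $(a_1a_3d_0d_2\Gamma_1^2-(d_0d_3\Gamma_1^2-a_0a_3)^2)(a_1a_3d_0d_2\Gamma_1^2-(d_0d_3\Gamma_1^2+a_0a_3)^2)\ge0$, $0<\Phi_1/\Gamma_1<a_1/a_0$, $a_0(d_0d_3\Gamma_1^2-a_0a_3)\Phi_1^3-(a_1d_0d_3\Gamma_1^2+a_0a_3d_1\Gamma_1-2a_0a_1a_3)\Gamma_1\Phi_1^2+a_1a_3(d_1\Gamma_1-a_1)\Gamma_1^2\Phi_1-a_0a_3d_3\Gamma_1^4=0$, and $a_0^2d_0\Phi_1^4-2a_0a_1d_0\Gamma_1\Phi_1^3+d_0(a_1^2+a_0a_2)\Gamma_1^2\Phi_1^2+(a_0d_0d_3\Gamma_1^2-a_1a_2d_0\Gamma_1-a_0^2a_3)\Gamma_1^2\Phi_1+a_0a_1a_3\Gamma_1^3=0$. (9.2) $a_0d_3-4a_3d_0\ge0$, $(a_0a_2d_1d_3\Gamma_2^2-(a_0a_3\Gamma_2^2-d_0d_3)^2)(a_0a_2d_1d_3\Gamma_2^2-(a_0a_3\Gamma_2^2+d_0d_3)^2)\ge0$, $0<\Phi_2/\Gamma_2<d_1/d_0$, $d_0(a_0a_3\Gamma_2^2-d_0d_3)\Phi_2^3-(a_0a_3d_1\Gamma_2^2+a_1d_0d_3\Gamma_2-2d_0d_1d_3)\Gamma_2\Phi_2^2+d_1d_3(a_1\Gamma_2-d_1)\Gamma_2^2\Phi_2-a_3d_0d_3\Gamma_2^4=0$,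 and $a_0d_0^2\Phi_2^4-2a_0d_0d_1\Gamma_2\Phi_2^3+a_0(d_1^2+d_0d_2)\Gamma_2^2\Phi_2^2+(a_0a_3d_0\Gamma_2^2-a_0d_1d_2\Gamma_2-d_0^2d_3)\Gamma_2^2\Phi_2+d_0d_1d_3\Gamma_2^3=0$. (10.1) $a_3d_0-4a_0d_3\ge0$, $(a_1d_2-a_3d_0)^2-4a_0a_3d_0d_3\ge0$, $0<\Psi_1<a_1/d_0$, $d_0^2\Psi_1^3-a_1d_0\Psi_1^2+a_2d_0\Gamma_1\Psi_1-a_0a_3\Gamma_1=0$, and $d_0^2\Psi_1^3+d_0(d_1\Gamma_1-2a_1)\Psi_1^2-a_1(d_1\Gamma_1-a_1)\Psi_1+a_0d_3\Gamma_1^2=0$. (10.2) $a_0d_3-4a_3d_0\ge0$, $(a_2d_1-a_0d_3)^2-4a_0a_3d_0d_3\ge0$, $0<\Psi_2<d_1/a_0$, $a_0^2\Psi_2^3-a_0d_1\Psi_2^2+a_0d_2\Gamma_2\Psi_2-d_0d_3\Gamma_2=0$, and $a_0^2\Psi_2^3+a_0(a_1\Gamma_2-2d_1)\Psi_2^2-d_1(a_1\Gamma_2-d_1)\Psi_2+a_3d_0\Gamma_2^2=0$. (11) $\mathcal{B}_{13}=0$, and there exists $T>0$ with $a_0d_0d_3T^3+(a_1d_0d_3+a_0d_1d_3-a_2d_0d_2)T^2+(a_1d_1d_3-a_2d_0d_3-a_3d_0d_2)T-a_3d_0d_3=0$ such that $a_0d_2T^2+(a_1d_2-3a_0d_3)T+a_1d_3\ge0$,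 $(a_2^2d_2-4a_0a_3d_3)T^3+(a_2^2d_3+2a_2a_3d_2-4a_1a_3d_3)T^2+a_3(a_3d_2+2a_2d_3)T+a_3^2d_3\ge0$, $a_1T+a_2-a_0(y_1z_1+y_2z_2)=0$, and $d_1T+d_2-d_0(y_1z_2+y_2z_1)=0$, where $y_1,y_2$ are the two positive roots (counted with multiplicity, in some order) of $d_0(d_2T+d_3)y^2-(a_0T+a_1)(d_2T+d_3)y+a_3T(a_0T+a_1)=0$ and $z_1,z_2$ are the two positive roots (counted with multiplicity, in some order) of $a_3T(a_0T+a_1)z^2-(a_2T+a_3)(d_2T+d_3)z+d_3T(d_2T+d_3)=0$.
   Context: Networks are two-terminal linear time-invariant networks consisting of dampers, springs and inerters with positive finite element values: a finite connected graph (multiple edges allowed) with two distinguished vertices $a,a'$ (the terminals), each edge being one element and, as usual, lying on some simple path from $a$ to $a'$. The impedance of a network is its driving-point impedance (velocity plays the role of voltage, force the role of current); a damper $c>0$ has impedance $1/c$, a spring $k>0$ has impedance $s/k$, an inerter $b>0$ has impedance $1/(bs)$. $Z(s)$ is realizable as a network if it equals its impedance. A network is series-parallel if it is a single element or a series or parallel connection of two smaller series-parallel networks, and non-series-parallel otherwise. For $Z=a/d$ with coprime polynomials $a,d$, the McMillan degree is $\delta(Z)=\max\{\deg a,\deg d\}$. Notation: $\mathcal{B}_{11}=a_1d_0-a_0d_1$, $\mathcal{B}_{12}=a_2d_0-a_0d_2$, $\mathcal{B}_{13}=a_3d_0-a_0d_3$, $\mathcal{B}_{23}=a_3d_1-a_1d_3$,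 $\mathcal{B}_{33}=a_3d_2-a_2d_3$; $\Delta_1=a_1a_2-a_0a_3$, $\Delta_2=d_1d_2-d_0d_3$; $\mathcal{M}_{13}=a_3d_0+a_0d_3$; $$\Lambda_{1a}=\frac{d_3^2\mathcal{B}_{11}}{\mathcal{B}_{13}\mathcal{M}_{13}},\qquad \Lambda_{2a}=\frac{a_3^2\mathcal{B}_{11}}{\mathcal{B}_{13}\mathcal{M}_{13}},$$ $$\Lambda_{1b}=\frac{1}{2a_0^2\mathcal{B}_{33}}\left(\mathcal{B}_{13}\mathcal{M}_{13}-\mathcal{B}_{11}\mathcal{B}_{33}\pm\sqrt{(\mathcal{B}_{13}^2-\mathcal{B}_{11}\mathcal{B}_{33})(\mathcal{M}_{13}^2-\mathcal{B}_{11}\mathcal{B}_{33})}\right),$$ $$\Lambda_{2b}=-\frac{1}{2d_0^2\mathcal{B}_{33}}\left(-\mathcal{B}_{13}\mathcal{M}_{13}-\mathcal{B}_{11}\mathcal{B}_{33}\pm\sqrt{(\mathcal{B}_{13}^2-\mathcal{B}_{11}\mathcal{B}_{33})(\mathcal{M}_{13}^2-\mathcal{B}_{11}\mathcal{B}_{33})}\right),$$ $$\Gamma_1=\frac{a_3d_0\pm\sqrt{a_3d_0(a_3d_0-4a_0d_3)}}{2d_0d_3},\qquad \Gamma_2=\frac{a_0d_3\pm\sqrt{a_0d_3(a_0d_3-4a_3d_0)}}{2a_0a_3},$$ $$\Phi_1=\frac{a_1a_3d_0d_2\Gamma_1^2-(d_0^2d_3^2\Gamma_1^4-a_0^2a_3^2)\pm\sqrt{(a_1a_3d_0d_2\Gamma_1^2-(d_0d_3\Gamma_1^2-a_0a_3)^2)(a_1a_3d_0d_2\Gamma_1^2-(d_0d_3\Gamma_1^2+a_0a_3)^2)}}{2a_0a_3d_0d_2\Gamma_1},$$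 $$\Phi_2=\frac{a_0a_2d_1d_3\Gamma_2^2-(a_0^2a_3^2\Gamma_2^4-d_0^2d_3^2)\pm\sqrt{(a_0a_2d_1d_3\Gamma_2^2-(a_0a_3\Gamma_2^2-d_0d_3)^2)(a_0a_2d_1d_3\Gamma_2^2-(a_0a_3\Gamma_2^2+d_0d_3)^2)}}{2a_0a_2d_0d_3\Gamma_2},$$ $$\Psi_1=\frac{a_1d_2+a_3d_0\pm\sqrt{(a_1d_2-a_3d_0)^2-4a_0a_3d_0d_3}}{2d_0d_2}-\frac{d_3}{d_2}\Gamma_1,$$ $$\Psi_2=\frac{a_2d_1+a_0d_3\pm\sqrt{(a_2d_1-a_0d_3)^2-4a_0a_3d_0d_3}}{2a_0a_2}-\frac{a_3}{a_2}\Gamma_2.$$ The sign in $\Gamma_i$ and the sign in $\Phi_i$ (or $\Psi_i$) are chosen independently. *)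

(* Defs.v *)
From mathcomp Require Import all_boot all_order all_algebra.
From mathcomp Require Import fraction complex reals.

Set Implicit Arguments.
Unset Strict Implicit.
Unset Printing Implicit Defensive.

Import Order.TTheory GRing.Theory Num.Theory.

Local Open Scope ring_scope.

Notation "x %:F" := (FracField.tofrac x) : ring_scope.

Section RationalFunctions.
Variable R : realType.
Implicit Types (Z : {fraction {poly R}}) (p q : {poly R}) (s : R[i]).

Definition lowest_terms Z p q : Prop :=
  [/\ q != 0, coprimep p q & Z = p%:F / q%:F].

Definition has_mcmillan_degree Z (n : nat) : Prop :=
  exists p q, lowest_terms Z p q /\ n = maxn (size p).-1 (size q).-1.

Definition zero_at Z s : Prop :=
  exists p q, lowest_terms Z p q /\ root (map_poly (real_complex R) p) s.

Definition pole_at Z s : Prop :=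
  exists p q, lowest_terms Z p q /\ root (map_poly (real_complex R) q) s.

Definition zero_at_infinity Z : Prop :=
  exists p q, lowest_terms Z p q /\ (size p < size q)%N.

Definition pole_at_infinity Z : Prop :=
  exists p q, lowest_terms Z p q /\ (size q < size p)%N.

Definition no_pole_or_zero_on_jR_infinity Z : Prop :=
  (forall w : R, ~ zero_at Z (Complex 0 w) /\ ~ pole_at Z (Complex 0 w)) /\
  ~ zero_at_infinity Z /\ ~ pole_at_infinity Z.

End RationalFunctions.

(* Undirected multigraphs: [ends e] is the pair of endpoints of the edge [e],
   listed in the order of its reference orientation. *)
Section Graphs.
Variables (V E : finType) (ends : E -> V * V).

Definition joins (e : E) (x y : V) : bool :=
  (ends e == (x, y)) || (ends e == (y, x)).

Definition adjacent : rel V := fun x y => [exists e, joins e x y].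

(* A step [(e, y)] of a walk traverses the edge [e] and arrives at [y]. *)
Fixpoint walk (x : V) (w : seq (E * V)) : bool :=
  if w is (e, y) :: w' then joins e x y && walk y w' else true.

Definition simple_path (x y : V) (w : seq (E * V)) : bool :=
  [&& walk x w, uniq (x :: unzip2 w) & last x (unzip2 w) == y].

Definition vertices_of (F : {set E}) : {set V} :=
  [set x | [exists e in F, (x == (ends e).1) || (x == (ends e).2)]].

(* [sp_part F x y]: the subnetwork consisting of the edges in [F] (and of their
   endpoints), with terminals [x] and [y], is series-parallel. *)
Inductive sp_part : {set E} -> V -> V -> Prop :=
| sp_single e x y of joins e x y & x != y :
    sp_part [set e] x y
| sp_series F1 F2 x z y of sp_part F1 x z & sp_part F2 z y
    & [disjoint F1 & F2] & vertices_of F1 :&: vertices_of F2 = [set z] :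
    sp_part (F1 :|: F2) x y
| sp_parallel F1 F2 x y of sp_part F1 x y & sp_part F2 x y
    & [disjoint F1 & F2] & vertices_of F1 :&: vertices_of F2 = [set x; y] :
    sp_part (F1 :|: F2) x y.

End Graphs.

Section Networks.
Variable R : realType.

Inductive element : Type :=
| Damper of R
| Spring of R
| Inerter of R.

Definition element_value (u : element) : R :=
  match u with Damper c => c | Spring k => k | Inerter b => b end.

Definition element_impedance (u : element) : {fraction {poly R}} :=
  match u with
  | Damper c => (c%:P%:F)^-1
  | Spring k => ('X : {poly R})%:F / k%:P%:F
  | Inerter b => (b%:P%:F * ('X : {poly R})%:F)^-1
  end.

Record network := Network {
  vertex : finType;
  edge : finType;
  ends : edge -> vertex * vertex;
  elt : edge -> element;
  source : vertex;
  sink : vertex;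
  terminals_distinct : source != sink;
  elt_gt0 : forall e, 0 < element_value (elt e);
  network_connected : forall x y, connect (adjacent ends) x y;
  edge_on_simple_path : forall e,
    exists2 w, simple_path ends source sink w & e \in unzip1 w
}.

(* Kirchhoff's current law, with external through-variable [I] entering at
   [source] and leaving at [sink], and the element laws, in terms of vertex
   potentials [v] (velocities) and edge flows [f] (forces). *)
Definition network_laws (N : network) (v : vertex N -> {fraction {poly R}})
    (f : edge N -> {fraction {poly R}}) (I : {fraction {poly R}}) : Prop :=
  (forall x, \sum_(e | (ends e).1 == x) f e - \sum_(e | (ends e).2 == x) f e
             = I *+ (x == source N) - I *+ (x == sink N)) /\
  (forall e, v (ends e).1 - v (ends e).2 = element_impedance (elt e) * f e).

(* Across-variable in response to a unit through-variable. It is the same for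
   all solutions: if [(v, f)] and [(v', f')] both satisfy the laws with [I = 1],
   both across-variables equal [\sum_e element_impedance (elt e) * f e * f' e]. *)
Definition has_impedance (N : network) (Z : {fraction {poly R}}) : Prop :=
  exists v f, @network_laws N v f 1 /\ Z = v (source N) - v (sink N).

Definition series_parallel (N : network) : Prop :=
  sp_part (@ends N) [set: edge N] (source N) (sink N).

Definition realizable_five_element_nsp (Z : {fraction {poly R}}) : Prop :=
  exists N : network,
    [/\ #|edge N| = 5, ~ series_parallel N & has_impedance N Z].

End Networks.

(* A boolean [e] stands for the sign [(-1) ^+ e], i.e. for one choice of a +-.
   [Num.sqrt] is 0 on negative reals; when the coefficients of [a] and [d] are
   positive, every condition below that uses a square root forces its radicand
   to be nonnegative. *)
Section Conditions.
Variables (R : realType) (a d : {poly R}).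

Local Notation a0 := (a`_0).
Local Notation a1 := (a`_1).
Local Notation a2 := (a`_2).
Local Notation a3 := (a`_3).
Local Notation d0 := (d`_0).
Local Notation d1 := (d`_1).
Local Notation d2 := (d`_2).
Local Notation d3 := (d`_3).

Definition B11 : R := a1 * d0 - a0 * d1.
Definition B12 : R := a2 * d0 - a0 * d2.
Definition B13 : R := a3 * d0 - a0 * d3.
Definition B23 : R := a3 * d1 - a1 * d3.
Definition B33 : R := a3 * d2 - a2 * d3.
Definition Delta1 : R := a1 * a2 - a0 * a3.
Definition Delta2 : R := d1 * d2 - d0 * d3.
Definition M13 : R := a3 * d0 + a0 * d3.

Definition cond7a : Prop :=
  [/\ 0 < B13, 0 < B23,
      B13 * (a2 * d2 - B23) - a2 ^+ 2 * d0 * d3 = 0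
    & B13 * B23 * Delta1 - a2 ^+ 2 * a3 ^+ 2 * d0 ^+ 2 = 0].

Definition cond7b : Prop :=
  [/\ B13 < 0, B23 < 0,
      B13 * (a2 * d2 + B23) + a0 * a3 * d2 ^+ 2 = 0
    & B13 * B23 * Delta2 - a0 ^+ 2 * d2 ^+ 2 * d3 ^+ 2 = 0].

Definition cond7c : Prop :=
  [/\ B13 < 0, B12 < 0,
      B13 * (a1 * d1 + B12) + a1 ^+ 2 * d0 * d3 = 0
    & B13 * B12 * Delta1 - a0 ^+ 2 * a1 ^+ 2 * d3 ^+ 2 = 0].

Definition cond7d : Prop :=
  [/\ 0 < B13, 0 < B12,
      B13 * (a1 * d1 - B12) - a0 * a3 * d1 ^+ 2 = 0
    & B13 * B12 * Delta2 - a3 ^+ 2 * d1 ^+ 2 * d0 ^+ 2 = 0].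

Definition Lambda1a : R := d3 ^+ 2 * B11 / (B13 * M13).
Definition Lambda2a : R := a3 ^+ 2 * B11 / (B13 * M13).

Definition Lambda_radicand : R :=
  (B13 ^+ 2 - B11 * B33) * (M13 ^+ 2 - B11 * B33).

Definition Lambda1b (e : bool) : R :=
  1 / (2 * a0 ^+ 2 * B33) *
  (B13 * M13 - B11 * B33 + (-1) ^+ e * Num.sqrt Lambda_radicand).

Definition Lambda2b (e : bool) : R :=
  - (1 / (2 * d0 ^+ 2 * B33)) *
  (- (B13 * M13) - B11 * B33 + (-1) ^+ e * Num.sqrt Lambda_radicand).

Definition eqns8_1 (L : R) : Prop :=
  a0 ^+ 2 * a3 * L ^+ 3 - a0 * a3 * d1 * L ^+ 2 + a2 * d0 * d3 * L
    - d0 * d3 ^+ 2 = 0 /\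
  a0 ^+ 3 * M13 * L ^+ 3
    + a0 * (2 * B11 * M13 - a1 * a3 * d0 ^+ 2) * L ^+ 2
    + B11 * (d3 * B11 - a3 * d0 * d1) * L + a3 * d0 ^+ 3 * d3 = 0.

Definition eqns8_3 (L : R) : Prop :=
  d0 ^+ 2 * d3 * L ^+ 3 - a1 * d0 * d3 * L ^+ 2 + a0 * a3 * d2 * L
    - a0 * a3 ^+ 2 = 0 /\
  d0 ^+ 3 * M13 * L ^+ 3
    - d0 * (2 * B11 * M13 + a0 ^+ 2 * d1 * d3) * L ^+ 2
    + B11 * (a3 * B11 + a0 * a1 * d3) * L + a0 ^+ 3 * a3 * d3 = 0.

Definition cond8_1 : Prop :=
  [/\ B33 = 0, 0 < B11 * B13 & eqns8_1 Lambda1a].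

Definition cond8_2 : Prop :=
  exists e : bool,
  [/\ B33 != 0, 0 <= Lambda_radicand,
      Num.max 0 (- B11) < a0 ^+ 2 * Lambda1b e
    & eqns8_1 (Lambda1b e)].

Definition cond8_3 : Prop :=
  [/\ B33 = 0, 0 < B11 * B13 & eqns8_3 Lambda2a].

Definition cond8_4 : Prop :=
  exists e : bool,
  [/\ B33 != 0, 0 <= Lambda_radicand,
      Num.max 0 B11 < d0 ^+ 2 * Lambda2b e
    & eqns8_3 (Lambda2b e)].

Definition Gamma1 (e : bool) : R :=
  (a3 * d0 + (-1) ^+ e * Num.sqrt (a3 * d0 * (a3 * d0 - 4 * a0 * d3)))
  / (2 * d0 * d3).

Definition Gamma2 (e : bool) : R :=
  (a0 * d3 + (-1) ^+ e * Num.sqrt (a0 * d3 * (a0 * d3 - 4 * a3 * d0)))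
  / (2 * a0 * a3).

(* In the definitions with a parameter [G], it stands for the chosen value of
   [Gamma1 _] (index 1) or [Gamma2 _] (index 2). *)
Definition Phi1_radicand (G : R) : R :=
  (a1 * a3 * d0 * d2 * G ^+ 2 - (d0 * d3 * G ^+ 2 - a0 * a3) ^+ 2) *
  (a1 * a3 * d0 * d2 * G ^+ 2 - (d0 * d3 * G ^+ 2 + a0 * a3) ^+ 2).

Definition Phi1 (G : R) (e : bool) : R :=
  (a1 * a3 * d0 * d2 * G ^+ 2
     - (d0 ^+ 2 * d3 ^+ 2 * G ^+ 4 - a0 ^+ 2 * a3 ^+ 2)
     + (-1) ^+ e * Num.sqrt (Phi1_radicand G))
  / (2 * a0 * a3 * d0 * d2 * G).

Definition Phi2_radicand (G : R) : R :=
  (a0 * a2 * d1 * d3 * G ^+ 2 - (a0 * a3 * G ^+ 2 - d0 * d3) ^+ 2) *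
  (a0 * a2 * d1 * d3 * G ^+ 2 - (a0 * a3 * G ^+ 2 + d0 * d3) ^+ 2).

Definition Phi2 (G : R) (e : bool) : R :=
  (a0 * a2 * d1 * d3 * G ^+ 2
     - (a0 ^+ 2 * a3 ^+ 2 * G ^+ 4 - d0 ^+ 2 * d3 ^+ 2)
     + (-1) ^+ e * Num.sqrt (Phi2_radicand G))
  / (2 * a0 * a2 * d0 * d3 * G).

Definition Psi1_radicand : R :=
  (a1 * d2 - a3 * d0) ^+ 2 - 4 * a0 * a3 * d0 * d3.

Definition Psi1 (G : R) (e : bool) : R :=
  (a1 * d2 + a3 * d0 + (-1) ^+ e * Num.sqrt Psi1_radicand) / (2 * d0 * d2)
  - d3 / d2 * G.

Definition Psi2_radicand : R :=
  (a2 * d1 - a0 * d3) ^+ 2 - 4 * a0 * a3 * d0 * d3.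

Definition Psi2 (G : R) (e : bool) : R :=
  (a2 * d1 + a0 * d3 + (-1) ^+ e * Num.sqrt Psi2_radicand) / (2 * a0 * a2)
  - a3 / a2 * G.

Definition cond9_1 : Prop :=
  0 <= a3 * d0 - 4 * a0 * d3 /\
  exists e1 e2 : bool,
  let G := Gamma1 e1 in
  let P := Phi1 G e2 in
  [/\ 0 <= Phi1_radicand G,
      0 < P / G < a1 / a0,
      a0 * (d0 * d3 * G ^+ 2 - a0 * a3) * P ^+ 3
        - (a1 * d0 * d3 * G ^+ 2 + a0 * a3 * d1 * G - 2 * a0 * a1 * a3)
          * G * P ^+ 2
        + a1 * a3 * (d1 * G - a1) * G ^+ 2 * P - a0 * a3 * d3 * G ^+ 4 = 0
    & a0 ^+ 2 * d0 * P ^+ 4 - 2 * a0 * a1 * d0 * G * P ^+ 3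
        + d0 * (a1 ^+ 2 + a0 * a2) * G ^+ 2 * P ^+ 2
        + (a0 * d0 * d3 * G ^+ 2 - a1 * a2 * d0 * G - a0 ^+ 2 * a3)
          * G ^+ 2 * P
        + a0 * a1 * a3 * G ^+ 3 = 0].

Definition cond9_2 : Prop :=
  0 <= a0 * d3 - 4 * a3 * d0 /\
  exists e1 e2 : bool,
  let G := Gamma2 e1 in
  let P := Phi2 G e2 in
  [/\ 0 <= Phi2_radicand G,
      0 < P / G < d1 / d0,
      d0 * (a0 * a3 * G ^+ 2 - d0 * d3) * P ^+ 3
        - (a0 * a3 * d1 * G ^+ 2 + a1 * d0 * d3 * G - 2 * d0 * d1 * d3)
          * G * P ^+ 2
        + d1 * d3 * (a1 * G - d1) * G ^+ 2 * P - a3 * d0 * d3 * G ^+ 4 = 0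
    & a0 * d0 ^+ 2 * P ^+ 4 - 2 * a0 * d0 * d1 * G * P ^+ 3
        + a0 * (d1 ^+ 2 + d0 * d2) * G ^+ 2 * P ^+ 2
        + (a0 * a3 * d0 * G ^+ 2 - a0 * d1 * d2 * G - d0 ^+ 2 * d3)
          * G ^+ 2 * P
        + d0 * d1 * d3 * G ^+ 3 = 0].

Definition cond10_1 : Prop :=
  0 <= a3 * d0 - 4 * a0 * d3 /\
  0 <= Psi1_radicand /\
  exists e1 e2 : bool,
  let G := Gamma1 e1 in
  let P := Psi1 G e2 in
  [/\ 0 < P < a1 / d0,
      d0 ^+ 2 * P ^+ 3 - a1 * d0 * P ^+ 2 + a2 * d0 * G * P
        - a0 * a3 * G = 0
    & d0 ^+ 2 * P ^+ 3 + d0 * (d1 * G - 2 * a1) * P ^+ 2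
        - a1 * (d1 * G - a1) * P + a0 * d3 * G ^+ 2 = 0].

Definition cond10_2 : Prop :=
  0 <= a0 * d3 - 4 * a3 * d0 /\
  0 <= Psi2_radicand /\
  exists e1 e2 : bool,
  let G := Gamma2 e1 in
  let P := Psi2 G e2 in
  [/\ 0 < P < d1 / a0,
      a0 ^+ 2 * P ^+ 3 - a0 * d1 * P ^+ 2 + a0 * d2 * G * P
        - d0 * d3 * G = 0
    & a0 ^+ 2 * P ^+ 3 + a0 * (a1 * G - 2 * d1) * P ^+ 2
        - d1 * (a1 * G - d1) * P + a3 * d0 * G ^+ 2 = 0].

(* [x1] and [x2] are the roots, counted with multiplicity, of the quadratic
   polynomial [p], and both are positive. *)
Definition positive_roots (p : {poly R}) (x1 x2 : R) : Prop :=
  [/\ size p = 3%N, p = lead_coef p *: (('X - x1%:P) * ('X - x2%:P)),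
      0 < x1 & 0 < x2].

Definition quadY (T : R) : {poly R} :=
  (d0 * (d2 * T + d3)) *: 'X^2 - ((a0 * T + a1) * (d2 * T + d3)) *: 'X
  + (a3 * T * (a0 * T + a1))%:P.

Definition quadZ (T : R) : {poly R} :=
  (a3 * T * (a0 * T + a1)) *: 'X^2 - ((a2 * T + a3) * (d2 * T + d3)) *: 'X
  + (d3 * T * (d2 * T + d3))%:P.

Definition cond11 : Prop :=
  B13 = 0 /\
  exists T : R,
  [/\ 0 < T,
      a0 * d0 * d3 * T ^+ 3
        + (a1 * d0 * d3 + a0 * d1 * d3 - a2 * d0 * d2) * T ^+ 2
        + (a1 * d1 * d3 - a2 * d0 * d3 - a3 * d0 * d2) * T
        - a3 * d0 * d3 = 0,
      0 <= a0 * d2 * T ^+ 2 + (a1 * d2 - 3 * a0 * d3) * T + a1 * d3,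
      0 <= (a2 ^+ 2 * d2 - 4 * a0 * a3 * d3) * T ^+ 3
        + (a2 ^+ 2 * d3 + 2 * a2 * a3 * d2 - 4 * a1 * a3 * d3) * T ^+ 2
        + a3 * (a3 * d2 + 2 * a2 * d3) * T + a3 ^+ 2 * d3
    & exists y1 y2 z1 z2 : R,
      [/\ positive_roots (quadY T) y1 y2,
          positive_roots (quadZ T) z1 z2,
          a1 * T + a2 - a0 * (y1 * z1 + y2 * z2) = 0
        & d1 * T + d2 - d0 * (y1 * z2 + y2 * z1) = 0]].

End Conditions.

(* Main.v *)
Require Import Defs.
From mathcomp Require Import all_boot all_order all_algebra.
From mathcomp Require Import fraction complex reals ring lra.

(* A five-edge network that is not series-parallel is the Wheatstone bridge,
   so Z is the ratio of two explicit polynomials in the five admittances,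
   each a positive multiple of s^-1, 1 or s. Since a and d are coprime, they
   divide the cleared denominator and numerator of the bridge with the same
   cofactor t; as a and d have degree 3 and nonzero constant terms, both
   sides have equal lowest degree, equal highest degree, and these differ by
   at least 3. This leaves 46 of the 243 assignments of element kinds, which
   form six classes under the symmetries of the bridge, duality (Z -> 1/Z)
   and inversion (s -> 1/s). In four classes t is a monomial and comparing
   coefficients gives a system that is solved for the element values: (7),
   (8), (9) and (10). In the two classes with four reactive elements t must
   have a negative real root; for one class this is condition (11), for the
   other one it is impossible because eliminating the damper from the two
   equations at the root leaves E^2 = 0 with E > 0. *)

(** Positive element values prevent any cancellation in the spanning-tree and 2-forest sums of the
    bridge. The degrees occurring in them therefore depend on the element kinds alone, and the
    selection of the kinds is a finite computation. The shape of the conditions reflects a count of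
    unknowns. When t is a monomial, eight coefficient equations face five element values and one
    scale, so two relations remain. The system of [fits7] is solved rationally. In [fits8] one
    element value, in [fits9] and [fits10] two of them, are only known through a quadratic equation;
    this is the origin of Lambda, Gamma, Phi, Psi and of their signs. In [fits11] there are ten
    equations, and the ratio of the two coefficients of t is one more unknown. Inversion needs its
    own treatment for [fits7] only: in all other classes the kinds of the inverted network are, up
    to a symmetry of the bridge, those of the dual network. *)

Set Implicit Arguments.
Unset Strict Implicit.
Unset Printing Implicit Defensive.

(** * Five-edge networks that are not series-parallel *)

(* An edge is coded by the increasing pair of the numbers of its endpoints, where
   the source has number 0 and the sink number 1; [k] is fuel. *)
Definition code_vertices (L : seq (nat * nat)) : seq nat :=
  flatten [seq [:: p.1; p.2] | p <- L].

Definition step (p : nat * nat) (x : nat) : seq nat :=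
  (if p.1 == x then [:: p.2] else [::]) ++ (if p.2 == x then [:: p.1] else [::]).

Fixpoint simple_code_paths (L : seq (nat * nat)) (k x : nat) (vis : seq nat) :
    seq (seq (nat * nat)) :=
  if x == 1 then [:: [::]] else
  if k is k'.+1 then
    flatten [seq flatten [seq if y \in vis then [::] else
      [seq p :: P | P <- simple_code_paths L k' y (y :: vis)]
      | y <- step p x] | p <- L]
  else [::].

Definition all_on_simple_path (L : seq (nat * nat)) : bool :=
  let Ps := simple_code_paths L 6 0 [:: 0] in
  all (fun p => has (fun P => p \in P) Ps) L.

Fixpoint bool_masks (n : nat) : seq bitseq :=
  if n is n'.+1 then
    let ms := bool_masks n' in map (cons true) ms ++ map (cons false) ms
  else [:: [::]].

(** The number of vertices shared by the two parts decides between series and parallel. An empty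
    part shares no vertex with the other one and so falls into the default branch. *)
Fixpoint sp_check (k : nat) (L : seq (nat * nat)) (x y : nat) : bool :=
  if k is k'.+1 then
    (if L is [:: p] then ((p == (x, y)) || (p == (y, x))) && (x != y)
     else false) ||
    has (fun m =>
      let L1 := mask m L in
      let L2 := mask (map negb m) L in
      let V2 := code_vertices L2 in
      match undup [seq v <- code_vertices L1 | v \in V2] with
      | [:: z] => sp_check k' L1 x z && sp_check k' L2 z y
      | [:: z; z'] =>
          [&& ((z == x) && (z' == y)) || ((z == y) && (z' == x)),
              sp_check k' L1 x y & sp_check k' L2 x y]
      | _ => false
      end) (bool_masks (size L))
  else false.

(** Taking [x] once more lowers [k] and keeps [U], dropping [x] shortens [U] and keeps [k]; hence
    the nested [fix]. The members come out sorted in the order of [U]. *)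
Fixpoint multisets (T : Type) (U : seq T) (k : nat) : seq (seq T) :=
  if U is x :: U' then
    (fix add (k : nat) : seq (seq T) :=
      if k is k'.+1 then map (cons x) (add k') ++ multisets U' k
      else [:: [::]]) k
  else if k is 0 then [:: [::]] else [::].

Definition pairs_below (n : nat) : seq (nat * nat) :=
  flatten [seq [seq (i, j) | j <- iota i.+1 (n - i.+1)] | i <- iota 0 n].

Definition bridge_code : seq (nat * nat) :=
  [:: (0, 2); (0, 3); (1, 2); (1, 3); (2, 3)].

(** [iota 2 5] is the range 2, ..., 6 of possible numbers of vertices. A single list remains because
    exchanging the internal vertices 2 and 3 maps the multiset [bridge_code] to itself. *)
Lemma five_edge_check :
  all (fun n => all (fun L =>
    if all (mem (code_vertices L)) (iota 0 n) then
      if all_on_simple_path L then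
        sp_check 5 L 0 1 || ((n == 4) && (L == bridge_code))
      else true
    else true) (multisets (pairs_below n) 5)) (iota 2 5).
Proof. by vm_compute. Qed.

Lemma size_bool_masks n m : m \in bool_masks n -> size m = n.
Proof.
elim: n m => [|n IH] m /=; first by rewrite inE => /eqP ->.
by rewrite mem_cat => /orP[] /mapP[m' /IH <- ->].
Qed.

Lemma perm_mask_cat (T : eqType) (m : bitseq) (s : seq T) : size m = size s ->
  perm_eq (mask m s ++ mask (map negb m) s) s.
Proof.
elim: m s => [|b m IH] [|x s] //= [/IH p].
case: b => /=; first by rewrite perm_cons; exact: p.
by rewrite -cat_rcons -cats1 -catA perm_catCA /= perm_cons; exact: p.
Qed.

Lemma multisets_complete (T : eqType) (U L : seq T) k :
  {subset L <= U} -> size L = k ->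
  exists2 L', L' \in multisets U k & perm_eq L' L.
Proof.
elim: U L k => [|x U IH] L k LU.
  case: L LU => [|y L] LU szL; last by have := LU y; rewrite inE eqxx => /(_ isT).
  by rewrite -szL; exists [::].
(* The inner induction is on the multiplicity of [x]: one occurrence is removed from [L] and put
   back by the [cons x] branch of [add]. *)
have [n Ln] : exists n, count_mem x L = n by exists (count_mem x L).
elim: n L k LU Ln => [|n IHn] L k LU Ln szL.
  have [L' L'U pL] : exists2 L', L' \in multisets U k & perm_eq L' L.
    apply: IH szL => y yL; have := LU y yL; rewrite inE => /orP[/eqP yx|//].
    by move/eqP: Ln; rewrite -leqn0 leqNgt -has_count has_pred1 -yx yL.
  exists L' => //; case: k L'U {szL} => [|k] L'U /=; last by rewrite mem_cat L'U orbT.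
  by rewrite /=; case: (U) L'U.
have xL : x \in L by rewrite -has_pred1 has_count Ln.
have pr := perm_to_rem xL.
have szr : size (rem x L) = k.-1 by rewrite size_rem // szL.
have [||L' L'U pL] := IHn (rem x L) k.-1 _ _ szr.
- by move=> y /mem_rem; apply: LU.
- by have := permP pr (pred1 x); rewrite Ln /= eqxx add1n => -[].
exists (x :: L'); last by rewrite perm_sym (permPl pr) perm_cons perm_sym.
have k0 : 0 < k by rewrite -szL; case: (L) xL.
by case: k k0 L'U {szL szr} => // k _ /= L'U; rewrite mem_cat map_f.
Qed.

(** * Numbering of the vertices, terminals first *)

Section Coding.
Variables (V E : finType) (ends : E -> V * V) (s t : V).
Hypothesis s_neq_t : s != t.

Definition vertex_order : seq V :=
  s :: t :: [seq x <- enum V | x \notin [:: s; t]].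

Lemma mem_vertex_order x : x \in vertex_order.
Proof. by rewrite !in_cons mem_filter !inE mem_enum; do !case: eqP. Qed.

Lemma uniq_vertex_order : uniq vertex_order.
Proof.
rewrite /= !in_cons !mem_filter !inE !eqxx (negPf s_neq_t) orbT /=.
by rewrite filter_uniq ?enum_uniq.
Qed.

Lemma size_vertex_order : size vertex_order = #|V|.
Proof.
rewrite cardE; apply/perm_size/uniq_perm.
- exact: uniq_vertex_order.
- exact: enum_uniq.
- by move=> x; rewrite mem_vertex_order mem_enum.
Qed.

Definition label (x : V) : nat := index x vertex_order.

Lemma label_inj : injective label.
Proof.
move=> x y /(congr1 (nth s vertex_order)).
by rewrite !nth_index ?mem_vertex_order.
Qed.

Lemma label_eq x y : (label x == label y) = (x == y).
Proof. exact: inj_eq label_inj _ _. Qed.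

Lemma label_lt x : label x < #|V|.
Proof. by rewrite -size_vertex_order index_mem mem_vertex_order. Qed.

Lemma label_source : label s = 0. Proof. by rewrite /label /= eqxx. Qed.

Lemma label_sink : label t = 1.
Proof. by rewrite /label /= (negPf s_neq_t) eqxx. Qed.

Definition code (e : E) : nat * nat :=
  let i := label (ends e).1 in let j := label (ends e).2 in
  (minn i j, maxn i j).

Lemma code_joins e x y :
  (code e == (label x, label y)) || (code e == (label y, label x)) =
  joins ends e x y.
Proof.
rewrite /joins /code; case: (ends e) => u v /=.
rewrite !xpair_eqE /minn /maxn; case: ltnP => _; rewrite !label_eq //.
by rewrite orbC (andbC (v == x)) (andbC (v == y)).
Qed.

Lemma code_joinsP e x y : joins ends e x y ->
  code e = (label x, label y) \/ code e = (label y, label x).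
Proof. by rewrite -code_joins => /orP[/eqP|/eqP]; [left|right]. Qed.

Lemma code_mem_ends e (x : V) :
  (label x \in [:: (code e).1; (code e).2]) =
  ((x == (ends e).1) || (x == (ends e).2)).
Proof.
rewrite /code; case: (ends e) => u v /=; rewrite !inE /minn /maxn.
by case: ltnP => _; rewrite !label_eq // orbC.
Qed.

Lemma mem_code_vertices (F : seq E) (x : V) :
  (label x \in code_vertices (map code F)) =
  (x \in vertices_of ends [set e in F]).
Proof.
rewrite inE /code_vertices -map_comp; apply/flatten_mapP/exists_inP.
  by case=> e eF; rewrite code_mem_ends => xe; exists e; rewrite ?inE.
by case=> e; rewrite inE => eF xe; exists e; rewrite // code_mem_ends.
Qed.

Lemma code_vertices_label (F : seq E) i :
  i \in code_vertices (map code F) -> exists x, i = label x.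
Proof.
rewrite /code_vertices -map_comp => /flatten_mapP[e _].
rewrite /code /= !inE /minn /maxn.
by case: ltnP => _ /orP[] /eqP ->; eexists.
Qed.

Lemma sp_check_sound k (F : seq E) x y : uniq F ->
  sp_check k (map code F) (label x) (label y) -> sp_part ends [set e in F] x y.
Proof.
elim: k F x y => [|k IH] //= F x y uF /orP[].
  case: F uF => [|e [|//]] //= _; rewrite label_eq code_joins => /andP[exy xy].
  have -> : [set e0 in [:: e]] = [set e] by apply/setP => e0; rewrite !inE.
  exact: sp_single.
case/hasP=> m; rewrite size_map => /size_bool_masks szm.
rewrite -!map_mask; set F1 := mask m F; set F2 := mask _ F.
have pF : perm_eq (F1 ++ F2) F by apply: perm_mask_cat.
have := uF; rewrite -(perm_uniq pF) cat_uniq => /and3P[u1 disj u2].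
have FE : [set e in F] = [set e in F1] :|: [set e in F2].
  by apply/setP => e; rewrite !inE -(perm_mem pF) mem_cat.
have dis : [disjoint [set e in F1] & [set e in F2]].
  rewrite disjoint_sym disjoint_subset; apply/subsetP => e; rewrite !inE => e2.
  by apply: contra disj => e1; apply/hasP; exists e.
set I := undup _.
have IE z : (label z \in I) = (z \in vertices_of ends [set e in F1]
    :&: vertices_of ends [set e in F2]).
  by rewrite mem_undup mem_filter !mem_code_vertices in_setI andbC.
have Ilab i : i \in I -> exists x, i = label x.
  by rewrite mem_undup mem_filter => /andP[/code_vertices_label].
case: I IE Ilab => [|i [|j [|]]] //= IE Ilab.
  have [z iE] := Ilab i (mem_head _ _); rewrite iE in IE *.
  case/andP=> /(IH _ _ _ u1) h1 /(IH _ _ _ u2) h2; rewrite FE.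
  apply: sp_series h1 h2 dis _.
  by apply/setP => v; rewrite -IE !inE label_eq.
case/and3P=> ij /(IH _ _ _ u1) h1 /(IH _ _ _ u2) h2; rewrite FE.
apply: sp_parallel h1 h2 dis _.
apply/setP => v; rewrite -IE !inE.
by case/orP: ij => /andP[/eqP-> /eqP->]; rewrite !label_eq // orbC.
Qed.

Lemma simple_code_paths_complete (L : seq (nat * nat)) :
  (forall e, code e \in L) -> forall w x k vis,
  walk ends x w -> uniq (x :: unzip2 w) -> last x (unzip2 w) = t ->
  (forall y, y \in unzip2 w -> label y \notin vis) -> size w <= k ->
  map code (unzip1 w) \in simple_code_paths L k (label x) vis.
Proof.
move=> eL; elim=> [|[e y] w IH] x k vis /=.
  by move=> _ _ -> _ _; case: k => [|k] /=; rewrite label_sink inE.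
move=> /andP[exy yw] /andP[xnot uy] lt visP.
case: k => // k; rewrite ltnS => szw /=.
(* The enumeration stops at the sink; a simple path that still has a step to make is not there
   yet. *)
have -> : (label x == 1) = false.
  rewrite -label_sink label_eq; apply/eqP => xt; move: xnot.
  by rewrite xt -lt mem_last.
apply/flatten_mapP; exists (code e) => //.
apply/flatten_mapP; exists (label y).
  have xy : (label y == label x) = false.
    by rewrite label_eq; apply: contraNF xnot => /eqP ->; rewrite mem_head.
  rewrite /step mem_cat; case: (code_joinsP exy) => -> /=.
    by rewrite eqxx mem_head.
  by rewrite eqxx mem_head orbT.
rewrite (negPf (visP y (mem_head _ _))); apply: map_f; apply: IH => //.
move=> z zw; rewrite inE negb_or label_eq visP ?inE ?zw ?orbT // andbT.
by case/andP: uy => ynot _; apply: contraNneq ynot => <-.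
Qed.
End Coding.

Lemma perm_map_ex (T T' : eqType) (f : T -> T') (s : seq T) (L : seq T') :
  perm_eq L (map f s) -> exists2 s', perm_eq s' s & L = map f s'.
Proof.
elim: L s => [|x L IH] s pL.
  by case: s pL => [|y s] /perm_size //; exists [::].
have /mapP[y ys xE] : x \in map f s by rewrite -(perm_mem pL) mem_head.
have ps := perm_to_rem ys; have := perm_map f ps.
rewrite -(permPl pL) /= -xE perm_cons => /IH[s' ps' ->].
by exists (y :: s'); rewrite /= ?xE // perm_sym (permPl ps) perm_cons perm_sym.
Qed.

(** * Vertex degrees and reduction to the enumeration *)

Section Degrees.
Variables (V E : finType) (ends : E -> V * V) (s t : V).
Hypotheses (s_neq_t : s != t)
  (conn : forall x y, connect (adjacent ends) x y)
  (cover : forall e, exists2 w, simple_path ends s t w & e \in unzip1 w).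

Definition incident (e : E) (v : V) : bool :=
  (v == (ends e).1) || (v == (ends e).2).

Lemma joins_incident e x y v :
  joins ends e x y -> incident e v = (v == x) || (v == y).
Proof. by rewrite /joins /incident => /orP[] /eqP -> //=; rewrite orbC. Qed.

Lemma incident_walk x w e v : walk ends x w -> e \in unzip1 w ->
  incident e v -> v \in x :: unzip2 w.
Proof.
elim: w x => [//|[e' y] w IH] x /= /andP[exy yw]; rewrite in_cons.
case/orP=> [/eqP ->|ew ev].
  by rewrite (joins_incident _ exy) !inE => /orP[] ->; rewrite ?orbT.
by rewrite in_cons IH ?orbT.
Qed.

Lemma two_incident x w v : walk ends x w -> uniq (x :: unzip2 w) ->
  v \in unzip2 w -> last x (unzip2 w) != v ->
  exists e e', [/\ e != e', incident e v & incident e' v].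
Proof.
elim: w x => [//|[e y] w IH] x /= /andP[exy yw] /andP[xnot uy].
rewrite in_cons => /orP[/eqP vy|vw] lv; last exact: IH yw uy vw lv.
case: w yw {IH} uy xnot lv => [|[e' z] w] /=; first by rewrite vy eqxx.
move=> /andP[e'yz _] _ xnot _; exists e, e'; split.
- apply: contraNneq xnot => ee; rewrite -ee in e'yz.
  have : incident e x by rewrite (joins_incident _ exy) eqxx.
  by rewrite (joins_incident _ e'yz) !inE => /orP[] ->; rewrite ?orbT.
- by rewrite (joins_incident _ exy) vy eqxx orbT.
- by rewrite (joins_incident _ e'yz) vy eqxx.
Qed.

Lemma ex_incident v : exists e, incident e v.
Proof.
have [u uv] : exists u, u != v.
  have [<-|?] := eqVneq s v; last by exists s.
  by exists t; rewrite eq_sym.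
case/connectP: (conn v u) => -[|y p] /=; first by move=> _ uE; rewrite uE eqxx in uv.
case/andP=> /existsP[e evy] _ _; exists e.
by rewrite (joins_incident _ evy) eqxx.
Qed.

Definition degree (v : V) : nat :=
  #|[pred e | (ends e).1 == v]| + #|[pred e | (ends e).2 == v]|.

Lemma sum_degree : \sum_v degree v = #|E|.*2.
Proof.
have sum1 (f : E -> V) : \sum_v #|[pred e | f e == v]| = #|E|.
  rewrite -sum1_card (partition_big f xpredT) //=.
  by apply: eq_bigr => v _; rewrite sum1_card.
by rewrite big_split /= !sum1 addnn.
Qed.

Lemma degree_gt0 v : 0 < degree v.
Proof.
have [e /orP[] /eqP ev] := ex_incident v; rewrite addn_gt0.
  by apply/orP; left; apply/card_gt0P; exists e; rewrite inE ev.
by apply/orP; right; apply/card_gt0P; exists e; rewrite inE ev.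
Qed.

Lemma degree_gt1 v : v != s -> v != t -> 1 < degree v.
Proof.
move=> vs vt; have [e ev] := ex_incident v.
have [w /and3P[ww uw /eqP lt] ew] := cover e.
have vw : v \in unzip2 w.
  by have := incident_walk ww ew ev; rewrite in_cons (negPf vs).
have [|e1 [e2 [e12 v1 v2]]] := two_incident ww uw vw; first by rewrite lt eq_sym.
have pos (f : E -> V) e0 : v == f e0 -> 0 < #|[pred e | f e == v]|.
  by move=> /eqP fe; apply/card_gt0P; exists e0; rewrite inE fe.
have pos2 (f : E -> V) : v == f e1 -> v == f e2 -> 1 < #|[pred e | f e == v]|.
  move=> /eqP f1 /eqP f2; apply/card_gt1P; exists e1, e2.
  by rewrite !inE -f1 -f2.
case/orP: v1 => v1; case/orP: v2 => v2.
- by apply: leq_trans (leq_addr _ _); apply: (pos2 (fun e => (ends e).1)).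
- by apply: (@leq_add 1 1); [exact: pos v1 | exact: pos v2].
- by apply: (@leq_add 1 1); [exact: pos v2 | exact: pos v1].
- by apply: leq_trans (leq_addl _ _); apply: (pos2 (fun e => (ends e).2)).
Qed.

(** Handshake: the degrees add up to 10, each terminal contributes at least 1 and each other vertex
    at least 2. *)
Lemma card_vertices_le : #|E| = 5 -> #|V| <= 6.
Proof.
move=> cardE; have := sum_degree; rewrite cardE (bigD1 s) //= (bigD1 t) 1?eq_sym //=.
set S := \sum_(v | _) _ => SE.
have rest : (#|V| - 2) * 2 <= S.
  rewrite [_ * 2](_ : _ = \sum_(v | (v != s) && (v != t)) 2).
    by apply: leq_sum => v /andP[vs vt]; exact: degree_gt1.
  rewrite sum_nat_const; congr (_ * _).
  rewrite -cardsT (cardsD1 s) (cardsD1 t) !inE [t == s]eq_sym s_neq_t /= !add1n subn2 /=.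
  by apply: eq_card => v; rewrite !inE andbT andbC.
have := degree_gt0 s; have := degree_gt0 t; move: SE rest.
case: (#|V|) => [|[|n]] //=; rewrite subSS subn1 /= => SE rest d1 d2.
have : n * 2 + 2 <= 10.
  have <- : 5.*2 = 10 by [].
  rewrite -SE addnC; apply: leq_trans (leq_add (leq_add d2 d1) rest) _.
  by rewrite addnA.
by rewrite -[10]/(4 * 2 + 2) leq_add2r leq_pmul2r.
Qed.

Lemma no_loop e : (ends e).1 != (ends e).2.
Proof.
have [w /and3P[ww uw _]] := cover e.
elim: w (s) ww uw => [//|[e' y] w IH] x /= /andP[exy yw] /andP[xnot uy].
rewrite inE => /orP[/eqP ->|]; last exact: IH yw uy.
have xy : x != y by apply: contraNneq xnot => ->; rewrite mem_head.
by move: exy; rewrite /joins => /orP[] /eqP -> //=; rewrite eq_sym.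
Qed.

Local Notation label := (label s t).
Local Notation code := (code ends s t).

Lemma code_below e : code e \in pairs_below #|V|.
Proof.
have := no_loop e; rewrite /code -(label_eq s t).
have l1 := label_lt s_neq_t (ends e).1; have l2 := label_lt s_neq_t (ends e).2.
move: l1 l2; set i := label _; set j := label _ => l1 l2 ij.
apply/flatten_mapP; exists (minn i j).
  by rewrite mem_iota /= gtn_min l1.
apply: map_f; rewrite mem_iota; move: ij; rewrite neq_ltn.
rewrite /minn /maxn; case: ltnP => [ij _|ji]; first by rewrite ij subnKC.
by move=> /= ji'; rewrite ji' subnKC.
Qed.

Lemma five_edges_bridge : #|E| = 5 -> ~ sp_part ends [set: E] s t ->
  exists p q e1 e2 e3 e4 e5,
  [/\ uniq [:: s; t; p; q], forall v, v \in [:: s; t; p; q],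
      perm_eq [:: e1; e2; e3; e4; e5] (enum E)
    & [/\ joins ends e1 s p, joins ends e2 s q, joins ends e3 t p,
          joins ends e4 t q & joins ends e5 p q]].
Proof.
move=> card5 nsp; have nV := card_vertices_le card5.
have V2 : 2 <= #|V|.
  by rewrite -(size_vertex_order s_neq_t).
have [L LU pL] : exists2 L, L \in multisets (pairs_below #|V|) 5
    & perm_eq L (map code (enum E)).
  apply: multisets_complete; last by rewrite size_map -cardE.
  by move=> _ /mapP[e _ ->]; exact: code_below.
have [es pes LE] : exists2 es, perm_eq es (enum E) & L = map code es.
  by have [es pes ->] := perm_map_ex pL; exists es.
have eL e : code e \in L by rewrite LE map_f // (perm_mem pes) mem_enum.
have ues : uniq es by rewrite (perm_uniq pes) enum_uniq.
have esT : [set e in es] = [set: E].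
  by apply/setP => e; rewrite !inE (perm_mem pes) mem_enum.
have := five_edge_check => /allP/(_ #|V|).
rewrite mem_iota V2 /= => /(_ nV)/allP/(_ L LU).
have -> : all (mem (code_vertices L)) (iota 0 #|V|).
  apply/allP => i; rewrite mem_iota /= => iV.
  rewrite -(size_vertex_order s_neq_t) in iV.
  have -> : i = label (nth s (vertex_order s t) i).
    by rewrite /label index_uniq // uniq_vertex_order.
  set v := nth _ _ _; have [e ev] := ex_incident v.
  rewrite /= LE mem_code_vertices // inE; apply/exists_inP; exists e => //.
  by rewrite inE (perm_mem pes) mem_enum.
have -> : all_on_simple_path L.
  apply/allP => c; rewrite {1}LE => /mapP[e _ ->].
  have [w /and3P[ww uw /eqP lt] ew] := cover e.
  apply/hasP; exists (map code (unzip1 w)); last by rewrite map_f.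
  suff: map code (unzip1 w) \in simple_code_paths L 6 (label s) [:: 0].
    by rewrite label_source.
  apply: simple_code_paths_complete => //.
    move=> y yw; rewrite inE -(label_source s t) label_eq.
    by case/andP: uw => sw _; apply: contraNneq sw => <-.
  (* At most six vertices means at most five steps, which is within the fuel 6. *)
  have : size (s :: unzip2 w) <= #|V|.
    by rewrite -(card_uniqP uw) max_card.
  by rewrite /= size_map => szw; exact: ltnW (leq_trans szw nV).
case/orP=> [chk|/andP[/eqP V4 /eqP LB]].
  case: nsp; rewrite -esT; apply: (@sp_check_sound _ _ _ s t 5) => //.
  by rewrite -LE label_source label_sink.
have szo := size_vertex_order s_neq_t; rewrite V4 in szo.
have uo := uniq_vertex_order s_neq_t; have mo := mem_vertex_order s t.
have [p [q oE]] : exists p q, vertex_order s t = [:: s; t; p; q].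
  move: szo; rewrite /vertex_order; case: [seq _ <- _ | _] => [|p [|q [|]]] //= _.
  by exists p, q.
have labp : label p = 2.
  move: uo; rewrite /label oE /= !inE !negb_or -!andbA.
  by move=> /and5P[_ /negPf-> _ /negPf-> _]; rewrite eqxx.
have labq : label q = 3.
  move: uo; rewrite /label oE /= !inE !negb_or -!andbA.
  by move=> /and5P[_ _ /negPf-> _ /and3P[/negPf-> /negPf-> _]]; rewrite eqxx.
move: LE; rewrite LB; case: es pes {ues esT} => [|e1 [|e2 [|e3 [|e4 [|e5 [|]]]]]] //.
move=> pes [c1 c2 c3 c4 c5 c6 c7 c8 c9 c10].
exists p, q, e1, e2, e3, e4, e5; split=> //.
- by move: uo; rewrite oE.
- by move=> v; move: (mo v); rewrite oE.
have ls := label_source s t; have lt := label_sink s_neq_t.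
by split; rewrite -(code_joins ends s t) ?ls ?lt ?labp ?labq;
  apply/orP; left; apply/eqP; rewrite [code _]surjective_pairing; congr pair.
Qed.
End Degrees.

Import Order.TTheory GRing.Theory Num.Theory.
Local Open Scope ring_scope.

(** * Quadratic equations *)

Section RealLemmas.
Variable R : rcfType.
Implicit Types (x y k p q r : R).

(** The form in which polynomial hypotheses are used below: [k] is an explicit cofactor that turns
    the goal into an identity for [ring] or [field]. *)
Lemma eq_of_multiple x y k p : p = 0 -> x - y = k * p -> x = y.
Proof. by move=> -> /eqP; rewrite mulr0 subr_eq0 => /eqP. Qed.

Definition quad_root p q r (e : bool) : R :=
  (q + (-1) ^+ e * Num.sqrt (q ^+ 2 - 4 * p * r)) / (2 * p).

Lemma quad_rootP p q r x : p != 0 ->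
  p * x ^+ 2 - q * x + r = 0 <->
  0 <= q ^+ 2 - 4 * p * r /\ exists e, x = quad_root p q r e.
Proof.
move=> p0; split=> [px0|[D_ge0 [e ->]]].
  have DE : q ^+ 2 - 4 * p * r = (2 * p * x - q) ^+ 2.
    by apply: (@eq_of_multiple _ _ (- 4 * p) _ px0); ring.
  split; first by rewrite DE sqr_ge0.
  (* The square root is the absolute value of [2 * p * x - q], and the chosen sign restores its
     sign. *)
  exists (2 * p * x - q < 0); rewrite /quad_root DE sqrtr_sqr mulr_sign_norm.
  by field.
rewrite /quad_root; set w := Num.sqrt _.
have w2 : w ^+ 2 = q ^+ 2 - 4 * p * r by rewrite sqr_sqrtr.
have -> : r = (q ^+ 2 - ((-1) ^+ e * w) ^+ 2) / (4 * p).
  by rewrite exprMn sqrr_sign mul1r w2; field.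
by field.
Qed.
End RealLemmas.

Ltac field_nz := field;
  repeat match goal with |- is_true (_ && _) => apply/andP; split end;
  assumption.

Ltac positivity := repeat first
  [ assumption | split
  | match goal with
    | |- is_true (0 < _ + _) => apply: addr_gt0
    | |- is_true (0 < _ * _) => apply: mulr_gt0
    | |- is_true (0 < _ ^+ _) => apply: exprn_gt0
    | |- is_true (0 < _ ^-1) => rewrite invr_gt0
    end ].

(** * Element values of the canonical bridges *)

Ltac unfold_minors := unfold B11, B12, B13, B23, B33, Delta1, Delta2, M13.

Section Classes.
Variable R : realType.
Implicit Types (a d : {poly R}) (x y c L T : R).

(* [fits7], ..., [fits10]: (a, d) is, up to the factor [c], the impedance of
   the bridge whose elements 1, ..., 5 (see [bridge_num] below) have the
   values [x1], ..., [x5] and are of the kinds SDIDS, SDDIS, SDDSI and SDISD,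
   respectively, with S, D, I for spring, damper, inerter. *)
Definition fits a d c (n0 n1 n2 n3 m0 m1 m2 m3 : R) : Prop :=
  [/\ 0 < c, [/\ c * a`_0 = n0, c * a`_1 = n1, c * a`_2 = n2 & c * a`_3 = n3]
    & [/\ c * d`_0 = m0, c * d`_1 = m1, c * d`_2 = m2 & c * d`_3 = m3]].

Definition fits7 a d c x1 x2 x3 x4 x5 : Prop :=
  fits a d c
    (x1 * x5) ((x1 + x5) * (x2 + x4)) (x3 * x5) (x3 * (x2 + x4))
    (x1 * x4 * x5) (x1 * x2 * x4 + x1 * x3 * x5 + x2 * x4 * x5)
    (x3 * (x1 * x2 + x1 * x4 + x2 * x5)) (x2 * x3 * x4).

Definition fits8 a d c x1 x2 x3 x4 x5 : Prop :=
  fits a d c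
    (x1 * x5) (x1 * x2 + x2 * x5 + x3 * x5) (x1 * x4 + x2 * x3 + x4 * x5)
    (x3 * x4)
    (x1 * x3 * x5) (x1 * x2 * x3 + x1 * x4 * x5 + x2 * x3 * x5)
    (x4 * (x1 * x3 + x1 * x2 + x2 * x5)) (x2 * x3 * x4).

Definition fits9 a d c x1 x2 x3 x4 x5 : Prop :=
  fits a d c
    (x1 * x4) (x1 * x2 + x3 * x4) (x2 * x3 + x5 * (x1 + x4)) (x5 * (x2 + x3))
    (x1 * x4 * (x2 + x3)) (x2 * x3 * (x1 + x4) + x1 * x4 * x5)
    (x5 * (x1 * x3 + x2 * x4)) (x2 * x3 * x5).

Definition fits10 a d c x1 x2 x3 x4 x5 : Prop :=
  fits a d c
    (x1 * x4) (x1 * x2 + x5 * (x1 + x4)) (x3 * x4 + x2 * x5) (x3 * (x2 + x5))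
    (x1 * x4 * (x2 + x5)) (x1 * x3 * x4 + x2 * x4 * x5)
    (x3 * (x1 * x2 + x2 * x4 + x1 * x5)) (x2 * x3 * x5).

Definition eqns9_1 a d (G P : R) : Prop :=
  a`_0 * (d`_0 * d`_3 * G ^+ 2 - a`_0 * a`_3) * P ^+ 3
    - (a`_1 * d`_0 * d`_3 * G ^+ 2 + a`_0 * a`_3 * d`_1 * G
       - 2 * a`_0 * a`_1 * a`_3) * G * P ^+ 2
    + a`_1 * a`_3 * (d`_1 * G - a`_1) * G ^+ 2 * P
    - a`_0 * a`_3 * d`_3 * G ^+ 4 = 0 /\
  a`_0 ^+ 2 * d`_0 * P ^+ 4 - 2 * a`_0 * a`_1 * d`_0 * G * P ^+ 3
    + d`_0 * (a`_1 ^+ 2 + a`_0 * a`_2) * G ^+ 2 * P ^+ 2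
    + (a`_0 * d`_0 * d`_3 * G ^+ 2 - a`_1 * a`_2 * d`_0 * G
       - a`_0 ^+ 2 * a`_3) * G ^+ 2 * P
    + a`_0 * a`_1 * a`_3 * G ^+ 3 = 0.

Definition eqns10_1 a d (G P : R) : Prop :=
  d`_0 ^+ 2 * P ^+ 3 - a`_1 * d`_0 * P ^+ 2 + a`_2 * d`_0 * G * P
    - a`_0 * a`_3 * G = 0 /\
  d`_0 ^+ 2 * P ^+ 3 + d`_0 * (d`_1 * G - 2 * a`_1) * P ^+ 2
    - a`_1 * (d`_1 * G - a`_1) * P + a`_0 * d`_3 * G ^+ 2 = 0.

Lemma fits_coef {a d c n0 n1 n2 n3 m0 m1 m2 m3} :
  fits a d c n0 n1 n2 n3 m0 m1 m2 m3 ->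
  [/\ 0 < c^-1,
      [/\ a`_0 = c^-1 * n0, a`_1 = c^-1 * n1, a`_2 = c^-1 * n2
        & a`_3 = c^-1 * n3]
    & [/\ d`_0 = c^-1 * m0, d`_1 = c^-1 * m1, d`_2 = c^-1 * m2
        & d`_3 = c^-1 * m3]].
Proof.
case=> c_gt0 [<- <- <- <-] [<- <- <- <-].
by rewrite invr_gt0 c_gt0 !mulKf ?gt_eqF.
Qed.

Section Necessity.
Variables (a d : {poly R}) (c x1 x2 x3 x4 x5 : R).
Hypotheses (x1_gt0 : 0 < x1) (x2_gt0 : 0 < x2) (x3_gt0 : 0 < x3)
  (x4_gt0 : 0 < x4) (x5_gt0 : 0 < x5).

Lemma fits7_cond : fits7 a d c x1 x2 x3 x4 x5 -> cond7a a d.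
Proof.
case/fits_coef; set k := c^-1; rewrite /cond7a; unfold_minors.
move=> k_gt0 [-> -> -> ->] [-> -> -> ->].
have pos n y : 0 < y -> 0 < k ^+ n * y by move=> ?; rewrite mulr_gt0 ?exprn_gt0.
split.
- have -> : k * (x3 * (x2 + x4)) * (k * (x1 * x4 * x5)) -
    k * (x1 * x5) * (k * (x2 * x3 * x4)) = k ^+ 2 * (x1 * x3 * x5 * x4 ^+ 2).
    by ring.
  by rewrite pos ?mulr_gt0 ?exprn_gt0.
- set D := (X in 0 < X).
  have -> : D = k ^+ 2 * (x3 ^+ 2 * x1 * x5 * (x2 + x4)) by rewrite /D; ring.
  by rewrite pos ?mulr_gt0 ?exprn_gt0 ?addr_gt0.
- by ring.
- by ring.
Qed.

(** Lambda is the value of the inerter [x4]. The second inequality, behind the maximum in the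
    condition, holds because the quantity equals [x1 * x3 ^+ 2 * x5 ^+ 2] up to the factor
    [c^-1 ^+ 2]. *)
Lemma fits8_cond : fits8 a d c x1 x2 x3 x4 x5 ->
  [/\ 0 < x4, 0 < B11 a d + a`_0 ^+ 2 * x4,
     a`_0 ^+ 2 * B33 a d * x4 ^+ 2
       - (B13 a d * M13 a d - B11 a d * B33 a d) * x4
       + d`_3 ^+ 2 * B11 a d = 0
   & eqns8_1 a d x4].
Proof.
case/fits_coef; set k := c^-1; rewrite /eqns8_1; unfold_minors.
move=> k_gt0 [-> -> -> ->] [-> -> -> ->].
split; [by [] | | by ring | split; by ring].
set D := (X in 0 < X).
have -> : D = k ^+ 2 * (x1 * x3 ^+ 2 * x5 ^+ 2) by rewrite /D; ring.
by rewrite !mulr_gt0 ?exprn_gt0.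
Qed.

(** Gamma and Phi are the reciprocals of the damper [x2] and of the spring [x4]. The equation for
    [G] says that [x2] and [x3] have sum [d_0 / a_0] and product [d_0 d_3 / (a_0 a_3)]. *)
Lemma fits9_cond : fits9 a d c x1 x2 x3 x4 x5 ->
  let G := x2^-1 in let P := x4^-1 in
  [/\ d`_0 * d`_3 * G ^+ 2 - a`_3 * d`_0 * G + a`_0 * a`_3 = 0,
      a`_0 * a`_3 * d`_0 * d`_2 * G * P ^+ 2
       - (a`_1 * a`_3 * d`_0 * d`_2 * G ^+ 2
          - (d`_0 ^+ 2 * d`_3 ^+ 2 * G ^+ 4 - a`_0 ^+ 2 * a`_3 ^+ 2)) * P
       + a`_0 * a`_1 * a`_3 ^+ 2 * G = 0,
      0 < P / G < a`_1 / a`_0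
    & eqns9_1 a d G P].
Proof.
case/fits_coef; set k := c^-1; rewrite /eqns9_1.
move=> k_gt0 [-> -> -> ->] [-> -> -> ->].
have [k0 x10 x20 x40] : [/\ k != 0, x1 != 0, x2 != 0 & x4 != 0].
  by rewrite !gt_eqF.
split; [by field; rewrite ?x20 ?x40| by field; rewrite ?x20 ?x40 | |].
  rewrite invrK mulr_gt0 ?invr_gt0 //= -subr_gt0.
  set D := (X in 0 < X).
  have -> : D = x3 / x1 by rewrite /D; field; rewrite ?k0 ?x10 ?x40.
  by rewrite divr_gt0.
by split; field; rewrite ?x20 ?x40.
Qed.

(** The equation for [G] is the one of [fits9], with the dampers [x2] and [x5]. Shifting [P] by
    [d_3 / d_2 * G] gives a quadratic equation whose coefficients are free of [G], so the radicand
    of Psi does not depend on Gamma. *)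
Lemma fits10_cond : fits10 a d c x1 x2 x3 x4 x5 ->
  let G := x2^-1 in let P := x4^-1 in
  [/\ d`_0 * d`_3 * G ^+ 2 - a`_3 * d`_0 * G + a`_0 * a`_3 = 0,
      d`_0 * d`_2 * (P + d`_3 / d`_2 * G) ^+ 2
       - (a`_1 * d`_2 + a`_3 * d`_0) * (P + d`_3 / d`_2 * G)
       + (a`_1 * a`_3 + a`_0 * a`_3 * d`_3 / d`_2) = 0,
      0 < P < a`_1 / d`_0
    & eqns10_1 a d G P].
Proof.
case/fits_coef; set k := c^-1; rewrite /eqns10_1.
move=> k_gt0 [-> -> -> ->] [-> -> -> ->].
have [k0 x10 x20 x40] : [/\ k != 0, x1 != 0, x2 != 0 & x4 != 0].
  by rewrite !gt_eqF.
have x30 : x3 != 0 by rewrite gt_eqF.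
have x250 : x2 + x5 != 0 by rewrite gt_eqF ?addr_gt0.
have s0 : x1 * x2 + x2 * x4 + x1 * x5 != 0.
  by rewrite gt_eqF // !addr_gt0 ?mulr_gt0.
split; [by field; rewrite ?x20 ?x40 | field | | ].
- by rewrite ?x20 ?x40 ?x30 ?k0 ?s0.
- rewrite invr_gt0 x4_gt0 /= -subr_gt0.
  set D := (X in 0 < X).
  have -> : D = x5 / (x1 * x4 * (x2 + x5)) * (x1 + x4) - x5 / (x4 * (x2 + x5)).
    by rewrite /D; field; rewrite ?k0 ?x10 ?x40 ?x250.
  have -> : x5 / (x1 * x4 * (x2 + x5)) * (x1 + x4) - x5 / (x4 * (x2 + x5)) =
    x5 / (x1 * (x2 + x5)) by field; rewrite ?k0 ?x10 ?x40 ?x250.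
  by rewrite divr_gt0 ?mulr_gt0 ?addr_gt0.
by split; field; rewrite ?x20 ?x40.
Qed.
End Necessity.
End Classes.

(** * Solving for the element values *)

Section Sufficiency.
Variables (R : realType) (a d : {poly R}).
Hypotheses (a_gt0 : forall i : nat, (i < 4)%N -> 0 < a`_i)
  (d_gt0 : forall j : nat, (j < 4)%N -> 0 < d`_j).

Lemma cond7a_fits : cond7a a d ->
  exists c x1 x2 x3 x4 x5 : R,
  [/\ 0 < x1, 0 < x2, 0 < x3, 0 < x4 & 0 < x5] /\ fits7 a d c x1 x2 x3 x4 x5.
Proof.
have [a0_gt0 a1_gt0 a2_gt0 a3_gt0] :
  [/\ 0 < a`_0, 0 < a`_1, 0 < a`_2 & 0 < a`_3] by rewrite !a_gt0.
have [d0_gt0 d1_gt0 d2_gt0 d3_gt0] :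
  [/\ 0 < d`_0, 0 < d`_1, 0 < d`_2 & 0 < d`_3] by rewrite !d_gt0.
case; set b := B13 a d; set b' := B23 a d; set D := Delta1 a => b_gt0 b'_gt0.
move=> E1 E2.
have D_gt0 : 0 < D.
  by rewrite -(pmulr_rgt0 _ (mulr_gt0 b_gt0 b'_gt0)) (subr0_eq E2) !mulr_gt0
    ?exprn_gt0.
have [a0 a1 a2 a3] : [/\ a`_0 != 0, a`_1 != 0, a`_2 != 0 & a`_3 != 0].
  by rewrite !gt_eqF.
have [d0 d3 bn Dn] : [/\ d`_0 != 0, d`_3 != 0, b != 0 & D != 0].
  by rewrite !gt_eqF.
(* The remaining coefficients become rational functions of [a_0], [a_2], [a_3], [d_0], [b] and [D],
   which leaves only rational identities to check. *)
have a1E : a`_1 = (D + a`_0 * a`_3) / a`_2 by rewrite /D /Delta1; field_nz.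
have d3E : d`_3 = (a`_3 * d`_0 - b) / a`_0 by rewrite /b /B13; field_nz.
have b'E : b' = a`_2 ^+ 2 * a`_3 ^+ 2 * d`_0 ^+ 2 / (b * D).
  by apply: (eq_of_multiple (k := (b * D)^-1) E2); field_nz.
have d1E : d`_1 = (a`_1 * d`_3 + b') / a`_3 by rewrite /b' /B23; field_nz.
have d2E : d`_2 = (a`_2 ^+ 2 * d`_0 * d`_3 / b + b') / a`_2.
  by apply: (eq_of_multiple (k := (b * a`_2)^-1) E1); field_nz.
(* In the network, [d_0 = a_0 x4], [d_0 d_3 = b x2] and [d_0^2 a_2 = a_0 b x5], while [D] is
   [x3 x5^2 (x2 + x4) / c^2]; the witnesses solve these relations. *)
set x5 := d`_0 ^+ 2 * a`_2 / (a`_0 * b).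
have x5_gt0 : 0 < x5 by rewrite /x5; positivity.
set c := x5 ^+ 2 * a`_3 / D.
have c_gt0 : 0 < c by rewrite /c; positivity.
exists c, (a`_0 * c / x5), (d`_0 * d`_3 / b), (a`_2 * c / x5), (d`_0 / a`_0), x5.
split; first by positivity.
split=> //; rewrite /c /x5; split;
  rewrite ?d2E ?d1E ?b'E ?a1E ?d3E; field_nz.
Qed.

(** Everything is expressed through [a_0], [a_3], [d_0], [d_3], [L] and [w]: the second equation of
    [eqns8_1] is linear in [a_1] once [w] is introduced, [w] itself gives [d_1], the first equation
    gives [a_2] and the quadratic one gives [d_2]. *)
Lemma cond8_fits L : 0 < L -> 0 < B11 a d + a`_0 ^+ 2 * L ->
  a`_0 ^+ 2 * B33 a d * L ^+ 2
    - (B13 a d * M13 a d - B11 a d * B33 a d) * L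
    + d`_3 ^+ 2 * B11 a d = 0 ->
  eqns8_1 a d L ->
  exists c x1 x2 x3 x4 x5 : R,
  [/\ 0 < x1, 0 < x2, 0 < x3, 0 < x4 & 0 < x5] /\ fits8 a d c x1 x2 x3 x4 x5.
Proof.
have [a0_gt0 a1_gt0 a2_gt0 a3_gt0] :
  [/\ 0 < a`_0, 0 < a`_1, 0 < a`_2 & 0 < a`_3] by rewrite !a_gt0.
have [d0_gt0 d1_gt0 d2_gt0 d3_gt0] :
  [/\ 0 < d`_0, 0 < d`_1, 0 < d`_2 & 0 < d`_3] by rewrite !d_gt0.
move=> L_gt0; set w := B11 a d + _ => w_gt0 EL [E1 E2].
have [a0 a3 Ln wn] : [/\ a`_0 != 0, a`_3 != 0, L != 0 & w != 0].
  by rewrite !gt_eqF.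
have [d0 d3] : d`_0 != 0 /\ d`_3 != 0 by rewrite !gt_eqF.
have E2' : a`_0 * a`_3 * d`_0 ^+ 3 * d`_3 + L * w ^+ 2 * M13 a d
    - a`_1 * d`_0 ^+ 2 * a`_3 * L * w = 0.
  by apply: (eq_of_multiple (k := a`_0) E2); rewrite /w; unfold_minors; ring.
have a1E : a`_1 = (a`_0 * a`_3 * d`_0 ^+ 3 * d`_3
    + L * w ^+ 2 * (a`_3 * d`_0 + a`_0 * d`_3)) / (d`_0 ^+ 2 * a`_3 * L * w).
  apply: (eq_of_multiple (k := - 1 / (d`_0 ^+ 2 * a`_3 * L * w)) E2').
  by unfold_minors; field_nz.
have d1E : d`_1 = (a`_1 * d`_0 - w + a`_0 ^+ 2 * L) / a`_0.
  by rewrite /w; unfold_minors; field_nz.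
have a2E : a`_2 = (d`_0 * d`_3 ^+ 2 + a`_0 * a`_3 * d`_1 * L ^+ 2
    - a`_0 ^+ 2 * a`_3 * L ^+ 3) / (d`_0 * d`_3 * L).
  apply: (eq_of_multiple (k := 1 / (d`_0 * d`_3 * L)) E1).
  by field_nz.
have EL' : (B33 a d * L + d`_3 ^+ 2) * w - a`_3 ^+ 2 * d`_0 ^+ 2 * L = 0.
  by apply: (eq_of_multiple (k := 1) EL); rewrite /w; unfold_minors; ring.
have d2E : d`_2 = ((a`_3 ^+ 2 * d`_0 ^+ 2 * L / w - d`_3 ^+ 2) / L
    + a`_2 * d`_3) / a`_3.
  apply: (eq_of_multiple (k := 1 / (a`_3 * L * w)) EL').
  by unfold_minors; field_nz.
(* In the network, [x3 = d_0 / a_0], [x2 = d_3 / a_3], [c a_3 = x3 x4] and [w = d_0^2 / x1]. *)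
set c := d`_0 * L / (a`_0 * a`_3).
have c_gt0 : 0 < c by rewrite /c; positivity.
exists c, (d`_0 ^+ 2 / w), (d`_3 / a`_3), (d`_0 / a`_0), L.
exists (c * a`_0 * w / d`_0 ^+ 2).
split; first by positivity.
split=> //; rewrite /c; split;
  rewrite ?d2E ?a2E ?d1E ?a1E; field_nz.
Qed.

Lemma cond9_fits G P : 0 < G ->
  d`_0 * d`_3 * G ^+ 2 - a`_3 * d`_0 * G + a`_0 * a`_3 = 0 ->
  a`_0 * a`_3 * d`_0 * d`_2 * G * P ^+ 2
    - (a`_1 * a`_3 * d`_0 * d`_2 * G ^+ 2
       - (d`_0 ^+ 2 * d`_3 ^+ 2 * G ^+ 4 - a`_0 ^+ 2 * a`_3 ^+ 2)) * P
    + a`_0 * a`_1 * a`_3 ^+ 2 * G = 0 ->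
  0 < P / G < a`_1 / a`_0 -> eqns9_1 a d G P ->
  exists c x1 x2 x3 x4 x5 : R,
  [/\ 0 < x1, 0 < x2, 0 < x3, 0 < x4 & 0 < x5] /\ fits9 a d c x1 x2 x3 x4 x5.
Proof.
have [a0_gt0 a1_gt0 a2_gt0 a3_gt0] :
  [/\ 0 < a`_0, 0 < a`_1, 0 < a`_2 & 0 < a`_3] by rewrite !a_gt0.
have [d0_gt0 d1_gt0 d2_gt0 d3_gt0] :
  [/\ 0 < d`_0, 0 < d`_1, 0 < d`_2 & 0 < d`_3] by rewrite !d_gt0.
move=> G_gt0 EG EP /andP[phi_gt0]; rewrite -subr_gt0.
set phi := P / G in phi_gt0 * => u_gt0' [E1 E2].
have [a0 a3 Gn phin] : [/\ a`_0 != 0, a`_3 != 0, G != 0 & phi != 0].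
  by rewrite !gt_eqF.
have PE : P = phi * G by rewrite /phi; field_nz.
clearbody phi; move: EP E1 E2 u_gt0'; rewrite {}PE => EP E1 E2 u_gt0'.
(* [x3] is the other root of the quadratic equation satisfied by [G^-1]. *)
set x2 := G^-1; set x3 := d`_0 * d`_3 / (a`_0 * a`_3 * x2).
have GE : G = x2^-1 by rewrite invrK.
have x2_gt0 : 0 < x2 by rewrite invr_gt0.
have x3_gt0 : 0 < x3 by rewrite /x3; positivity.
have [x20 x30] : x2 != 0 /\ x3 != 0 by rewrite !gt_eqF.
have d0E : d`_0 = a`_0 * (x2 + x3).
  apply: (eq_of_multiple (k := - 1 / (a`_3 * G)) EG).
  by rewrite /x3 /x2; field_nz.
have d00 : d`_0 != 0 by rewrite gt_eqF.
have x230 : x2 + x3 != 0 by rewrite gt_eqF ?addr_gt0.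
have d3E : d`_3 = a`_3 * x2 * x3 / (x2 + x3).
  have -> : x2 + x3 = d`_0 / a`_0 by rewrite d0E; field_nz.
  by rewrite /x3; field_nz.
(* In the network, [phi] is [x2 / x4] and [u] is [x3 * x4 / c]; the upper bound on [P / G] is
   exactly [0 < u]. *)
set u := a`_1 - a`_0 * phi.
have u_gt0 : 0 < u.
  suff -> : u = a`_0 * (a`_1 / a`_0 - phi) by rewrite mulr_gt0.
  by rewrite /u; field_nz.
have un : u != 0 by rewrite gt_eqF.
have a1E : a`_1 = u + a`_0 * phi by rewrite /u; ring.
(* Now [a_0], [a_3], [x2], [x3], [phi] and [u] serve as free parameters, and the three remaining
   equations are linear in [d_2], [d_1] and [a_2] respectively. *)
clearbody u x3; clear u_gt0' EG; clearbody x2; subst G.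
have d2E : d`_2 = a`_3 / (x2 + x3) * (a`_0 * x3 ^+ 2 / u + x2 ^+ 2 / phi).
  move: EP; rewrite d0E d3E a1E => EP.
  apply: (eq_of_multiple (k := - x2 ^+ 3 / (a`_3 * a`_0 * (x2 + x3) * phi * u)) EP).
  by field_nz.
have d1E : d`_1 = a`_0 * x3 * phi + x2 * u
   + a`_0 * a`_3 * x2 * x3 / ((x2 + x3) * phi * u).
  move: E1; rewrite d0E d3E a1E => E1.
  apply: (eq_of_multiple (k := x2 ^+ 4 / (a`_3 * phi * u)) E1).
  by field_nz.
have a2E : a`_2 = phi * u + a`_3 / (x2 + x3) * (a`_0 * x3 / u + x2 / phi).
  move: E2; rewrite d0E d3E a1E => E2.
  apply: (eq_of_multiple (k := - x2 ^+ 4 / (a`_0 * (x2 + x3) * phi * u)) E2).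
  by field_nz.
set c := x2 * x3 / (phi * u).
have c_gt0 : 0 < c by rewrite /c; positivity.
exists c, (a`_0 * x3 / u), x2, x3, (x2 / phi).
exists (a`_0 * a`_3 * c / (a`_0 * (x2 + x3))).
split; first by positivity.
split=> //; rewrite /c; split;
  rewrite ?d1E ?d2E ?a2E ?d0E ?d3E ?a1E; field_nz.
Qed.

Lemma cond10_fits G P : 0 < G ->
  d`_0 * d`_3 * G ^+ 2 - a`_3 * d`_0 * G + a`_0 * a`_3 = 0 ->
  d`_0 * d`_2 * (P + d`_3 / d`_2 * G) ^+ 2
    - (a`_1 * d`_2 + a`_3 * d`_0) * (P + d`_3 / d`_2 * G)
    + (a`_1 * a`_3 + a`_0 * a`_3 * d`_3 / d`_2) = 0 ->
  0 < P < a`_1 / d`_0 -> eqns10_1 a d G P ->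
  exists c x1 x2 x3 x4 x5 : R,
  [/\ 0 < x1, 0 < x2, 0 < x3, 0 < x4 & 0 < x5] /\ fits10 a d c x1 x2 x3 x4 x5.
Proof.
have [a0_gt0 a1_gt0 a2_gt0 a3_gt0] :
  [/\ 0 < a`_0, 0 < a`_1, 0 < a`_2 & 0 < a`_3] by rewrite !a_gt0.
have [d0_gt0 d1_gt0 d2_gt0 d3_gt0] :
  [/\ 0 < d`_0, 0 < d`_1, 0 < d`_2 & 0 < d`_3] by rewrite !d_gt0.
move=> G_gt0 EG EP /andP[P_gt0]; rewrite -subr_gt0 => u_gt0' [E1 E2].
have [a0 a3 Gn Pn] : [/\ a`_0 != 0, a`_3 != 0, G != 0 & P != 0].
  by rewrite !gt_eqF.
have d20 : d`_2 != 0 by rewrite gt_eqF.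
have d00 : d`_0 != 0 by rewrite gt_eqF.
set x2 := G^-1; set x5 := d`_0 * d`_3 / (a`_0 * a`_3 * x2).
have GE : G = x2^-1 by rewrite invrK.
have x2_gt0 : 0 < x2 by rewrite invr_gt0.
have x5_gt0 : 0 < x5 by rewrite /x5; positivity.
have [x20 x50] : x2 != 0 /\ x5 != 0 by rewrite !gt_eqF.
have d0E : d`_0 = a`_0 * (x2 + x5).
  apply: (eq_of_multiple (k := - 1 / (a`_3 * G)) EG).
  by rewrite /x5 /x2; field_nz.
have x250 : x2 + x5 != 0 by rewrite gt_eqF ?addr_gt0.
have d3E : d`_3 = a`_3 * x2 * x5 / (x2 + x5).
  have -> : x2 + x5 = d`_0 / a`_0 by rewrite d0E; field_nz.
  by rewrite /x5; field_nz.
(* In the network, [u] is [x4 * x5 / c]. *)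
set u := a`_1 - d`_0 * P.
have u_gt0 : 0 < u.
  suff -> : u = d`_0 * (a`_1 / d`_0 - P) by rewrite mulr_gt0.
  by rewrite /u; field_nz.
have un : u != 0 by rewrite gt_eqF.
have a1E : a`_1 = u + a`_0 * (x2 + x5) * P by rewrite -d0E /u; ring.
clearbody u x5; clear u_gt0' EG; clearbody x2; subst G.
have d2E : d`_2 = a`_0 * a`_3 / d`_0 * (d`_0 * x5 / u + x2 / P).
  move: EP; rewrite d0E d3E a1E => EP.
  apply: (eq_of_multiple (k := - (1 / (u * P))) EP).
  by field_nz.
have a2E : a`_2 = a`_0 * a`_3 / (d`_0 * P) + x2 * P * u.
  move: E1; rewrite d0E a1E => E1.
  apply: (eq_of_multiple (k := x2 / (a`_0 * (x2 + x5) * P)) E1).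
  by field_nz.
have d1E : d`_1 = a`_0 * d`_3 / (x2 * P * u) + u * x2.
  move: E2; rewrite d0E d3E a1E => E2.
  apply: (eq_of_multiple (k := - x2 / (u * P)) E2).
  by field_nz.
set c := x5 / (P * u).
have c_gt0 : 0 < c by rewrite /c; positivity.
exists c, (a`_0 * c * P), x2, (a`_3 * c / (x2 + x5)), P^-1, x5.
split; first by positivity.
split=> //; rewrite /c; split;
  rewrite ?d1E ?d2E ?a2E ?d0E ?d3E ?a1E; field_nz.
Qed.
End Sufficiency.

(** * Explicit root formulas versus quadratic equations *)

Section RootFormulas.
Variables (R : realType) (a d : {poly R}).
Hypotheses (a_gt0 : forall i : nat, (i < 4)%N -> 0 < a`_i)
  (d_gt0 : forall j : nat, (j < 4)%N -> 0 < d`_j).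

Lemma Lambda1bP L : B33 a d != 0 ->
  a`_0 ^+ 2 * B33 a d * L ^+ 2
    - (B13 a d * M13 a d - B11 a d * B33 a d) * L
    + d`_3 ^+ 2 * B11 a d = 0 <->
  0 <= Lambda_radicand a d /\ exists e, L = Lambda1b a d e.
Proof.
move=> B33_neq0; have a0 : a`_0 != 0 by rewrite gt_eqF ?a_gt0.
have p0 : a`_0 ^+ 2 * B33 a d != 0 by rewrite mulf_neq0 ?expf_neq0.
have DE : (B13 a d * M13 a d - B11 a d * B33 a d) ^+ 2
    - 4 * (a`_0 ^+ 2 * B33 a d) * (d`_3 ^+ 2 * B11 a d) = Lambda_radicand a d.
  by rewrite /Lambda_radicand; unfold_minors; ring.
have rE e : quad_root (a`_0 ^+ 2 * B33 a d)
    (B13 a d * M13 a d - B11 a d * B33 a d) (d`_3 ^+ 2 * B11 a d) e =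
    Lambda1b a d e.
  by rewrite /quad_root DE /Lambda1b; field_nz.
rewrite (quad_rootP _ _ _ p0) DE.
by split=> -[? [e ->]]; split=> //; exists e.
Qed.

(** If [B33] vanishes, the quadratic equation degenerates to [B13 M13 L = d_3^2 B11], whose solution
    is positive when [B11] and [B13] have the same sign. The hypothesis excludes the case in which
    this equation is void. *)
Lemma cond8P : ~ [/\ B11 a d = 0, B13 a d = 0 & B33 a d = 0] ->
  (exists L, [/\ 0 < L, 0 < B11 a d + a`_0 ^+ 2 * L,
     a`_0 ^+ 2 * B33 a d * L ^+ 2
       - (B13 a d * M13 a d - B11 a d * B33 a d) * L
       + d`_3 ^+ 2 * B11 a d = 0
   & eqns8_1 a d L]) <-> cond8_1 a d \/ cond8_2 a d.
Proof.
move=> nondeg.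
have [a0 a3] : 0 < a`_0 /\ 0 < a`_3 by rewrite !a_gt0.
have [d0 d3] : 0 < d`_0 /\ 0 < d`_3 by rewrite !d_gt0.
have M_gt0 : 0 < M13 a d by rewrite /M13; positivity.
have Mn : M13 a d != 0 by rewrite gt_eqF.
split=> [[L [L_gt0 w_gt0 EL EqL]]|[[B33_0 BB_gt0 EqL]|]].
- have [B33_0|B33_neq0] := eqVneq (B33 a d) 0; last first.
    right; have [D_ge0 [e LE]] := (Lambda1bP L B33_neq0).1 EL.
    exists e; rewrite -LE; split=> //.
    by rewrite gt_max mulr_gt0 ?exprn_gt0 //= -subr_gt0 opprK addrC.
  left; move: EL; rewrite B33_0 !mulr0 mul0r subr0 add0r addrC => /subr0_eq EL.
  have [B13_0|B13_neq0] := eqVneq (B13 a d) 0.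
    case: nondeg; split=> //; move: EL; rewrite B13_0 !mul0r => /eqP.
    by rewrite mulf_eq0 expf_eq0 /= gt_eqF //= => /eqP.
  have LE : L = Lambda1a a d.
    apply: (mulfI (mulf_neq0 B13_neq0 Mn)); rewrite -EL /Lambda1a.
    by field_nz.
  split=> //; last by rewrite -LE.
  have : 0 < B13 a d ^+ 2 * M13 a d * L.
    by apply: mulr_gt0 => //; apply: mulr_gt0 => //; rewrite exprn_even_gt0.
  have -> : B13 a d ^+ 2 * M13 a d * L = d`_3 ^+ 2 * (B11 a d * B13 a d).
    by rewrite mulrA EL; ring.
  by rewrite pmulr_rgt0 ?exprn_gt0.
- have B13_neq0 : B13 a d != 0.
    by apply/eqP => B13_0; rewrite B13_0 mulr0 ltxx in BB_gt0.
  have B13_2 : 0 < B13 a d ^+ 2 by rewrite exprn_even_gt0.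
  exists (Lambda1a a d).
  have LE : Lambda1a a d =
      d`_3 ^+ 2 * (B11 a d * B13 a d) / (B13 a d ^+ 2 * M13 a d).
    by rewrite /Lambda1a; field_nz.
  have L_gt0 : 0 < Lambda1a a d.
    by rewrite LE; positivity.
  split=> //; last by rewrite B33_0 /Lambda1a; field_nz.
  (* Since [B13 M13 = a_3^2 d_0^2 - a_0^2 d_3^2], the sum collapses to a positive multiple of
     [B11 / B13]. *)
  have wE : B11 a d + a`_0 ^+ 2 * Lambda1a a d =
     a`_3 ^+ 2 * d`_0 ^+ 2 * (B11 a d * B13 a d) / (B13 a d ^+ 2 * M13 a d).
    have -> : a`_3 ^+ 2 * d`_0 ^+ 2 = B13 a d * M13 a d + a`_0 ^+ 2 * d`_3 ^+ 2.
      by unfold_minors; ring.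
    by rewrite /Lambda1a; field_nz.
  by rewrite wE; positivity.
- case=> e [B33_neq0 D_ge0]; rewrite gt_max => /andP[L_gt0 w_gt0] EqL.
  exists (Lambda1b a d e); split=> //.
  + by rewrite pmulr_rgt0 ?exprn_gt0 in L_gt0.
  + by rewrite -subr_gt0 opprK addrC in w_gt0.
  + by apply/(Lambda1bP _ B33_neq0); split=> //; exists e.
Qed.

Lemma Gamma1P G :
  d`_0 * d`_3 * G ^+ 2 - a`_3 * d`_0 * G + a`_0 * a`_3 = 0 <->
  0 <= a`_3 * d`_0 - 4 * a`_0 * d`_3 /\ exists e, G = Gamma1 a d e.
Proof.
have a3 : 0 < a`_3 by rewrite a_gt0.
have [d0 d3] : 0 < d`_0 /\ 0 < d`_3 by rewrite !d_gt0.
have p0 : d`_0 * d`_3 != 0 by rewrite gt_eqF ?mulr_gt0.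
have DE : (a`_3 * d`_0) ^+ 2 - 4 * (d`_0 * d`_3) * (a`_0 * a`_3) =
   a`_3 * d`_0 * (a`_3 * d`_0 - 4 * a`_0 * d`_3) by ring.
rewrite (quad_rootP _ _ _ p0) DE pmulr_rge0 ?mulr_gt0 // /quad_root DE.
by split=> -[? [e ->]]; split=> //; exists e; rewrite /Gamma1 ?mulrA.
Qed.

Lemma Gamma1_gt0 G :
  d`_0 * d`_3 * G ^+ 2 - a`_3 * d`_0 * G + a`_0 * a`_3 = 0 -> 0 < G.
Proof.
have [a0 a3] : 0 < a`_0 /\ 0 < a`_3 by rewrite !a_gt0.
have [d0 d3] : 0 < d`_0 /\ 0 < d`_3 by rewrite !d_gt0.
move=> EG; have : 0 < a`_3 * d`_0 * G.
  have -> : a`_3 * d`_0 * G = d`_0 * d`_3 * G ^+ 2 + a`_0 * a`_3.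
    by apply: (@eq_of_multiple _ _ _ (- 1) _ EG); ring.
  by rewrite ltr_wpDl ?mulr_gt0 // mulr_ge0 ?sqr_ge0 // ltW ?mulr_gt0.
by rewrite pmulr_rgt0 ?mulr_gt0.
Qed.

Lemma cond9P :
  (exists G P, [/\
      d`_0 * d`_3 * G ^+ 2 - a`_3 * d`_0 * G + a`_0 * a`_3 = 0,
      a`_0 * a`_3 * d`_0 * d`_2 * G * P ^+ 2
       - (a`_1 * a`_3 * d`_0 * d`_2 * G ^+ 2
          - (d`_0 ^+ 2 * d`_3 ^+ 2 * G ^+ 4 - a`_0 ^+ 2 * a`_3 ^+ 2)) * P
       + a`_0 * a`_1 * a`_3 ^+ 2 * G = 0,
      0 < P / G < a`_1 / a`_0
    & eqns9_1 a d G P]) <-> cond9_1 a d.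
Proof.
have [a0 a1 a3] : [/\ 0 < a`_0, 0 < a`_1 & 0 < a`_3] by rewrite !a_gt0.
have [d0 d2] : 0 < d`_0 /\ 0 < d`_2 by rewrite !d_gt0.
have PP G P : 0 < G -> a`_0 * a`_3 * d`_0 * d`_2 * G * P ^+ 2
       - (a`_1 * a`_3 * d`_0 * d`_2 * G ^+ 2
          - (d`_0 ^+ 2 * d`_3 ^+ 2 * G ^+ 4 - a`_0 ^+ 2 * a`_3 ^+ 2)) * P
       + a`_0 * a`_1 * a`_3 ^+ 2 * G = 0 <->
    0 <= Phi1_radicand a d G /\ exists e, P = Phi1 a d G e.
  move=> G_gt0.
  have p0 : a`_0 * a`_3 * d`_0 * d`_2 * G != 0 by rewrite gt_eqF ?mulr_gt0.
  rewrite (quad_rootP _ _ _ p0) /quad_root.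
  set D := _ ^+ 2 - 4 * _ * _.
  have DE : D = Phi1_radicand a d G by rewrite /D /Phi1_radicand; ring.
  by rewrite DE; split=> -[? [e ->]]; split=> //; exists e; rewrite /Phi1 ?mulrA.
split=> [[G [P [EG EP iP [E1 E2]]]]|[D_ge0 [e1 [e2 /= [P_ge0 iP E1 E2]]]]].
  have G_gt0 := Gamma1_gt0 EG.
  have [D_ge0 [e1 GE]] := (Gamma1P G).1 EG.
  have [P_ge0 [e2 PE]] := (PP _ _ G_gt0).1 EP.
  by split=> //; exists e1, e2; rewrite /= -GE -PE.
have EG : d`_0 * d`_3 * Gamma1 a d e1 ^+ 2 - a`_3 * d`_0 * Gamma1 a d e1
    + a`_0 * a`_3 = 0 by apply/Gamma1P; split=> //; exists e1.
exists (Gamma1 a d e1), (Phi1 a d (Gamma1 a d e1) e2); split=> //.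
by apply/PP; [exact: Gamma1_gt0 | split=> //; exists e2].
Qed.

Lemma cond10P :
  (exists G P, [/\
      d`_0 * d`_3 * G ^+ 2 - a`_3 * d`_0 * G + a`_0 * a`_3 = 0,
      d`_0 * d`_2 * (P + d`_3 / d`_2 * G) ^+ 2
       - (a`_1 * d`_2 + a`_3 * d`_0) * (P + d`_3 / d`_2 * G)
       + (a`_1 * a`_3 + a`_0 * a`_3 * d`_3 / d`_2) = 0,
      0 < P < a`_1 / d`_0
    & eqns10_1 a d G P]) <-> cond10_1 a d.
Proof.
have [d0 d2] : d`_0 != 0 /\ d`_2 != 0 by rewrite !gt_eqF ?d_gt0.
have PP G P : d`_0 * d`_2 * (P + d`_3 / d`_2 * G) ^+ 2
       - (a`_1 * d`_2 + a`_3 * d`_0) * (P + d`_3 / d`_2 * G)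
       + (a`_1 * a`_3 + a`_0 * a`_3 * d`_3 / d`_2) = 0 <->
    0 <= Psi1_radicand a d /\ exists e, P = Psi1 a d G e.
  have p0 : d`_0 * d`_2 != 0 by rewrite mulf_neq0.
  rewrite (quad_rootP _ _ _ p0) /quad_root.
  set D := _ ^+ 2 - 4 * _ * _.
  have DE : D = Psi1_radicand a d by rewrite /D /Psi1_radicand; field_nz.
  rewrite DE; split=> -[? [e E]]; split=> //; exists e.
    by rewrite /Psi1 -[P](addrK (d`_3 / d`_2 * G)) E !mulrA.
  by rewrite E /Psi1 subrK !mulrA.
split=> [[G [P [EG EP iP [E1 E2]]]]|[D_ge0 [P_ge0 [e1 [e2 /= [iP E1 E2]]]]]].
  have [D_ge0 [e1 GE]] := (Gamma1P G).1 EG.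
  have [P_ge0 [e2 PE]] := (PP _ _).1 EP.
  by do 2!split=> //; exists e1, e2; rewrite /= -GE -PE.
have EG : d`_0 * d`_3 * Gamma1 a d e1 ^+ 2 - a`_3 * d`_0 * Gamma1 a d e1
    + a`_0 * a`_3 = 0 by apply/Gamma1P; split=> //; exists e1.
exists (Gamma1 a d e1), (Psi1 a d (Gamma1 a d e1) e2); split=> //.
by apply/PP; split=> //; exists e2.
Qed.
End RootFormulas.

(** * The bridge of condition (11) *)

Section CommonFactor.
Variable R : realType.
Implicit Types (a d : {poly R}) (A B C x y T s t : R).

Lemma positive_rootsP A B C y1 y2 : A != 0 ->
  positive_roots (A *: 'X^2 - B *: 'X + C%:P) y1 y2 <->
  [/\ A * (y1 + y2) = B, A * (y1 * y2) = C, 0 < y1 & 0 < y2].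
Proof.
move=> A0; have sz : size (A *: 'X^2 - B *: 'X + C%:P) = 3%N.
  rewrite -addrA size_polyDl size_scale // size_polyXn //.
  rewrite (leq_ltn_trans (size_polyD _ _)) // size_polyN gtn_max.
  rewrite (leq_ltn_trans (size_scale_leq _ _)) ?size_polyX //.
  exact: leq_ltn_trans (size_polyC_leq1 _) _.
have lcE : lead_coef (A *: 'X^2 - B *: 'X + C%:P) = A.
  by rewrite lead_coefE sz !coefE /= !(mulr0, mulr1, subr0, addr0).
rewrite /positive_roots lcE; split=> [[_ E y1_gt0 y2_gt0]|[BE CE ? ?]].
  (* The values at 0 and 1 are enough for Vieta's formulas, as the leading coefficient is known. *)
  have E0 := congr1 (fun p : {poly R} => p.[0]) E.
  have E1 := congr1 (fun p : {poly R} => p.[1]) E.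
  rewrite !hornerE /= in E0 E1.
  by split=> //; lra.
by split=> //; rewrite -BE -CE -!mul_polyC !polyCM polyCD; ring.
Qed.

(* The numerator and the denominator of the network are [a] and [d] times the
   common factor [t X + s]. *)
Definition fits_factor a d s t (n0 n1 n2 n3 n4 m0 m1 m2 m3 m4 : R) : Prop :=
  [/\ 0 < s, 0 < t,
      [/\ s * a`_0 = n0, s * a`_1 + t * a`_0 = n1, s * a`_2 + t * a`_1 = n2,
          s * a`_3 + t * a`_2 = n3 & t * a`_3 = n4]
    & [/\ s * d`_0 = m0, s * d`_1 + t * d`_0 = m1, s * d`_2 + t * d`_1 = m2,
          s * d`_3 + t * d`_2 = m3 & t * d`_3 = m4]].

Definition fits11 a d s t x1 x2 x3 x4 x5 : Prop :=
  fits_factor a d s t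
    (x1 * x4) (x5 * (x1 + x4)) (x1 * x2 + x3 * x4) (x5 * (x2 + x3)) (x2 * x3)
    (x1 * x4 * x5) (x1 * x4 * (x2 + x3)) (x5 * (x1 * x3 + x2 * x4))
    (x2 * x3 * (x1 + x4)) (x2 * x3 * x5).

Definition fits_excluded a d s t x1 x2 x3 x4 x5 : Prop :=
  fits_factor a d s t
    (x1 * x4) (x1 * x2) (x3 * x4 + x1 * x5 + x4 * x5) (x2 * (x3 + x5))
    (x3 * x5)
    (x1 * x2 * x4) (x1 * x4 * (x3 + x5)) (x2 * (x1 * x3 + x3 * x4 + x4 * x5))
    (x1 * x3 * x5) (x2 * x3 * x5).

Lemma fits_excluded_false a d s t x1 x2 x3 x4 x5 :
  0 < x1 -> 0 < x2 -> 0 < x3 -> 0 < x4 -> 0 < x5 ->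
  ~ fits_excluded a d s t x1 x2 x3 x4 x5.
Proof.
move=> x1_gt0 x2_gt0 x3_gt0 x4_gt0 x5_gt0 [s_gt0 t_gt0].
move=> [n0 n1 n2 n3 n4] [m0 m1 m2 m3 m4].
pose r := s / t; have r_gt0 : 0 < r by rewrite divr_gt0.
have rE : s = r * t by rewrite /r mulfVK ?gt_eqF.
rewrite rE in n0 n1 n2 n3 n4 m0 m1 m2 m3 m4.
(* Even and odd parts: the numerator at [- r] is [P - x2 r V] and the denominator there is
   [x2 Q - r W]. Both vanish because of the common factor. *)
pose P := x1 * x4 + (x3 * x4 + x1 * x5 + x4 * x5) * r ^+ 2
  + x3 * x5 * r ^+ 4.
pose Q := x1 * x4 + (x1 * x3 + x3 * x4 + x4 * x5) * r ^+ 2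
  + x3 * x5 * r ^+ 4.
pose V := x1 + (x3 + x5) * r ^+ 2.
pose W := x1 * x4 * (x3 + x5) + x1 * x3 * x5 * r ^+ 2.
have PE : P = x2 * r * V.
  have -> : x2 * r * V = x1 * x2 * r + x2 * (x3 + x5) * r ^+ 3.
    by rewrite /V; ring.
  by rewrite /P -n0 -n1 -n2 -n3 -n4; ring.
have QE : x2 * Q = r * W.
  have -> : x2 * Q = x1 * x2 * x4
      + x2 * (x1 * x3 + x3 * x4 + x4 * x5) * r ^+ 2 + x2 * x3 * x5 * r ^+ 4.
    by rewrite /Q; ring.
  by rewrite /W -m0 -m1 -m2 -m3 -m4; ring.
(* The damper [x2] cancels in the product of the two equations that express that
   [- r] is a common root. *)
have PQ : P * Q = r ^+ 2 * V * W.
  by rewrite PE mulrAC -(mulrA x2) (mulrC r) mulrA QE; ring.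
pose E := x1 * x4 + x4 * (x3 + x5) * r ^+ 2 + x3 * x5 * r ^+ 4.
have E_gt0 : 0 < E by rewrite /E; positivity.
have E2 : P * Q - r ^+ 2 * V * W = E ^+ 2 by rewrite /P /Q /V /W /E; ring.
move/eqP: E2; rewrite PQ subrr eq_sym expf_eq0 /= => /eqP E0.
by rewrite E0 ltxx in E_gt0.
Qed.

(** [T] is [t / s], the roots of [quadY] are the reciprocals of the two springs and those of [quadZ]
    are the two inerters. Given [B13 = 0], the two inequalities are the discriminants up to positive
    factors; they become squares of [x1 - x4] and [x2 - x3]. *)
Lemma fits11_cond a d s t x1 x2 x3 x4 x5 :
  0 < x1 -> 0 < x2 -> 0 < x3 -> 0 < x4 -> 0 < x5 ->
  fits11 a d s t x1 x2 x3 x4 x5 -> cond11 a d.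
Proof.
move=> x1_gt0 x2_gt0 x3_gt0 x4_gt0 x5_gt0 [s_gt0 t_gt0].
move=> [n0 n1 n2 n3 n4] [m0 m1 m2 m3 m4].
have [s0 t0] : s != 0 /\ t != 0 by rewrite !gt_eqF.
pose T := t / s; have T_gt0 : 0 < T by rewrite divr_gt0.
have tE : t = T * s by rewrite /T mulfVK.
have T0 : T != 0 by rewrite gt_eqF.
have [x10 x20 x30 x40 x50] :
  [/\ x1 != 0, x2 != 0, x3 != 0, x4 != 0 & x5 != 0] by rewrite !gt_eqF.
have x14 : x1 + x4 != 0 by rewrite gt_eqF ?addr_gt0.
have a0E : a`_0 = x1 * x4 / s by rewrite -n0; field_nz.
have a3T : a`_3 * T = x2 * x3 / s by rewrite -n4 tE; field_nz.
have a01 : a`_0 * T + a`_1 = x5 * (x1 + x4) / s by rewrite -n1 tE; field_nz.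
have a12 : a`_1 * T + a`_2 = (x1 * x2 + x3 * x4) / s.
  by rewrite -n2 tE; field_nz.
have a23 : a`_2 * T + a`_3 = x5 * (x2 + x3) / s by rewrite -n3 tE; field_nz.
have d0E : d`_0 = x1 * x4 * x5 / s by rewrite -m0; field_nz.
have d3T : d`_3 * T = x2 * x3 * x5 / s by rewrite -m4 tE; field_nz.
have d01 : d`_0 * T + d`_1 = x1 * x4 * (x2 + x3) / s.
  by rewrite -m1 tE; field_nz.
have d12 : d`_1 * T + d`_2 = x5 * (x1 * x3 + x2 * x4) / s.
  by rewrite -m2 tE; field_nz.
have d23 : d`_2 * T + d`_3 = x2 * x3 * (x1 + x4) / s.
  by rewrite -m3 tE; field_nz.
have a3E : a`_3 = x2 * x3 / (s * T) by rewrite -n4 tE; field_nz.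
have d3E : d`_3 = x2 * x3 * x5 / (s * T) by rewrite -m4 tE; field_nz.
split; first by rewrite /B13 a3E d3E a0E d0E; field_nz.
exists T; split=> //.
- have -> : a`_0 * d`_0 * d`_3 * T ^+ 3
      + (a`_1 * d`_0 * d`_3 + a`_0 * d`_1 * d`_3 - a`_2 * d`_0 * d`_2) * T ^+ 2
      + (a`_1 * d`_1 * d`_3 - a`_2 * d`_0 * d`_3 - a`_3 * d`_0 * d`_2) * T
      - a`_3 * d`_0 * d`_3 =
    d`_3 * T * (a`_0 * T + a`_1) * (d`_0 * T + d`_1)
      - d`_0 * (a`_2 * T + a`_3) * (d`_2 * T + d`_3) by ring.
  by rewrite d3T a01 d01 a23 d23 d0E; field_nz.
- have -> : a`_0 * d`_2 * T ^+ 2 + (a`_1 * d`_2 - 3 * a`_0 * d`_3) * T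
      + a`_1 * d`_3 =
    (a`_0 * T + a`_1) * (d`_2 * T + d`_3) - 4 * a`_0 * (d`_3 * T) by ring.
  rewrite a01 d23 d3T a0E.
  have -> : x5 * (x1 + x4) / s * (x2 * x3 * (x1 + x4) / s)
      - 4 * (x1 * x4 / s) * (x2 * x3 * x5 / s) =
    x5 * x2 * x3 * ((x1 - x4) / s) ^+ 2 by field_nz.
  apply: mulr_ge0; last exact: sqr_ge0.
  by apply/ltW; positivity.
- have -> : (a`_2 ^+ 2 * d`_2 - 4 * a`_0 * a`_3 * d`_3) * T ^+ 3
      + (a`_2 ^+ 2 * d`_3 + 2 * a`_2 * a`_3 * d`_2
         - 4 * a`_1 * a`_3 * d`_3) * T ^+ 2
      + a`_3 * (a`_3 * d`_2 + 2 * a`_2 * d`_3) * T + a`_3 ^+ 2 * d`_3 =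
    (a`_2 * T + a`_3) ^+ 2 * (d`_2 * T + d`_3)
      - 4 * (a`_3 * T) * (d`_3 * T) * (a`_0 * T + a`_1) by ring.
  rewrite a01 d23 d3T a3T a23.
  have -> : (x5 * (x2 + x3) / s) ^+ 2 * (x2 * x3 * (x1 + x4) / s)
      - 4 * (x2 * x3 / s) * (x2 * x3 * x5 / s) * (x5 * (x1 + x4) / s) =
    x5 ^+ 2 * x2 * x3 * (x1 + x4) / s * ((x2 - x3) / s) ^+ 2 by field_nz.
  apply: mulr_ge0; last exact: sqr_ge0.
  by apply/ltW; positivity.
exists (x1 / (s * a`_0)), (x4 / (s * a`_0)), x2, x3.
have p0 : s * a`_0 != 0 by rewrite n0 mulf_neq0.
split.
- rewrite /quadY positive_rootsP ?a01 ?d23 ?a3T ?d0E.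
    rewrite n0; split; [by field_nz | by field_nz | by positivity..].
  by rewrite gt_eqF //; positivity.
- rewrite /quadZ positive_rootsP ?a01 ?d23 ?a3T ?d3T ?a23.
    by split=> //; field_nz.
  by rewrite gt_eqF //; positivity.
- by rewrite a12 n0 a0E; field_nz.
- by rewrite d12 n0 d0E; field_nz.
Qed.

Lemma cond11_fits a d (a_gt0 : forall i : nat, (i < 4)%N -> 0 < a`_i)
    (d_gt0 : forall j : nat, (j < 4)%N -> 0 < d`_j) : cond11 a d ->
  exists s t x1 x2 x3 x4 x5 : R,
  [/\ 0 < x1, 0 < x2, 0 < x3, 0 < x4 & 0 < x5] /\
  fits11 a d s t x1 x2 x3 x4 x5.
Proof.
have [a0_gt0 a1_gt0 a2_gt0 a3_gt0] :
  [/\ 0 < a`_0, 0 < a`_1, 0 < a`_2 & 0 < a`_3] by rewrite !a_gt0.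
have [d0_gt0 d1_gt0 d2_gt0 d3_gt0] :
  [/\ 0 < d`_0, 0 < d`_1, 0 < d`_2 & 0 < d`_3] by rewrite !d_gt0.
case=> B13_0 [T [T_gt0 EC _ _ [y1 [y2 [z1 [z2 [EY EZ E1 E2]]]]]]].
have A_gt0 : 0 < a`_0 * T + a`_1 by positivity.
have D_gt0 : 0 < d`_2 * T + d`_3 by positivity.
move: EY EZ; rewrite /quadY /quadZ.
rewrite !positive_rootsP; try by rewrite gt_eqF //; positivity.
move=> [Y1 Y2 y1_gt0 y2_gt0] [Z1 Z2 z1_gt0 z2_gt0].
set A := a`_0 * T + a`_1 in A_gt0 Y1 Y2 Z1 Z2.
set D := d`_2 * T + d`_3 in D_gt0 Y1 Y2 Z1 Z2.
set C := a`_2 * T + a`_3 in Z1.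
have [a0 a3 d0 d3 T0] :
  [/\ a`_0 != 0, a`_3 != 0, d`_0 != 0, d`_3 != 0 & T != 0] by rewrite !gt_eqF.
have [An Dn] : A != 0 /\ D != 0 by rewrite !gt_eqF.
have [y10 y20 z10 z20] : [/\ y1 != 0, y2 != 0, z1 != 0 & z2 != 0].
  by rewrite !gt_eqF.
have y120 : y1 + y2 != 0 by rewrite gt_eqF ?addr_gt0.
(* Vieta's formulas and [B13 = 0] express [A], [D], [a_3], [d_3] and [C] through [a_0], [d_0], [T]
   and the roots; the cubic equation then yields [d_0 T + d_1]. *)
have AE : A = d`_0 * (y1 + y2).
  by apply: (mulIf Dn); rewrite -Y1; ring.
have a3d0 : a`_3 * d`_0 = a`_0 * d`_3 by apply/subr0_eq.
have DE : D = a`_0 * (y1 + y2) * (z1 * z2).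
  have H : (d`_0 * T * (d`_3 * A)) * D = (d`_0 * T * (d`_3 * A)) *
    (a`_0 * (y1 + y2) * (z1 * z2)).
    have -> : d`_0 * T * (d`_3 * A) * D = d`_0 * A * (d`_3 * T * D) by ring.
    rewrite -Z2 {2}AE.
    have -> : d`_0 * A * (a`_3 * T * (d`_0 * (y1 + y2)) * (z1 * z2)) =
      (a`_3 * d`_0) * d`_0 * T * A * (y1 + y2) * (z1 * z2) by ring.
    by rewrite a3d0; ring.
  by apply: mulfI H; rewrite !mulf_neq0.
have a3E : a`_3 = a`_0 * (y1 * y2) * (z1 * z2) / T.
  have : (T * A) * a`_3 = (T * A) * (a`_0 * (y1 * y2) * (z1 * z2) / T).
    have -> : T * A * a`_3 = a`_3 * T * A by ring.
    by rewrite -Y2 DE AE; field_nz.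
  by apply: mulfI; rewrite mulf_neq0.
have d3E : d`_3 = d`_0 * (y1 * y2) * (z1 * z2) / T.
  by apply: (mulfI a0); rewrite -a3d0 a3E; field_nz.
have CE : C = (z1 + z2) * d`_0 * (y1 * y2).
  by apply: (mulIf Dn); rewrite -Z1 DE a3E AE; field_nz.
have d01 : d`_0 * T + d`_1 = a`_0 * (z1 + z2).
  have : d`_3 * T * A * (d`_0 * T + d`_1) - d`_0 * C * D = 0.
    by apply: (eq_of_multiple (k := 1) EC); rewrite /A /C /D; ring.
  move/subr0_eq => H; have : (d`_3 * T * A) * (d`_0 * T + d`_1) =
      (d`_3 * T * A) * (a`_0 * (z1 + z2)).
    by rewrite H DE CE AE d3E; field_nz.
  by apply: mulfI; rewrite !mulf_neq0.
(* Forced by [s * a_0 = x1 * x4], where the springs are the reciprocals of the [y]; the damper is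
   [d_0 / a_0]. *)
set s := (a`_0 * (y1 * y2))^-1; have s_gt0 : 0 < s by rewrite /s; positivity.
exists s, (s * T), y2^-1, z1, z2, y1^-1, (d`_0 / a`_0).
split; first by positivity.
split=> //; first by positivity.
- have fac x y : s * x + s * T * y = s * (y * T + x) by ring.
  rewrite !fac -/A -/C CE AE (subr0_eq E1) /s a3E.
  split; by field_nz.
- have fac x y : s * x + s * T * y = s * (y * T + x) by ring.
  rewrite !fac -/D DE d01 (subr0_eq E2) /s d3E.
  split; by field_nz.
Qed.
End CommonFactor.

(** * The impedance of the bridge as a law on the positive half-line *)

Section Bridge.
Variable K : comNzRingType.

(* Admittances of the bridge with terminals [a], [b] and internal vertices
   [p], [q]: [y1 : a-p], [y2 : a-q], [y3 : b-p], [y4 : b-q], [y5 : p-q]. Its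
   impedance is the ratio of a sum over the spanning 2-forests separating [a]
   from [b] to a sum over the spanning trees. *)
Definition bridge_num (y1 y2 y3 y4 y5 : K) : K :=
  (y1 + y3) * (y2 + y4) + y5 * (y1 + y2 + y3 + y4).
Definition bridge_den (y1 y2 y3 y4 y5 : K) : K :=
  y1 * y3 * (y2 + y4) + y2 * y4 * (y1 + y3) + y5 * ((y1 + y2) * (y3 + y4)).
End Bridge.

Section Law.
Variable R : realType.
Implicit Types (a d p q : {poly R}) (u : element R) (s x : R).

Definition admittance_at u s : R :=
  match u with Damper c => c | Spring k => k / s | Inerter b => b * s end.

(** For real [s > 0] all admittances are positive numbers, hence invertible, and the half-line is
    large enough to recover polynomial identities. *)
Definition bridge_law u1 u2 u3 u4 u5 a d : Prop := forall s, 0 < s ->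
  let y u := admittance_at u s in
  a.[s] * bridge_den (y u1) (y u2) (y u3) (y u4) (y u5) =
  d.[s] * bridge_num (y u1) (y u2) (y u3) (y u4) (y u5).

(** Reflection exchanging the internal vertices [p] and [q]. *)
Lemma bridge_law_swap u1 u2 u3 u4 u5 a d :
  bridge_law u1 u2 u3 u4 u5 a d -> bridge_law u2 u1 u4 u3 u5 a d.
Proof.
move=> H s s_gt0; move: (H s s_gt0) => /= {}H.
by apply: (eq_trans _ (eq_trans H _)); rewrite /bridge_den /bridge_num; ring.
Qed.

(** Reflection exchanging the terminals. *)
Lemma bridge_law_flip u1 u2 u3 u4 u5 a d :
  bridge_law u1 u2 u3 u4 u5 a d -> bridge_law u3 u4 u1 u2 u5 a d.
Proof.
move=> H s s_gt0; move: (H s s_gt0) => /= {}H.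
by apply: (eq_trans _ (eq_trans H _)); rewrite /bridge_den /bridge_num; ring.
Qed.

Definition dual_element u : element R :=
  match u with
  | Damper c => Damper c^-1 | Spring k => Inerter k^-1
  | Inerter b => Spring b^-1
  end.

Lemma admittance_at_gt0 u s : 0 < element_value u -> 0 < s ->
  0 < admittance_at u s.
Proof. by case: u => x /= x_gt0 s_gt0 //; positivity. Qed.

Lemma dual_element_gt0 u : 0 < element_value u ->
  0 < element_value (dual_element u).
Proof. by case: u => x /=; rewrite invr_gt0. Qed.

Lemma admittance_at_dual u s :
  admittance_at (dual_element u) s = (admittance_at u s)^-1.
Proof. by case: u => x //=; rewrite ?invfM ?invrK. Qed.

(** The planar dual of the bridge is a bridge with the edges 2 and 3 exchanged. Inverting the
    admittances and multiplying by the product of all five replaces each monomial by the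
    complementary one, which exchanges numerator and denominator. *)
Lemma bridge_law_dual u1 u2 u3 u4 u5 a d :
  0 < element_value u1 -> 0 < element_value u2 -> 0 < element_value u3 ->
  0 < element_value u4 -> 0 < element_value u5 ->
  bridge_law u1 u2 u3 u4 u5 a d ->
  bridge_law (dual_element u1) (dual_element u3) (dual_element u2)
    (dual_element u4) (dual_element u5) d a.
Proof.
move=> /admittance_at_gt0 h1 /admittance_at_gt0 h2 /admittance_at_gt0 h3.
move=> /admittance_at_gt0 h4 /admittance_at_gt0 h5 H s s_gt0.
move: (H s s_gt0) => /= {}H; rewrite !admittance_at_dual.
move: (h1 s s_gt0) (h2 s s_gt0) (h3 s s_gt0) (h4 s s_gt0) (h5 s s_gt0) H.
set y1 := admittance_at u1 s; set y2 := admittance_at u2 s.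
set y3 := admittance_at u3 s; set y4 := admittance_at u4 s.
set y5 := admittance_at u5 s => /gt_eqF/negbT y10 /gt_eqF/negbT y20.
move=> /gt_eqF/negbT y30 /gt_eqF/negbT y40 /gt_eqF/negbT y50 H.
apply: (mulIf (mulf_neq0 (mulf_neq0 (mulf_neq0 (mulf_neq0 y10 y20) y30) y40) y50)).
rewrite -!mulrA.
have -> : bridge_den y1^-1 y3^-1 y2^-1 y4^-1 y5^-1 *
    (y1 * (y2 * (y3 * (y4 * y5)))) = bridge_num y1 y2 y3 y4 y5.
  by rewrite /bridge_den /bridge_num; field_nz.
have -> : bridge_num y1^-1 y3^-1 y2^-1 y4^-1 y5^-1 *
    (y1 * (y2 * (y3 * (y4 * y5)))) = bridge_den y1 y2 y3 y4 y5.
  by rewrite /bridge_den /bridge_num; field_nz.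
exact/esym.
Qed.

Lemma poly_eq_on_pos p q : (forall s, 0 < s -> p.[s] = q.[s]) -> p = q.
Proof.
move=> pq; apply/eqP; rewrite -subr_eq0; apply/eqP.
pose rs := [seq (i.+1)%:R : R | i <- iota 0 (size (p - q))].
apply: (@roots_geq_poly_eq0 _ (p - q) rs).
- apply/allP => _ /mapP[i _ ->]; by rewrite rootE hornerD hornerN pq ?ltr0n // subrr.
- rewrite map_inj_uniq ?iota_uniq // => i j /eqP.
  by rewrite eqr_nat => /eqP[].
- by rewrite size_map size_iota.
Qed.

Lemma coprimep_cofactor a d p q : coprimep a d -> d != 0 -> a * p = d * q ->
  exists2 t, p = d * t & q = a * t.
Proof.
move=> co d0 E; have : d %| p.
  by rewrite -(Gauss_dvdpr p (q := a)) 1?coprimep_sym // E dvdp_mulr.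
case/dvdpP => t pE; exists t; first by rewrite mulrC.
by apply: (mulfI d0); rewrite -E pE; ring.
Qed.

Definition admissible a d : Prop :=
  [/\ size a = 4%N, size d = 4%N, forall i : nat, (i < 4)%N -> 0 < a`_i,
      forall i : nat, (i < 4)%N -> 0 < d`_i & coprimep a d].

Lemma admissible_sym a d : admissible a d -> admissible d a.
Proof. by case=> *; split; rewrite 1?coprimep_sym. Qed.

Lemma coef_mul_linear a (t : {poly R}) : (size t <= 2)%N ->
  [/\ (a * t)`_0 = t`_0 * a`_0, (a * t)`_1 = t`_0 * a`_1 + t`_1 * a`_0,
      (a * t)`_2 = t`_0 * a`_2 + t`_1 * a`_1,
      (a * t)`_3 = t`_0 * a`_3 + t`_1 * a`_2
    & (a * t)`_4 = t`_0 * a`_4 + t`_1 * a`_3].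
Proof.
move=> sz; have tE : t = (t`_0)%:P + (t`_1)%:P * 'X.
  apply/polyP => i; rewrite coefD coefC coefCM coefX.
  case: i => [|[|i]] /=; rewrite ?mulr0 ?mulr1 ?addr0 ?add0r //.
  by rewrite nth_default ?(leq_trans sz).
have -> : a * t = t`_0 *: a + t`_1 *: (a * 'X).
  by rewrite {1}tE -!mul_polyC; ring.
by rewrite !coefD !coefZ !coefMX /= mulr0 addr0.
Qed.

Lemma quartic_factor a d (n0 n1 n2 n3 n4 m0 m1 m2 m3 m4 : R) :
  admissible a d ->
  (forall s, 0 < s ->
    a.[s] * (m0 + m1 * s + m2 * s ^+ 2 + m3 * s ^+ 3 + m4 * s ^+ 4) =
    d.[s] * (n0 + n1 * s + n2 * s ^+ 2 + n3 * s ^+ 3 + n4 * s ^+ 4)) ->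
  exists s t,
    [/\ s * a`_0 = n0, s * a`_1 + t * a`_0 = n1, s * a`_2 + t * a`_1 = n2,
        s * a`_3 + t * a`_2 = n3 & t * a`_3 = n4] /\
    [/\ s * d`_0 = m0, s * d`_1 + t * d`_0 = m1, s * d`_2 + t * d`_1 = m2,
        s * d`_3 + t * d`_2 = m3 & t * d`_3 = m4].
Proof.
case=> sa sd _ _ co H.
pose M := Poly [:: m0; m1; m2; m3; m4]; pose N := Poly [:: n0; n1; n2; n3; n4].
have d0 : d != 0 by rewrite -size_poly_eq0 sd.
have E : a * M = d * N.
  apply: poly_eq_on_pos => s s_gt0; move: (H s s_gt0) => {}H.
  rewrite !hornerM !horner_Poly /=.
  by apply: (eq_trans _ (eq_trans H _)); ring.
have [t ME NE] := coprimep_cofactor co d0 E.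
(* [M] has degree at most 4 and [d] has degree 3, so the cofactor is at most linear. *)
have st : (size t <= 2)%N.
  have [->|t0] := eqVneq t 0; first by rewrite size_poly0.
  have : (size (d * t)%R <= 5)%N by rewrite -ME (leq_trans (size_Poly _)).
  by rewrite size_mul // sd.
exists t`_0, t`_1.
have [A0 A1 A2 A3 A4] := coef_mul_linear a st.
have [D0 D1 D2 D3 D4] := coef_mul_linear d st.
rewrite -{}NE -{}ME !coef_Poly /= in A0 A1 A2 A3 A4 D0 D1 D2 D3 D4.
rewrite !(nth_default _ (_ : size _ <= 4)%N) ?sa ?sd // in A4 D4.
by rewrite ?mulr0 ?add0r in A4 D4.
Qed.

Lemma quartic_fits a d (n0 n1 n2 n3 n4 m0 m1 m2 m3 m4 : R) : admissible a d ->
  0 < n0 -> 0 < n4 ->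
  (forall s, 0 < s ->
    a.[s] * (m0 + m1 * s + m2 * s ^+ 2 + m3 * s ^+ 3 + m4 * s ^+ 4) =
    d.[s] * (n0 + n1 * s + n2 * s ^+ 2 + n3 * s ^+ 3 + n4 * s ^+ 4)) ->
  exists s t, fits_factor a d s t n0 n1 n2 n3 n4 m0 m1 m2 m3 m4.
Proof.
move=> adm n0_gt0 n4_gt0 /(quartic_factor adm)[s [t [nE mE]]].
have [_ _ a_gt0 _ _] := adm.
exists s, t; split=> //; case: nE => n0E _ _ _ n4E.
  by rewrite -(pmulr_lgt0 _ (a_gt0 0 isT)) n0E.
by rewrite -(pmulr_lgt0 _ (a_gt0 3 isT)) n4E.
Qed.

Lemma cubic_fits a d (n0 n1 n2 n3 m0 m1 m2 m3 : R) : admissible a d ->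
  0 < n0 ->
  (forall s, 0 < s ->
    a.[s] * (m0 + m1 * s + m2 * s ^+ 2 + m3 * s ^+ 3) =
    d.[s] * (n0 + n1 * s + n2 * s ^+ 2 + n3 * s ^+ 3)) ->
  exists c, fits a d c n0 n1 n2 n3 m0 m1 m2 m3.
Proof.
move=> adm n0_gt0 H; have [_ _ a_gt0 _ _] := adm.
have H' s : 0 < s ->
    a.[s] * (m0 + m1 * s + m2 * s ^+ 2 + m3 * s ^+ 3 + 0 * s ^+ 4) =
    d.[s] * (n0 + n1 * s + n2 * s ^+ 2 + n3 * s ^+ 3 + 0 * s ^+ 4).
  by rewrite !mul0r !addr0; apply: H.
have [c [t [[n0E n1E n2E n3E n4E] [m0E m1E m2E m3E _]]]] :=
  quartic_factor adm H'.
have t0 : t = 0.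
  by move/eqP: n4E; rewrite mulf_eq0 (gt_eqF (a_gt0 3 isT)) orbF => /eqP.
rewrite t0 !mul0r !addr0 in n1E n2E n3E m1E m2E m3E.
by exists c; split=> //; rewrite -(pmulr_lgt0 _ (a_gt0 0 isT)) n0E.
Qed.

(** The coefficients of [s ^ 3 * p (1 / s)]: replacing [s] by [1 / s] exchanges springs and
    inerters. *)
Definition rev4 (p : {poly R}) : {poly R} := \poly_(i < 4) p`_(3 - i).

Lemma coef_rev4 p : [/\ (rev4 p)`_0 = p`_3, (rev4 p)`_1 = p`_2,
  (rev4 p)`_2 = p`_1 & (rev4 p)`_3 = p`_0].
Proof. by rewrite !coef_poly. Qed.

Section Patterns.
Variables (a d : {poly R}) (x1 x2 x3 x4 x5 : R).
Hypotheses (x1_gt0 : 0 < x1) (x2_gt0 : 0 < x2) (x3_gt0 : 0 < x3)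
  (x4_gt0 : 0 < x4) (x5_gt0 : 0 < x5).

Lemma bridge_law_fits7 : admissible a d ->
  bridge_law (Spring x1) (Damper x2) (Inerter x3) (Damper x4) (Spring x5) a d ->
  exists c, fits7 a d c x1 x2 x3 x4 x5.
Proof.
move=> adm H; apply: cubic_fits adm _ _; first by positivity.
move=> s s_gt0; have s0 : s != 0 by rewrite gt_eqF.
move: (H s s_gt0); rewrite /= /bridge_num /bridge_den => {}H.
apply: (mulIf (invr_neq0 (expf_neq0 2 s0))).
by apply: (eq_trans _ (eq_trans H _)); field_nz.
Qed.

Lemma bridge_law_fits7_rev : admissible a d ->
  bridge_law (Inerter x1) (Damper x2) (Spring x3) (Damper x4) (Inerter x5) a d ->
  exists c, fits7 (rev4 a) (rev4 d) c x1 x2 x3 x4 x5.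
Proof.
move=> adm H.
have [A0 A1 A2 A3] := coef_rev4 a; have [D0 D1 D2 D3] := coef_rev4 d.
suff [c [c_gt0 [? ? ? ?] [? ? ? ?]]] : exists c, fits a d c
    (x3 * (x2 + x4)) (x3 * x5) ((x1 + x5) * (x2 + x4)) (x1 * x5)
    (x2 * x3 * x4) (x3 * (x1 * x2 + x1 * x4 + x2 * x5))
    (x1 * x2 * x4 + x1 * x3 * x5 + x2 * x4 * x5) (x1 * x4 * x5).
  by exists c; split; rewrite ?A0 ?A1 ?A2 ?A3 ?D0 ?D1 ?D2 ?D3.
apply: cubic_fits adm _ _; first by positivity.
move=> s s_gt0; have s0 : s != 0 by rewrite gt_eqF.
move: (H s s_gt0); rewrite /= /bridge_num /bridge_den => {}H.
apply: (mulIf (invr_neq0 (expf_neq0 1 s0))).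
by apply: (eq_trans _ (eq_trans H _)); field_nz.
Qed.

Lemma bridge_law_fits8 : admissible a d ->
  bridge_law (Spring x1) (Damper x2) (Damper x3) (Inerter x4) (Spring x5) a d ->
  exists c, fits8 a d c x1 x2 x3 x4 x5.
Proof.
move=> adm H; apply: cubic_fits adm _ _; first by positivity.
move=> s s_gt0; have s0 : s != 0 by rewrite gt_eqF.
move: (H s s_gt0); rewrite /= /bridge_num /bridge_den => {}H.
apply: (mulIf (invr_neq0 (expf_neq0 2 s0))).
by apply: (eq_trans _ (eq_trans H _)); field_nz.
Qed.

Lemma bridge_law_fits9 : admissible a d ->
  bridge_law (Spring x1) (Damper x2) (Damper x3) (Spring x4) (Inerter x5) a d ->
  exists c, fits9 a d c x1 x2 x3 x4 x5.
Proof.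
move=> adm H; apply: cubic_fits adm _ _; first by positivity.
move=> s s_gt0; have s0 : s != 0 by rewrite gt_eqF.
move: (H s s_gt0); rewrite /= /bridge_num /bridge_den => {}H.
apply: (mulIf (invr_neq0 (expf_neq0 2 s0))).
by apply: (eq_trans _ (eq_trans H _)); field_nz.
Qed.

Lemma bridge_law_fits10 : admissible a d ->
  bridge_law (Spring x1) (Damper x2) (Inerter x3) (Spring x4) (Damper x5) a d ->
  exists c, fits10 a d c x1 x2 x3 x4 x5.
Proof.
move=> adm H; apply: cubic_fits adm _ _; first by positivity.
move=> s s_gt0; have s0 : s != 0 by rewrite gt_eqF.
move: (H s s_gt0); rewrite /= /bridge_num /bridge_den => {}H.
apply: (mulIf (invr_neq0 (expf_neq0 2 s0))).
by apply: (eq_trans _ (eq_trans H _)); field_nz.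
Qed.

Lemma bridge_law_fits11 : admissible a d ->
  bridge_law (Spring x1) (Inerter x2) (Inerter x3) (Spring x4) (Damper x5) a d ->
  exists s t, fits11 a d s t x1 x2 x3 x4 x5.
Proof.
move=> adm H; apply: quartic_fits adm _ _ _; try by positivity.
move=> s s_gt0; have s0 : s != 0 by rewrite gt_eqF.
move: (H s s_gt0); rewrite /= /bridge_num /bridge_den => {}H.
apply: (mulIf (invr_neq0 (expf_neq0 2 s0))).
by apply: (eq_trans _ (eq_trans H _)); field_nz.
Qed.

Lemma bridge_law_fits_excluded : admissible a d ->
  bridge_law (Spring x1) (Damper x2) (Inerter x3) (Spring x4) (Inerter x5) a d ->
  exists s t, fits_excluded a d s t x1 x2 x3 x4 x5.
Proof.
move=> adm H; apply: quartic_fits adm _ _ _; try by positivity.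
move=> s s_gt0; have s0 : s != 0 by rewrite gt_eqF.
move: (H s s_gt0); rewrite /= /bridge_num /bridge_den => {}H.
apply: (mulIf (invr_neq0 (expf_neq0 2 s0))).
by apply: (eq_trans _ (eq_trans H _)); field_nz.
Qed.
End Patterns.
End Law.

(** * From the coefficient equations back to the law *)

Section Realize.
Variable R : realType.
Implicit Types (a d p : {poly R}).

Lemma horner_cubic p (s : R) : size p = 4%N ->
  p.[s] = p`_0 + p`_1 * s + p`_2 * s ^+ 2 + p`_3 * s ^+ 3.
Proof.
move=> sz; rewrite horner_coef sz !big_ord_recr big_ord0 /=.
by rewrite add0r mulr1 expr1.
Qed.

Lemma fits_cubic a d c n0 n1 n2 n3 m0 m1 m2 m3 : size a = 4%N -> size d = 4%N ->
  fits a d c n0 n1 n2 n3 m0 m1 m2 m3 -> forall s,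
  a.[s] * (m0 + m1 * s + m2 * s ^+ 2 + m3 * s ^+ 3) =
  d.[s] * (n0 + n1 * s + n2 * s ^+ 2 + n3 * s ^+ 3).
Proof.
move=> sa sd [_ [<- <- <- <-] [<- <- <- <-]] s.
by rewrite !horner_cubic //; ring.
Qed.

Lemma fits_quartic a d s0 t n0 n1 n2 n3 n4 m0 m1 m2 m3 m4 :
  size a = 4%N -> size d = 4%N ->
  fits_factor a d s0 t n0 n1 n2 n3 n4 m0 m1 m2 m3 m4 -> forall s,
  a.[s] * (m0 + m1 * s + m2 * s ^+ 2 + m3 * s ^+ 3 + m4 * s ^+ 4) =
  d.[s] * (n0 + n1 * s + n2 * s ^+ 2 + n3 * s ^+ 3 + n4 * s ^+ 4).
Proof.
move=> sa sd [_ _ [<- <- <- <- <-] [<- <- <- <- <-]] s.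
by rewrite !horner_cubic //; ring.
Qed.

Section Patterns.
Variables (a d : {poly R}) (x1 x2 x3 x4 x5 : R).
Hypotheses (sa : size a = 4%N) (sd : size d = 4%N).

Lemma fits7_law c : fits7 a d c x1 x2 x3 x4 x5 ->
  bridge_law (Spring x1) (Damper x2) (Inerter x3) (Damper x4) (Spring x5) a d.
Proof.
move=> H r r_gt0.
have r0 : r != 0 by rewrite gt_eqF.
have {}H := fits_cubic sa sd H r.
apply: (mulIf (expf_neq0 2 r0)); rewrite /= /bridge_num /bridge_den.
by apply: (eq_trans _ (eq_trans H _)); field_nz.
Qed.

Lemma fits7_rev_law c : fits7 (rev4 a) (rev4 d) c x1 x2 x3 x4 x5 ->
  bridge_law (Inerter x1) (Damper x2) (Spring x3) (Damper x4) (Inerter x5) a d.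
Proof.
have [A0 A1 A2 A3] := coef_rev4 a; have [D0 D1 D2 D3] := coef_rev4 d.
case; rewrite A0 A1 A2 A3 D0 D1 D2 D3.
move=> c_gt0 [n0 n1 n2 n3] [m0 m1 m2 m3] r r_gt0.
have H : fits a d c (x3 * (x2 + x4)) (x3 * x5) ((x1 + x5) * (x2 + x4)) (x1 * x5)
    (x2 * x3 * x4) (x3 * (x1 * x2 + x1 * x4 + x2 * x5))
    (x1 * x2 * x4 + x1 * x3 * x5 + x2 * x4 * x5) (x1 * x4 * x5) by [].
have r0 : r != 0 by rewrite gt_eqF.
have {}H := fits_cubic sa sd H r.
apply: (mulIf (expf_neq0 1 r0)); rewrite /= /bridge_num /bridge_den.
by apply: (eq_trans _ (eq_trans H _)); field_nz.
Qed.

Lemma fits8_law c : fits8 a d c x1 x2 x3 x4 x5 ->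
  bridge_law (Spring x1) (Damper x2) (Damper x3) (Inerter x4) (Spring x5) a d.
Proof.
move=> H r r_gt0.
have r0 : r != 0 by rewrite gt_eqF.
have {}H := fits_cubic sa sd H r.
apply: (mulIf (expf_neq0 2 r0)); rewrite /= /bridge_num /bridge_den.
by apply: (eq_trans _ (eq_trans H _)); field_nz.
Qed.

Lemma fits9_law c : fits9 a d c x1 x2 x3 x4 x5 ->
  bridge_law (Spring x1) (Damper x2) (Damper x3) (Spring x4) (Inerter x5) a d.
Proof.
move=> H r r_gt0.
have r0 : r != 0 by rewrite gt_eqF.
have {}H := fits_cubic sa sd H r.
apply: (mulIf (expf_neq0 2 r0)); rewrite /= /bridge_num /bridge_den.
by apply: (eq_trans _ (eq_trans H _)); field_nz.
Qed.

Lemma fits10_law c : fits10 a d c x1 x2 x3 x4 x5 ->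
  bridge_law (Spring x1) (Damper x2) (Inerter x3) (Spring x4) (Damper x5) a d.
Proof.
move=> H r r_gt0.
have r0 : r != 0 by rewrite gt_eqF.
have {}H := fits_cubic sa sd H r.
apply: (mulIf (expf_neq0 2 r0)); rewrite /= /bridge_num /bridge_den.
by apply: (eq_trans _ (eq_trans H _)); field_nz.
Qed.

Lemma fits11_law s t : fits11 a d s t x1 x2 x3 x4 x5 ->
  bridge_law (Spring x1) (Inerter x2) (Inerter x3) (Spring x4) (Damper x5) a d.
Proof.
move=> H r r_gt0.
have r0 : r != 0 by rewrite gt_eqF.
have {}H := fits_quartic sa sd H r.
apply: (mulIf (expf_neq0 2 r0)); rewrite /= /bridge_num /bridge_den.
by apply: (eq_trans _ (eq_trans H _)); field_nz.
Qed.
End Patterns.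
End Realize.

(** * Element kinds compatible with degree 3 *)

(** One entry per spanning tree, each admittance being multiplied by [s] so that it is a monomial of
    degree 0, 1 or 2. *)
Definition den_degrees (k1 k2 k3 k4 k5 : nat) : seq nat :=
  ([:: k1 + k3 + k2; k1 + k3 + k4; k2 + k4 + k1; k2 + k4 + k3;
       k5 + (k1 + k3); k5 + (k1 + k4); k5 + (k2 + k3); k5 + (k2 + k4)])%N.

(** One entry per separating 2-forest. The successor is the factor [s] missing in this scaling, as
    the numerator is quadratic and the denominator cubic in the admittances. *)
Definition num_degrees (k1 k2 k3 k4 k5 : nat) : seq nat :=
  ([:: (k1 + k2).+1; (k1 + k4).+1; (k3 + k2).+1; (k3 + k4).+1;
       (k5 + k1).+1; (k5 + k2).+1; (k5 + k3).+1; (k5 + k4).+1])%N.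

Definition extremal (S : seq nat) (v w : nat) : bool :=
  [&& v \in S, w \in S & all (fun i => v <= i <= w)%N S].

(* [v] and [w] are the lowest and the highest degree of both sides of the
   impedance; they differ by at least 3 because [d] divides the denominator. *)
Definition feasible (k1 k2 k3 k4 k5 : nat) : bool :=
  has (fun v => has (fun w =>
    [&& extremal (den_degrees k1 k2 k3 k4 k5) v w,
        extremal (num_degrees k1 k2 k3 k4 k5) v w & v + 3 <= w]%N)
  (iota 0 8)) (iota 0 8).

(** In this order: [fits7], its inversion, [fits8], [fits9], [fits10] and the impossible class
    [fits_excluded]. *)
Definition primal_kinds : seq (seq nat) :=
  [:: [:: 0; 1; 2; 1; 0]; [:: 2; 1; 0; 1; 2]; [:: 0; 1; 1; 2; 0];
      [:: 0; 1; 1; 0; 2]; [:: 0; 1; 2; 0; 1]; [:: 0; 1; 2; 0; 2]]%N.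

(** The last pattern, that of [fits11], is listed without its dual, which is a reflection of it. *)
Definition canonical (k1 k2 k3 k4 k5 : nat) : bool :=
  [|| [:: k1; k2; k3; k4; k5] \in primal_kinds,
      [:: 2 - k1; 2 - k3; 2 - k2; 2 - k4; 2 - k5]%N \in primal_kinds
    | [:: k1; k2; k3; k4; k5] == [:: 0; 2; 2; 0; 1]%N].

Lemma feasible_kinds k1 k2 k3 k4 k5 :
  (k1 < 3)%N -> (k2 < 3)%N -> (k3 < 3)%N -> (k4 < 3)%N -> (k5 < 3)%N ->
  feasible k1 k2 k3 k4 k5 ->
  [|| canonical k1 k2 k3 k4 k5, canonical k2 k1 k4 k3 k5,
      canonical k3 k4 k1 k2 k5 | canonical k4 k3 k2 k1 k5].
Proof.
have H : all (fun i1 => all (fun i2 => all (fun i3 => all (fun i4 =>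
    all (fun i5 => feasible i1 i2 i3 i4 i5 ==>
      [|| canonical i1 i2 i3 i4 i5, canonical i2 i1 i4 i3 i5,
          canonical i3 i4 i1 i2 i5 | canonical i4 i3 i2 i1 i5])
    (iota 0 3)) (iota 0 3)) (iota 0 3)) (iota 0 3)) (iota 0 3).
  by vm_compute.
have I k : (k < 3)%N -> k \in iota 0 3 by rewrite mem_iota.
move=> /I l1 /I l2 /I l3 /I l4 /I l5; apply/implyP.
move: H => /allP/(_ _ l1)/allP/(_ _ l2)/allP/(_ _ l3)/allP/(_ _ l4).
by move=> /allP/(_ _ l5).
Qed.

Section Filter.
Variable R : realType.
Implicit Types (a d p q : {poly R}) (u : element R) (L : seq (R * nat)).

Definition kind u : nat :=
  match u with Spring _ => 0 | Damper _ => 1 | Inerter _ => 2 end.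

Lemma kind_lt3 u : (kind u < 3)%N. Proof. by case: u. Qed.

Definition scaled_admittance u : {poly R} := element_value u *: 'X^(kind u).

Lemma horner_scaled_admittance u (s : R) : s != 0 ->
  (scaled_admittance u).[s] = s * admittance_at u s.
Proof. by move=> s0; rewrite hornerZ hornerXn; case: u => x /=; by [ring | field]. Qed.

Definition monomial_sum L : {poly R} := \sum_(x <- L) x.1 *: 'X^(x.2).

(** Positive coefficients cannot cancel. *)
Lemma coef_monomial_sum L i : all (fun x => 0 < x.1) L ->
  ((monomial_sum L)`_i != 0) = (i \in unzip2 L).
Proof.
move=> Lpos; suff [] : 0 <= (monomial_sum L)`_i /\
  (0 < (monomial_sum L)`_i) = (i \in unzip2 L).
  by move=> ge0 <-; rewrite lt0r ge0 andbT.
elim: L Lpos => [|[c m] L IH] /=.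
  by rewrite /monomial_sum big_nil coef0 lexx ltxx.
case/andP=> c_gt0 /IH[ge0 gt0E].
rewrite /monomial_sum big_cons coefD coefZ coefXn /= inE -gt0E.
case: eqP => _ /=; rewrite ?mulr1 ?mulr0 ?add0r //.
by rewrite addr_ge0 ?(ltW c_gt0) // ltr_wpDr.
Qed.

(** With a nonzero constant term in [p], the lowest degree of the product is that of [q]; its
    highest degree is the sum of both degrees, each one less than the size. *)
Lemma extremal_mul p q L v : all (fun x => 0 < x.1) L ->
  p`_0 != 0 -> q`_v != 0 -> (forall i, (i < v)%N -> q`_i = 0) ->
  monomial_sum L = p * q ->
  extremal (unzip2 L) v (size p + size q).-2.
Proof.
move=> Lpos p0 qv qlt E.
have coefE i := coef_monomial_sum i Lpos.
have pn0 : p != 0 by apply: contraNneq p0 => ->; rewrite coef0.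
have qn0 : q != 0 by apply: contraNneq qv => ->; rewrite coef0.
have low i : (i < v)%N -> (p * q)`_i = 0.
  move=> iv; rewrite coefM big1 // => j _; rewrite qlt ?mulr0 //.
  by rewrite (leq_ltn_trans (leq_subr _ _)).
have at_v : (p * q)`_v != 0.
  rewrite coefM big_ord_recl /= subn0 big1 ?addr0 ?mulf_neq0 // => j _.
  by rewrite qlt ?mulr0 // ltn_subrL /= (leq_ltn_trans _ (ltn_ord j)).
have szE : size (p * q)%R = (size p + size q).-1 by rewrite size_mul.
apply/and3P; split.
- by rewrite -coefE E.
- by rewrite -coefE E -szE -lead_coefE lead_coef_eq0 mulf_neq0.
- apply/allP => i; rewrite -coefE E => iP; apply/andP; split.
    by rewrite leqNgt; apply: contra iP => /low ->.
  rewrite -ltnS prednK -?szE; last by rewrite size_poly_gt0 mulf_neq0.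
  by rewrite ltnNge; apply: contra iP => /(nth_default 0) ->.
Qed.

Lemma bridge_law_poly u1 u2 u3 u4 u5 a d : bridge_law u1 u2 u3 u4 u5 a d ->
  let q := scaled_admittance in
  a * bridge_den (q u1) (q u2) (q u3) (q u4) (q u5) =
  d * ('X * bridge_num (q u1) (q u2) (q u3) (q u4) (q u5)).
Proof.
move=> H q; apply: poly_eq_on_pos => s s_gt0.
have s0 : s != 0 by rewrite gt_eqF.
have hE u : (q u).[s] = s * admittance_at u s.
  exact: horner_scaled_admittance.
rewrite hornerM (hornerM d) (hornerM 'X) hornerX.
rewrite /bridge_den /bridge_num !(hornerD, hornerM) !hE.
move: (H s s_gt0); rewrite /bridge_den /bridge_num => /(congr1 ( *%R (s ^+ 3))).
by move=> {}H; apply: (eq_trans _ (eq_trans H _)); ring.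
Qed.

Lemma poly_bridge_law u1 u2 u3 u4 u5 a d :
  let q := scaled_admittance in
  a * bridge_den (q u1) (q u2) (q u3) (q u4) (q u5) =
  d * ('X * bridge_num (q u1) (q u2) (q u3) (q u4) (q u5)) ->
  bridge_law u1 u2 u3 u4 u5 a d.
Proof.
move=> q /(congr1 (fun p : {poly R} => horner p)) H s s_gt0.
have s0 : s != 0 by rewrite gt_eqF.
move: H => /(congr1 (fun f => f s)) /=.
have hE u : (q u).[s] = s * admittance_at u s.
  exact: horner_scaled_admittance.
rewrite hornerM (hornerM d) (hornerM 'X) hornerX.
rewrite /bridge_den /bridge_num !(hornerD, hornerM) !hE => H.
apply: (mulIf (expf_neq0 3 s0)).
by apply: (eq_trans _ (eq_trans H _)); ring.
Qed.

Lemma bridge_law_feasible u1 u2 u3 u4 u5 a d : admissible a d ->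
  0 < element_value u1 -> 0 < element_value u2 -> 0 < element_value u3 ->
  0 < element_value u4 -> 0 < element_value u5 ->
  bridge_law u1 u2 u3 u4 u5 a d ->
  feasible (kind u1) (kind u2) (kind u3) (kind u4) (kind u5).
Proof.
move=> [sa sd a_gt0 d_gt0 co] x1 x2 x3 x4 x5 /bridge_law_poly /=.
set D := bridge_den _ _ _ _ _; set N := bridge_num _ _ _ _ _ => E.
set e1 := element_value u1 in x1; set e2 := element_value u2 in x2.
set e3 := element_value u3 in x3; set e4 := element_value u4 in x4.
set e5 := element_value u5 in x5.
set k1 := kind u1; set k2 := kind u2; set k3 := kind u3; set k4 := kind u4.
set k5 := kind u5.
have d0 : d != 0 by rewrite -size_poly_eq0 sd.
have [t DE NE] := coprimep_cofactor co d0 E.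
pose LD := zip [:: e1 * e3 * e2; e1 * e3 * e4; e2 * e4 * e1; e2 * e4 * e3;
  e5 * (e1 * e3); e5 * (e1 * e4); e5 * (e2 * e3); e5 * (e2 * e4)]
  (den_degrees k1 k2 k3 k4 k5).
pose LN := zip [:: e1 * e2; e1 * e4; e3 * e2; e3 * e4;
  e5 * e1; e5 * e2; e5 * e3; e5 * e4] (num_degrees k1 k2 k3 k4 k5).
have LDE : monomial_sum LD = d * t.
  rewrite -DE /D /monomial_sum /LD /= !big_cons big_nil /=.
  rewrite /bridge_den /scaled_admittance -!mul_polyC.
  by rewrite !exprD !polyCM; ring.
have LNE : monomial_sum LN = a * t.
  rewrite -NE /N /monomial_sum /LN /= !big_cons big_nil /=.
  rewrite /bridge_num /scaled_admittance -!mul_polyC.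
  by rewrite !exprS !exprD !polyCM; ring.
have LDpos : all (fun x => 0 < x.1) LD by rewrite /= !mulr_gt0.
have LNpos : all (fun x => 0 < x.1) LN by rewrite /= !mulr_gt0.
have t0 : t != 0.
  apply/eqP => t0; move: LDE; rewrite t0 mulr0 => LD0.
  have := coef_monomial_sum (k1 + k3 + k2) LDpos.
  by rewrite LD0 coef0 eqxx /= inE eqxx.
have tv_ex : exists i, t`_i != 0.
  by exists (size t).-1; rewrite -lead_coefE lead_coef_eq0.
pose v := ex_minn tv_ex.
have [tv tlt] : t`_v != 0 /\ forall i, (i < v)%N -> t`_i = 0.
  rewrite /v; case: ex_minnP => m tm mmin; split=> // i im.
  by apply/eqP; apply: contraTT im => /mmin; rewrite -leqNgt.
have d00 : d`_0 != 0 by rewrite gt_eqF ?d_gt0.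
have a00 : a`_0 != 0 by rewrite gt_eqF ?a_gt0.
have := extremal_mul LDpos d00 tv tlt LDE.
have := extremal_mul LNpos a00 tv tlt LNE.
rewrite sa sd !unzip2_zip //= => exN exD.
have kl u : (kind u <= 2)%N by case: u.
have lt8 i : i \in den_degrees k1 k2 k3 k4 k5 -> (i < 8)%N.
  have := (kl u1, kl u2, kl u3, kl u4, kl u5).
  rewrite -/k1 -/k2 -/k3 -/k4 -/k5 => -[[[[l1 l2] l3] l4] l5].
  have le6 x y z : (x <= 2 -> y <= 2 -> z <= 2 -> x + y + z < 8)%N.
    by move=> lx ly lz; rewrite ltnS (leq_trans (leq_add (leq_add lx ly) lz)).
  rewrite !inE => /or3P[/eqP->|/eqP->|]; rewrite ?le6 //.
  move=> /or3P[/eqP->|/eqP->|]; rewrite ?addnA ?le6 //.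
  by move=> /or4P[/eqP->|/eqP->|/eqP->|/eqP->]; rewrite ?addnA ?le6.
have vt : (v < size t)%N.
  by rewrite ltnNge; apply: contra tv => /(nth_default 0) ->.
case/and3P: (exD) => vD wD _.
apply/hasP; exists v; first by rewrite mem_iota lt8.
(* The degree of [d * t] is [3 + (size t).-1]; with [v < size t] this is the gap of at least 3. *)
apply/hasP; exists (size t).+2; first by rewrite mem_iota lt8.
by rewrite exD exN addn3 !ltnS.
Qed.
End Filter.

(** * Duality and the main equivalence for bridges *)

Section Duality.
Variables (R : realType) (a d : {poly R}).

Lemma minors_dual :
  [/\ B11 d a = - B11 a d, B12 d a = - B12 a d, B13 d a = - B13 a d,
      B23 d a = - B23 a d & B33 d a = - B33 a d] /\ M13 d a = M13 a d.
Proof. by unfold_minors; split; [split|]; ring. Qed.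

Lemma cond7b_dual : cond7b a d <-> cond7a d a.
Proof.
have [[_ _ B13E B23E _] _] := minors_dual.
rewrite /cond7a /cond7b B13E B23E !oppr_gt0.
split=> -[h1 h2 h3 h4]; split=> //.
- by apply: (eq_of_multiple (k := - 1) h3); ring.
- by apply: (eq_of_multiple (k := 1) h4); rewrite /Delta1 /Delta2; ring.
- by apply: (eq_of_multiple (k := - 1) h3); ring.
- by apply: (eq_of_multiple (k := 1) h4); rewrite /Delta1 /Delta2; ring.
Qed.

Lemma cond7d_dual : cond7d a d <-> cond7c d a.
Proof.
have [[_ B12E B13E _ _] _] := minors_dual.
rewrite /cond7c /cond7d B13E B12E !oppr_lt0.
split=> -[h1 h2 h3 h4]; split=> //.
- by apply: (eq_of_multiple (k := - 1) h3); ring.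
- by apply: (eq_of_multiple (k := 1) h4); rewrite /Delta1 /Delta2; ring.
- by apply: (eq_of_multiple (k := - 1) h3); ring.
- by apply: (eq_of_multiple (k := 1) h4); rewrite /Delta1 /Delta2; ring.
Qed.

Lemma cond7c_rev : cond7c a d <-> cond7a (rev4 a) (rev4 d).
Proof.
have [A0 A1 A2 A3] := coef_rev4 a; have [D0 D1 D2 D3] := coef_rev4 d.
have B13E : B13 (rev4 a) (rev4 d) = - B13 a d.
  by rewrite /B13 A0 A3 D0 D3; ring.
have B23E : B23 (rev4 a) (rev4 d) = - B12 a d.
  by rewrite /B23 /B12 A1 A3 D1 D3; ring.
rewrite /cond7a /cond7c /Delta1 B13E B23E A0 A1 A2 A3 D0 D2 D3 !oppr_gt0.
split=> -[h1 h2 h3 h4]; split=> //.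
- by apply: (eq_of_multiple (k := - 1) h3); ring.
- by apply: (eq_of_multiple (k := 1) h4); ring.
- by apply: (eq_of_multiple (k := - 1) h3); ring.
- by apply: (eq_of_multiple (k := 1) h4); ring.
Qed.

Lemma eqns8_dual L : eqns8_3 a d L <-> eqns8_1 d a L.
Proof.
have [[B11E _ _ _ _] M13E] := minors_dual.
rewrite /eqns8_3 /eqns8_1 B11E M13E.
split=> -[h1 h2]; split.
- by apply: (eq_of_multiple (k := 1) h1); ring.
- by apply: (eq_of_multiple (k := 1) h2); ring.
- by apply: (eq_of_multiple (k := 1) h1); ring.
- by apply: (eq_of_multiple (k := 1) h2); ring.
Qed.

Lemma cond8_dual : cond8_3 a d \/ cond8_4 a d <-> cond8_1 d a \/ cond8_2 d a.
Proof.
have [[B11E _ B13E _ B33E] M13E] := minors_dual.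
have LaE : Lambda1a d a = Lambda2a a d.
  by rewrite /Lambda1a /Lambda2a B11E B13E M13E mulNr invrN !mulrN mulNr opprK.
have DE : Lambda_radicand d a = Lambda_radicand a d.
  by rewrite /Lambda_radicand B11E B13E B33E M13E; congr (_ * _); ring.
have LbE e : Lambda1b d a e = Lambda2b a d e.
  rewrite /Lambda1b /Lambda2b DE B11E B13E B33E M13E mulrN invrN mulrN.
  by congr (_ * (_ + _)); ring.
have e81 : cond8_3 a d <-> cond8_1 d a.
  rewrite /cond8_1 /cond8_3 B33E B11E B13E mulrNN LaE.
  split=> -[h1 h2 /eqns8_dual h3]; split=> //; first by rewrite h1 oppr0.
  by apply/eqP; rewrite -oppr_eq0 h1.
have e82 : cond8_4 a d <-> cond8_2 d a.
  rewrite /cond8_2 /cond8_4 B33E B11E opprK DE.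
  split=> -[e [h1 h2 h3 h4]]; exists e; rewrite ?LbE in h1 h2 h3 h4 *.
    by rewrite oppr_eq0; split=> //; apply/eqns8_dual.
  by rewrite oppr_eq0 in h1; split=> //; apply/eqns8_dual.
by rewrite e81 e82.
Qed.

Lemma Gamma2_dual e : Gamma2 a d e = Gamma1 d a e.
Proof.
rewrite /Gamma1 /Gamma2; congr ((_ + _ * Num.sqrt _) / _); ring.
Qed.

Lemma Phi2_dual G e : Phi2 a d G e = Phi1 d a G e.
Proof.
rewrite /Phi1 /Phi2 /Phi1_radicand /Phi2_radicand.
congr ((_ + _ * Num.sqrt _) / _); ring.
Qed.

Lemma Psi2_dual G e : Psi2 a d G e = Psi1 d a G e.
Proof.
rewrite /Psi1 /Psi2 /Psi1_radicand /Psi2_radicand.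
by congr ((_ + _ * Num.sqrt _) / _ - _); ring.
Qed.

Lemma cond9_dual : cond9_2 a d <-> cond9_1 d a.
Proof.
have DE G : Phi2_radicand a d G = Phi1_radicand d a G.
  by rewrite /Phi1_radicand /Phi2_radicand; ring.
have gE : a`_0 * d`_3 - 4 * a`_3 * d`_0 = d`_3 * a`_0 - 4 * d`_0 * a`_3.
  by ring.
rewrite /cond9_1 /cond9_2 gE.
split=> -[g_ge0 [e1 [e2 /= [h1 h2 h3 h4]]]]; split=> //; exists e1, e2 => /=;
  rewrite ?Gamma2_dual ?Phi2_dual ?DE in h1 h2 h3 h4 *; split=> //.
- by apply: (eq_of_multiple (k := 1) h3); ring.
- by apply: (eq_of_multiple (k := 1) h4); ring.
- by apply: (eq_of_multiple (k := 1) h3); ring.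
- by apply: (eq_of_multiple (k := 1) h4); ring.
Qed.

Lemma cond10_dual : cond10_2 a d <-> cond10_1 d a.
Proof.
have DE : Psi2_radicand a d = Psi1_radicand d a.
  by rewrite /Psi1_radicand /Psi2_radicand; ring.
have gE : a`_0 * d`_3 - 4 * a`_3 * d`_0 = d`_3 * a`_0 - 4 * d`_0 * a`_3.
  by ring.
rewrite /cond10_1 /cond10_2 gE DE.
split=> -[g_ge0 [D_ge0 [e1 [e2 /= [h2 h3 h4]]]]]; split=> //; split=> //;
  exists e1, e2 => /=; rewrite ?Gamma2_dual ?Psi2_dual in h2 h3 h4 *;
  split=> //.
- by apply: (eq_of_multiple (k := 1) h3); ring.
- by apply: (eq_of_multiple (k := 1) h4); ring.
- by apply: (eq_of_multiple (k := 1) h3); ring.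
- by apply: (eq_of_multiple (k := 1) h4); ring.
Qed.
End Duality.

Section Main.
Variable R : realType.
Implicit Types (a d : {poly R}) (u : element R).

(** If the three minors vanish, all ratios of corresponding coefficients agree, so [a] and [d] are
    proportional, against coprimality. *)
Lemma admissible_nondeg a d : admissible a d ->
  ~ [/\ B11 a d = 0, B13 a d = 0 & B33 a d = 0].
Proof.
move=> [sa sd a_gt0 d_gt0 co]; unfold_minors.
move=> [/subr0_eq b11 /subr0_eq b13 /subr0_eq b33].
have [d0 d3] : d`_0 != 0 /\ d`_3 != 0 by rewrite !gt_eqF ?d_gt0.
have aE : d`_0 *: a = a`_0 *: d.
  apply/polyP => i; rewrite !coefZ.
  case: i => [|[|[|[|i]]]]; first by rewrite mulrC.
  - by rewrite mulrC.
  - apply: (mulIf d3); rewrite -mulrA -b33 [RHS]mulrAC -b13; ring.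
  - by rewrite mulrC.
  - have za : a`_i.+4 = 0 by rewrite nth_default ?sa.
    have zd : d`_i.+4 = 0 by rewrite nth_default ?sd.
    by rewrite za zd !mulr0.
have a0 : a`_0 != 0 by rewrite gt_eqF ?a_gt0.
move: co; rewrite -(coprimepZl _ _ d0) aE coprimepZl // coprimepp sd.
by [].
Qed.

Definition realizable_law a d : Prop := exists u1 u2 u3 u4 u5,
  [/\ 0 < element_value u1, 0 < element_value u2, 0 < element_value u3,
      0 < element_value u4 & 0 < element_value u5] /\
  bridge_law u1 u2 u3 u4 u5 a d.

Lemma realizable_law_dual a d : realizable_law a d -> realizable_law d a.
Proof.
move=> [u1 [u2 [u3 [u4 [u5 [[p1 p2 p3 p4 p5] H]]]]]].
exists (dual_element u1), (dual_element u3), (dual_element u2).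
exists (dual_element u4), (dual_element u5).
by split; [split; apply: dual_element_gt0 | apply: bridge_law_dual].
Qed.

Definition conditions a d : Prop :=
  (cond7a a d \/ cond7b a d \/ cond7c a d \/ cond7d a d) \/
  (cond8_1 a d \/ cond8_2 a d \/ cond8_3 a d \/ cond8_4 a d) \/
  (cond9_1 a d \/ cond9_2 a d) \/
  (cond10_1 a d \/ cond10_2 a d) \/
  cond11 a d.

(* The conditions realized by the canonical networks; the remaining ones follow
   by duality. *)
Definition primal_conditions a d : Prop :=
  [\/ cond7a a d \/ cond7c a d, cond8_1 a d \/ cond8_2 a d, cond9_1 a d
    | cond10_1 a d].

Lemma conditionsE a d :
  conditions a d <-> [\/ primal_conditions a d, primal_conditions d a
                       | cond11 a d].
Proof.
have e8 := cond8_dual a d.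
rewrite /conditions cond7b_dual cond7d_dual cond9_dual cond10_dual.
split.
- case=> [[h|[h|[h|h]]]|[[h|[h|h]]|[[h|h]|[[h|h]|h]]]].
  + by apply: Or31; apply: Or41; left.
  + by apply: Or32; apply: Or41; left.
  + by apply: Or31; apply: Or41; right.
  + by apply: Or32; apply: Or41; right.
  + by apply: Or31; apply: Or42; left.
  + by apply: Or31; apply: Or42; right.
  + by apply: Or32; apply: Or42; apply/e8.
  + by apply: Or31; apply: Or43.
  + by apply: Or32; apply: Or43.
  + by apply: Or31; apply: Or44.
  + by apply: Or32; apply: Or44.
  + exact: Or33.
- case=> [[[h|h]|[h|h]|h|h]|[[h|h]|/e8 h|h|h]|h]; tauto.
Qed.

Lemma primal_conditions_law a d : admissible a d ->
  primal_conditions a d -> realizable_law a d.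
Proof.
move=> adm; have [sa sd a_gt0 d_gt0 co] := adm.
have [A0 A1 A2 A3] := coef_rev4 a; have [D0 D1 D2 D3] := coef_rev4 d.
have rev_gt0 (p : {poly R}) : (forall i : nat, (i < 4)%N -> 0 < p`_i) ->
    forall i : nat, (i < 4)%N -> 0 < (rev4 p)`_i.
  by move=> p_gt0 i i4; rewrite coef_poly i4 p_gt0 // ltnS leq_subr.
case.
- case=> [|/cond7c_rev].
    move=> /(cond7a_fits a_gt0 d_gt0)[c [x1 [x2 [x3 [x4 [x5 [pos H]]]]]]].
    by do 5!eexists; split; last exact: fits7_law H.
  move=> /(cond7a_fits (rev_gt0 _ a_gt0) (rev_gt0 _ d_gt0)).
  move=> [c [x1 [x2 [x3 [x4 [x5 [pos H]]]]]]].
  by do 5!eexists; split; last exact: fits7_rev_law H.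
- move/(cond8P a_gt0 d_gt0 (admissible_nondeg adm)) => [L [h1 h2 h3 h4]].
  have [c [x1 [x2 [x3 [x4 [x5 [pos H]]]]]]] := cond8_fits a_gt0 d_gt0 h1 h2 h3 h4.
  by do 5!eexists; split; last exact: fits8_law H.
- move/(cond9P a_gt0 d_gt0) => [G [P [h1 h2 h3 h4]]].
  have [c [x1 [x2 [x3 [x4 [x5 [pos H]]]]]]] :=
    cond9_fits a_gt0 d_gt0 (Gamma1_gt0 a_gt0 d_gt0 h1) h1 h2 h3 h4.
  by do 5!eexists; split; last exact: fits9_law H.
- move/(cond10P a_gt0 d_gt0) => [G [P [h1 h2 h3 h4]]].
  have [c [x1 [x2 [x3 [x4 [x5 [pos H]]]]]]] :=
    cond10_fits a_gt0 d_gt0 (Gamma1_gt0 a_gt0 d_gt0 h1) h1 h2 h3 h4.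
  by do 5!eexists; split; last exact: fits10_law H.
Qed.

Lemma primal_kinds_conditions u1 u2 u3 u4 u5 a d : admissible a d ->
  0 < element_value u1 -> 0 < element_value u2 -> 0 < element_value u3 ->
  0 < element_value u4 -> 0 < element_value u5 ->
  bridge_law u1 u2 u3 u4 u5 a d ->
  [:: kind u1; kind u2; kind u3; kind u4; kind u5] \in primal_kinds ->
  primal_conditions a d.
Proof.
move=> adm p1 p2 p3 p4 p5 H; have [sa sd a_gt0 d_gt0 co] := adm.
rewrite !inE => /or4P[/eqP[]|/eqP[]|/eqP[]|/or3P[] /eqP[]];
  case: u1 H p1 => // x1 + p1 _; case: u2 p2 => // x2 p2 + _;
  case: u3 p3 => // x3 p3 + _; case: u4 p4 => // x4 p4 + _;
  case: u5 p5 => // x5 p5 + _ => H; rewrite /= in p1 p2 p3 p4 p5.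
- have [c {}H] := bridge_law_fits7 p1 p5 adm H.
  by apply: Or41; left; exact: fits7_cond H.
- have [c {}H] := bridge_law_fits7_rev p2 p3 p4 adm H.
  by apply: Or41; right; apply/cond7c_rev; exact: fits7_cond H.
- have [c {}H] := bridge_law_fits8 p1 p5 adm H; apply: Or42.
  apply/(cond8P a_gt0 d_gt0 (admissible_nondeg adm)).
  by exists x4; exact: fits8_cond H.
- have [c {}H] := bridge_law_fits9 p1 p4 adm H; apply/Or43/(cond9P a_gt0 d_gt0).
  by exists x2^-1, x4^-1; exact: fits9_cond H.
- have [c {}H] := bridge_law_fits10 p1 p4 adm H; apply/Or44/(cond10P a_gt0 d_gt0).
  by exists x2^-1, x4^-1; exact: fits10_cond H.
- have [s [t {}H]] := bridge_law_fits_excluded p1 p3 p4 p5 adm H.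
  by case: (fits_excluded_false p1 p2 p3 p4 p5 H).
Qed.

Lemma kind_dual u : kind (dual_element u) = (2 - kind u)%N.
Proof. by case: u. Qed.

Lemma canonical_conditions u1 u2 u3 u4 u5 a d : admissible a d ->
  0 < element_value u1 -> 0 < element_value u2 -> 0 < element_value u3 ->
  0 < element_value u4 -> 0 < element_value u5 ->
  bridge_law u1 u2 u3 u4 u5 a d ->
  canonical (kind u1) (kind u2) (kind u3) (kind u4) (kind u5) ->
  [\/ primal_conditions a d, primal_conditions d a | cond11 a d].
Proof.
move=> adm p1 p2 p3 p4 p5 H /or3P[K|K|].
- by apply: Or31; exact: primal_kinds_conditions K.
- apply: Or32; apply: (primal_kinds_conditions (admissible_sym adm)
    _ _ _ _ _ (bridge_law_dual p1 p2 p3 p4 p5 H));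
    rewrite ?kind_dual //; exact: dual_element_gt0.
- move/eqP=> []; case: u1 H p1 => // x1 + p1 _; case: u2 p2 => // x2 p2 + _;
    case: u3 p3 => // x3 p3 + _; case: u4 p4 => // x4 p4 + _;
    case: u5 p5 => // x5 p5 + _ => H; rewrite /= in p1 p2 p3 p4 p5.
  have [s [t {}H]] := bridge_law_fits11 p1 p2 p3 p4 adm H.
  by apply: Or33; exact: fits11_cond H.
Qed.

Lemma realizable_lawP a d : admissible a d ->
  realizable_law a d <-> conditions a d.
Proof.
move=> adm; rewrite conditionsE; split; last first.
  case=> [|h|h]; first exact: primal_conditions_law.
    apply: realizable_law_dual.
    exact: primal_conditions_law (admissible_sym adm) h.
  have [sa sd a_gt0 d_gt0 co] := adm.
  have [s [t [x1 [x2 [x3 [x4 [x5 [pos H]]]]]]]] := cond11_fits a_gt0 d_gt0 h.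
  by do 5!eexists; split; last exact: fits11_law H.
move=> [u1 [u2 [u3 [u4 [u5 [[p1 p2 p3 p4 p5] H]]]]]].
have := bridge_law_feasible adm p1 p2 p3 p4 p5 H.
move/feasible_kinds; rewrite !kind_lt3 => /(_ isT isT isT isT isT).
case/or4P=> K.
- exact: canonical_conditions H K.
- by apply: canonical_conditions (bridge_law_swap H) K.
- by apply: canonical_conditions (bridge_law_flip H) K.
- by apply: canonical_conditions (bridge_law_swap (bridge_law_flip H)) K.
Qed.
End Main.

(** * Kirchhoff's laws on the bridge *)

Section Kirchhoff.
Variable K : fieldType.
Variables y1 y2 y3 y4 y5 : K.

Lemma bridge_kirchhoff (va vb vp vq : K) :
  y1 * (va - vp) + y2 * (va - vq) = 1 ->
  y1 * (vp - va) + y3 * (vp - vb) + y5 * (vp - vq) = 0 ->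
  y2 * (vq - va) + y4 * (vq - vb) + y5 * (vq - vp) = 0 ->
  (va - vb) * bridge_den y1 y2 y3 y4 y5 = bridge_num y1 y2 y3 y4 y5.
Proof.
(* The multipliers of the current laws at [a], [p] and [q] are cofactors of the
   nodal admittance matrix. *)
move=> Ea Ep Eq; rewrite -[RHS]mulr1 -Ea.
have -> : (va - vb) * bridge_den y1 y2 y3 y4 y5 =
  bridge_num y1 y2 y3 y4 y5 * (y1 * (va - vp) + y2 * (va - vq))
  + (y1 * (y2 + y4 + y5) + y2 * y5)
    * (y1 * (vp - va) + y3 * (vp - vb) + y5 * (vp - vq))
  + (y2 * (y1 + y3 + y5) + y1 * y5)
    * (y2 * (vq - va) + y4 * (vq - vb) + y5 * (vq - vp)).
  by rewrite /bridge_den /bridge_num; ring.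
by rewrite Ep Eq !mulr0 !addr0.
Qed.

(** Cramer's rule for the node potentials, with the sink at potential 0 and unit current. *)
Lemma bridge_kirchhoff_sol : let D := bridge_den y1 y2 y3 y4 y5 in D != 0 ->
  let va := bridge_num y1 y2 y3 y4 y5 / D in
  let vp := (y1 * (y2 + y4 + y5) + y2 * y5) / D in
  let vq := (y2 * (y1 + y3 + y5) + y1 * y5) / D in
  [/\ y1 * (va - vp) + y2 * (va - vq) = 1,
      y1 * (vp - va) + y3 * vp + y5 * (vp - vq) = 0,
      y2 * (vq - va) + y4 * vq + y5 * (vq - vp) = 0
    & y3 * vp + y4 * vq = 1].
Proof.
by rewrite /bridge_num /bridge_den => /= D0; split; field.
Qed.

Lemma bridge_den_div (x : K) : x != 0 ->
  bridge_den (y1 / x) (y2 / x) (y3 / x) (y4 / x) (y5 / x) =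
  bridge_den y1 y2 y3 y4 y5 / x ^+ 3.
Proof. by move=> x0; rewrite /bridge_den; field. Qed.

Lemma bridge_num_div (x : K) : x != 0 ->
  bridge_num (y1 / x) (y2 / x) (y3 / x) (y4 / x) (y5 / x) =
  bridge_num y1 y2 y3 y4 y5 / x ^+ 2.
Proof. by move=> x0; rewrite /bridge_num; field. Qed.

Lemma clear_powers (a d x D N : K) : d != 0 -> x != 0 ->
  a / d * (D / x ^+ 3) = N / x ^+ 2 <-> a * D = d * (x * N).
Proof.
move=> d0 x0; split=> [H|H].
  have : a / d * (D / x ^+ 3) * (d * x ^+ 3) = N / x ^+ 2 * (d * x ^+ 3).
    by rewrite H.
  by move=> {}H; apply: (eq_trans _ (eq_trans H _)); field_nz.
have -> : a / d * (D / x ^+ 3) = a * D / (d * x ^+ 3) by field_nz.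
by rewrite H; field_nz.
Qed.
End Kirchhoff.

Lemma rmorph_bridge_den (K L : comNzRingType) (f : {rmorphism K -> L}) y1 y2 y3 y4 y5 :
  f (bridge_den y1 y2 y3 y4 y5) =
  bridge_den (f y1) (f y2) (f y3) (f y4) (f y5).
Proof. by rewrite /bridge_den !(rmorphD, rmorphM). Qed.

Lemma rmorph_bridge_num (K L : comNzRingType) (f : {rmorphism K -> L}) y1 y2 y3 y4 y5 :
  f (bridge_num y1 y2 y3 y4 y5) =
  bridge_num (f y1) (f y2) (f y3) (f y4) (f y5).
Proof. by rewrite /bridge_num !(rmorphD, rmorphM). Qed.

Section Frac.
Variable R : realType.
Implicit Types (a d p q : {poly R}) (u : element R).
Local Notation F := {fraction {poly R}}.

Definition admittance u : F := (element_impedance u)^-1.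

Lemma tofracX_neq0 : ('X : {poly R})%:F != 0.
Proof. by rewrite tofrac_eq0 polyX_eq0. Qed.

Lemma mulX_admittance u : 0 < element_value u ->
  ('X : {poly R})%:F * admittance u = (scaled_admittance u)%:F.
Proof.
have X0 := tofracX_neq0; rewrite /admittance /scaled_admittance -mul_polyC.
case: u => c /= c_gt0.
- by rewrite invrK expr1 tofracM mulrC.
- by rewrite invf_div mulrC divfK // expr0 mulr1.
- by rewrite invrK expr2 !tofracM mulrCA.
Qed.

Lemma admittance_neq0 u : 0 < element_value u -> admittance u != 0.
Proof.
move=> u_gt0; have := mulX_admittance u_gt0.
apply: contra_eq_neq => ->; rewrite mulr0 eq_sym tofrac_eq0 scaler_eq0.
by rewrite gt_eqF //= expf_eq0 polyX_eq0 andbF.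
Qed.

Lemma bridge_impedance_law u1 u2 u3 u4 u5 a d : d != 0 ->
  0 < element_value u1 -> 0 < element_value u2 -> 0 < element_value u3 ->
  0 < element_value u4 -> 0 < element_value u5 ->
  let y := admittance in
  a%:F / d%:F * bridge_den (y u1) (y u2) (y u3) (y u4) (y u5) =
    bridge_num (y u1) (y u2) (y u3) (y u4) (y u5) <->
  bridge_law u1 u2 u3 u4 u5 a d.
Proof.
move=> d0 p1 p2 p3 p4 p5 y.
have X0 := tofracX_neq0; have dF0 : d%:F != 0 by rewrite tofrac_eq0.
set X := 'X%:F in X0.
have yE u : 0 < element_value u -> y u = (scaled_admittance u)%:F / X.
  by move=> u_gt0; rewrite -mulX_admittance // mulrAC divff // mul1r.
rewrite (yE _ p1) (yE _ p2) (yE _ p3) (yE _ p4) (yE _ p5).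
rewrite (bridge_den_div _ _ _ _ _ X0) (bridge_num_div _ _ _ _ _ X0).
rewrite (clear_powers _ _ _ dF0 X0).
rewrite -!rmorph_bridge_den -!rmorph_bridge_num -!rmorphM.
split=> [/eqP|/bridge_law_poly /= ->]; last by [].
by rewrite tofrac_eq => /eqP; apply: poly_bridge_law.
Qed.

(** After scaling by [X] the expression is a polynomial whose value at 1 is a sum of products of
    positive numbers. *)
Lemma bridge_den_neq0 u1 u2 u3 u4 u5 :
  0 < element_value u1 -> 0 < element_value u2 -> 0 < element_value u3 ->
  0 < element_value u4 -> 0 < element_value u5 ->
  bridge_den (admittance u1) (admittance u2) (admittance u3) (admittance u4)
    (admittance u5) != 0.
Proof.
move=> p1 p2 p3 p4 p5; set y := admittance; apply/eqP => D0.
have X0 := tofracX_neq0; set X := 'X%:F in X0.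
have yE u : 0 < element_value u -> y u = (scaled_admittance u)%:F / X.
  by move=> u_gt0; rewrite -mulX_admittance // mulrAC divff // mul1r.
move/eqP: D0; rewrite (yE _ p1) (yE _ p2) (yE _ p3) (yE _ p4) (yE _ p5).
rewrite (bridge_den_div _ _ _ _ _ X0) mulf_eq0 invr_eq0.
rewrite (negPf (expf_neq0 3 X0)) orbF -rmorph_bridge_den /= tofrac_eq0.
move/eqP/(congr1 (horner_eval (1 : R))); rewrite rmorph_bridge_den rmorph0.
rewrite /= /horner_eval !horner_scaled_admittance ?oner_neq0 // !mul1r => /eqP.
apply/negP; rewrite gt_eqF //.
have g u : 0 < element_value u -> 0 < admittance_at u 1.
  by move=> u_gt0; apply: admittance_at_gt0.
move: (g _ p1) (g _ p2) (g _ p3) (g _ p4) (g _ p5) => g1 g2 g3 g4 g5.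
by rewrite /bridge_den; positivity.
Qed.
End Frac.

(** * A concrete bridge network, not series-parallel *)

Section BridgeGraph.

Definition vx0 : 'I_4 := Ordinal (isT : 0 < 4)%N.
Definition vx1 : 'I_4 := Ordinal (isT : 1 < 4)%N.
Definition vx2 : 'I_4 := Ordinal (isT : 2 < 4)%N.
Definition vx3 : 'I_4 := Ordinal (isT : 3 < 4)%N.

Definition eg0 : 'I_5 := Ordinal (isT : 0 < 5)%N.
Definition eg1 : 'I_5 := Ordinal (isT : 1 < 5)%N.
Definition eg2 : 'I_5 := Ordinal (isT : 2 < 5)%N.
Definition eg3 : 'I_5 := Ordinal (isT : 3 < 5)%N.
Definition eg4 : 'I_5 := Ordinal (isT : 4 < 5)%N.

(* Vertices [0], [1] are the terminals; [4] is the bridging edge. *)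
Definition bridge_ends (e : 'I_5) : 'I_4 * 'I_4 :=
  nth (vx0, vx0)
    [:: (vx0, vx2); (vx0, vx3); (vx1, vx2); (vx1, vx3); (vx2, vx3)] e.

Lemma vx_cases (P : 'I_4 -> Prop) : P vx0 -> P vx1 -> P vx2 -> P vx3 ->
  forall x, P x.
Proof.
move=> p0 p1 p2 p3 [[|[|[|[|x]]]] lx] //.
- by rewrite (_ : Ordinal lx = vx0) //; apply: val_inj.
- by rewrite (_ : Ordinal lx = vx1) //; apply: val_inj.
- by rewrite (_ : Ordinal lx = vx2) //; apply: val_inj.
- by rewrite (_ : Ordinal lx = vx3) //; apply: val_inj.
Qed.

Lemma eg_cases (P : 'I_5 -> Prop) : P eg0 -> P eg1 -> P eg2 -> P eg3 -> P eg4 ->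
  forall e, P e.
Proof.
move=> p0 p1 p2 p3 p4 [[|[|[|[|[|e]]]]] le] //.
- by rewrite (_ : Ordinal le = eg0) //; apply: val_inj.
- by rewrite (_ : Ordinal le = eg1) //; apply: val_inj.
- by rewrite (_ : Ordinal le = eg2) //; apply: val_inj.
- by rewrite (_ : Ordinal le = eg3) //; apply: val_inj.
- by rewrite (_ : Ordinal le = eg4) //; apply: val_inj.
Qed.

Lemma bridge_connected x y : connect (adjacent bridge_ends) x y.
Proof.
have sym : symmetric (adjacent bridge_ends).
  by move=> u v; apply: eq_existsb => e; rewrite /joins orbC.
have c0 e : connect (adjacent bridge_ends) (bridge_ends e).1 (bridge_ends e).2.
  by apply/connect1/existsP; exists e; rewrite /joins -surjective_pairing eqxx.
have from0 : forall v, connect (adjacent bridge_ends) vx0 v.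
  apply: vx_cases; [exact: connect0 | | exact: c0 eg0 | exact: c0 eg1].
  apply: connect_trans (c0 eg0) _.
  by rewrite (sym_connect_sym sym); exact: c0 eg2.
by apply: connect_trans (from0 y); rewrite (sym_connect_sym sym).
Qed.

Lemma bridge_simple_path e : exists2 w,
  simple_path bridge_ends vx0 vx1 w & e \in unzip1 w.
Proof.
move: e; apply: eg_cases.
- by exists [:: (eg0, vx2); (eg2, vx1)].
- by exists [:: (eg1, vx3); (eg3, vx1)].
- by exists [:: (eg0, vx2); (eg2, vx1)].
- by exists [:: (eg1, vx3); (eg3, vx1)].
- by exists [:: (eg0, vx2); (eg4, vx3); (eg3, vx1)].
Qed.

Lemma sp_part_neq0 (V E : finType) (ends : E -> V * V) F x y :
  sp_part ends F x y -> F != set0.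
Proof.
elim=> {F x y} [e x y _|F1 F2 x z y _ h1 _ _ _ _|F1 F2 x y _ h1 _ _ _ _].
- by move=> _; apply/set0Pn; exists e; rewrite inE.
- by rewrite setU_eq0 (negPf h1).
- by rewrite setU_eq0 (negPf h1).
Qed.

Lemma mem_vertices_bridge (F : {set 'I_5}) (x : 'I_4) :
  (x \in vertices_of bridge_ends F) =
  has (fun e => (e \in F) &&
         ((x == (bridge_ends e).1) || (x == (bridge_ends e).2)))
    [:: eg0; eg1; eg2; eg3; eg4].
Proof.
rewrite inE; apply/exists_inP/hasP => [[e eF xe]|[e _ /andP[eF xe]]].
  exists e; last by rewrite eF.
  by move: e {eF xe}; apply: eg_cases.
by exists e.
Qed.

Lemma bridge_split (F1 F2 : {set 'I_5}) :
  F1 != set0 -> F2 != set0 -> [disjoint F1 & F2] -> F1 :|: F2 = setT ->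
  let C := vertices_of bridge_ends F1 :&: vertices_of bridge_ends F2 in
  (forall z, C <> [set z]) /\ C <> [set vx0; vx1].
Proof.
move=> /set0Pn[f1 f1F] /set0Pn[f2 f2F] dis uni C.
have F2E e : (e \in F2) = (e \notin F1).
  have := in_setT e; rewrite -uni inE.
  have [eF1 _|_ /= ->] := boolP (e \in F1); last by [].
  by rewrite (disjointFr dis).
have n1 : has (mem F1) [:: eg0; eg1; eg2; eg3; eg4].
  by apply/hasP; exists f1 => //; move: (f1) ; apply: eg_cases.
have n2 : has (fun e => e \notin F1) [:: eg0; eg1; eg2; eg3; eg4].
  apply/hasP; exists f2; last by rewrite -F2E.
  by move: (f2) ; apply: eg_cases.
have CE x : (x \in C) = (x \in vertices_of bridge_ends F1)
    && (x \in vertices_of bridge_ends F2) by rewrite inE.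
have C0 := CE vx0; have C1 := CE vx1; have C2 := CE vx2; have C3 := CE vx3.
rewrite !mem_vertices_bridge /= !F2E in C0 C1 C2 C3.
rewrite /= in n1 n2.
split=> [z|] CS; rewrite CS in C0 C1 C2 C3.
  move: C0 C1 C2 C3 n1 n2; rewrite !in_set1; move: z {CS}.
  (* A split is determined by the membership of the five edges in [F1]; all 32 choices are tried. *)
  by apply: vx_cases; case: (eg0 \in F1); case: (eg1 \in F1);
    case: (eg2 \in F1); case: (eg3 \in F1); case: (eg4 \in F1).
move: C0 C1 C2 C3 n1 n2; rewrite !in_set2.
by case: (eg0 \in F1); case: (eg1 \in F1);
    case: (eg2 \in F1); case: (eg3 \in F1); case: (eg4 \in F1).
Qed.

Lemma bridge_not_sp : ~ sp_part bridge_ends setT vx0 vx1.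
Proof.
(* Generalizing the edge set and the terminals keeps the equations in the case analysis. Only the
   last step of a derivation matters, since no admissible split of the whole edge set exists. *)
have main F x y : sp_part bridge_ends F x y ->
    F = setT -> x = vx0 -> y = vx1 -> False.
  case=> {F x y} [e x y _ _ eT|F1 F2 x z y h1 h2 dis VV uni|F1 F2 x y h1 h2 dis VV uni].
  - by move/(congr1 (fun S : {set _} => #|S|)): eT; rewrite cards1 cardsT card_ord.
  - have [nz _] := bridge_split (sp_part_neq0 h1) (sp_part_neq0 h2) dis uni.
    by case: (nz z).
  - move=> x0 y1; rewrite x0 y1 in VV.
    by have [_] := bridge_split (sp_part_neq0 h1) (sp_part_neq0 h2) dis uni.
by move=> h; apply: main h _ _ _.
Qed.

Lemma bridge_current_law (K : zmodType) (f : 'I_5 -> K) :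
  let net x := \sum_(e | (bridge_ends e).1 == x) f e
    - \sum_(e | (bridge_ends e).2 == x) f e in
  [/\ net vx0 = f eg0 + f eg1, net vx1 = f eg2 + f eg3,
      net vx2 = f eg4 - (f eg0 + f eg2) & net vx3 = - (f eg1 + f eg3 + f eg4)].
Proof.
have E (P : pred 'I_5) : \sum_(e | P e) f e =
    f eg0 *+ P eg0 + (f eg1 *+ P eg1 + (f eg2 *+ P eg2 + (f eg3 *+ P eg3
    + f eg4 *+ P eg4))).
  have mk b (z : K) : (if b then z else 0) = z *+ b by case: b.
  rewrite big_mkcond !big_ord_recl big_ord0 /= addr0 !mk.
  have -> : lift ord0 ord0 = eg1 by apply: val_inj.
  have -> : lift ord0 (lift ord0 ord0) = eg2 by apply: val_inj.
  have -> : lift ord0 (lift ord0 (lift ord0 ord0)) = eg3 by apply: val_inj.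
  have -> : lift ord0 (lift ord0 (lift ord0 (lift ord0 ord0))) = eg4.
    by apply: val_inj.
  by have -> : ord0 = eg0 by apply: val_inj.
move=> net; rewrite /net !E /= !mulr1n !mulr0n !addr0 !add0r.
by split; rewrite ?subr0 ?sub0r ?addrA.
Qed.
End BridgeGraph.

Lemma bridge_solution (K : fieldType) (z : 'I_5 -> K) :
  (forall e, z e != 0) ->
  let y e := (z e)^-1 in
  let D := bridge_den (y eg0) (y eg1) (y eg2) (y eg3) (y eg4) in
  D != 0 ->
  exists (v : 'I_4 -> K) (f : 'I_5 -> K),
  [/\ forall x, \sum_(e | (bridge_ends e).1 == x) f e
        - \sum_(e | (bridge_ends e).2 == x) f e =
        1 *+ (x == vx0) - 1 *+ (x == vx1),
      forall e, v (bridge_ends e).1 - v (bridge_ends e).2 = z e * f e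
    & v vx0 - v vx1 =
        bridge_num (y eg0) (y eg1) (y eg2) (y eg3) (y eg4) / D].
Proof.
move=> z0 y D D0.
have [] := bridge_kirchhoff_sol D0; rewrite -/D.
set va := bridge_num _ _ _ _ _ / D; set vp := _ / D; set vq := _ / D.
move=> E0 E2 E3 E1.
pose v (x : 'I_4) := nth 0 [:: va; 0; vp; vq] x.
pose f e := y e * (v (bridge_ends e).1 - v (bridge_ends e).2).
exists v, f; split; last by rewrite /v /= subr0.
- have [F0 F1 F2 F3] := bridge_current_law f.
  apply: vx_cases; rewrite ?F0 ?F1 ?F2 ?F3 /f /v /=.
  + by rewrite mulr1n mulr0n subr0 -E0.
  + by rewrite mulr1n mulr0n -[in RHS]E1; ring.
  + by rewrite !mulr0n subrr -[RHS]E2; ring.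
  + by rewrite !mulr0n subrr -[RHS]E3; ring.
- by move=> e; rewrite /f mulrA mulfV ?z0 // mul1r.
Qed.

Section BridgeNetwork.
Variables (R : realType) (u1 u2 u3 u4 u5 : element R).
Hypotheses (u1_gt0 : 0 < element_value u1) (u2_gt0 : 0 < element_value u2)
  (u3_gt0 : 0 < element_value u3) (u4_gt0 : 0 < element_value u4)
  (u5_gt0 : 0 < element_value u5).

Definition bridge_elt (e : 'I_5) : element R :=
  nth u1 [:: u1; u2; u3; u4; u5] e.

Lemma bridge_elt_gt0 e : 0 < element_value (bridge_elt e).
Proof. by move: e; apply: eg_cases. Qed.

Definition bridge_network : network R :=
  @Network R 'I_4 'I_5 bridge_ends bridge_elt vx0 vx1 isT bridge_elt_gt0
    bridge_connected bridge_simple_path.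

Lemma bridge_network_realizes (a d : {poly R}) : d != 0 ->
  bridge_law u1 u2 u3 u4 u5 a d -> realizable_five_element_nsp (a%:F / d%:F).
Proof.
move=> d0 H; exists bridge_network; split.
- by rewrite card_ord.
- exact: bridge_not_sp.
have D0 := bridge_den_neq0 u1_gt0 u2_gt0 u3_gt0 u4_gt0 u5_gt0.
have z0 e : element_impedance (bridge_elt e) != 0.
  by rewrite -invr_eq0; apply: admittance_neq0 (bridge_elt_gt0 e).
have [v [f [kcl ohm vE]]] := bridge_solution z0 D0.
exists v, f; split; first by split; [exact: kcl | exact: ohm].
rewrite [RHS]vE.
have /= /(bridge_impedance_law _ d0 u1_gt0 u2_gt0 u3_gt0 u4_gt0 u5_gt0) <- := H.
by rewrite mulfK.
Qed.
End BridgeNetwork.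

(** * Kirchhoff's laws on an arbitrary copy of the bridge *)

Section BridgeCurrents.
Variables (K : fieldType) (V E : finType) (ends : E -> V * V).
Variables (v : V -> K) (z f : E -> K).
Hypotheses (z_neq0 : forall e, z e != 0)
  (ohm : forall e, v (ends e).1 - v (ends e).2 = z e * f e).

(** Reversing the reference orientation changes the sign of both the flow and the potential
    difference, so only the endpoints matter. *)
Lemma branch_current e x u w : joins ends e u w -> u != w ->
  f e *+ ((ends e).1 == x) - f e *+ ((ends e).2 == x) =
  ((z e)^-1 * (v u - v w)) *+ (u == x) - ((z e)^-1 * (v u - v w)) *+ (w == x).
Proof.
have fE : f e = (z e)^-1 * (v (ends e).1 - v (ends e).2).
  by rewrite ohm mulKf.
rewrite fE => /orP[] /eqP -> uw //=.
by rewrite -(opprB (v u)) mulrN !mulNrn opprK addrC.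
Qed.

Lemma bridge_potential s t p q e1 e2 e3 e4 e5 :
  uniq [:: s; t; p; q] -> perm_eq [:: e1; e2; e3; e4; e5] (enum E) ->
  [/\ joins ends e1 s p, joins ends e2 s q, joins ends e3 t p,
      joins ends e4 t q & joins ends e5 p q] ->
  (forall x, \sum_(e | (ends e).1 == x) f e - \sum_(e | (ends e).2 == x) f e =
     1 *+ (x == s) - 1 *+ (x == t)) ->
  let y e := (z e)^-1 in
  (v s - v t) * bridge_den (y e1) (y e2) (y e3) (y e4) (y e5) =
    bridge_num (y e1) (y e2) (y e3) (y e4) (y e5).
Proof.
move=> un pe [j1 j2 j3 j4 j5] kcl y.
have [[st sp sq tp tq] pq] :
    [/\ s != t, s != p, s != q, t != p & t != q] /\ p != q.
  move: un; rewrite /= !inE !negb_or -!andbA andbT.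
  by case/and5P=> -> -> -> -> /andP[-> ->].
have sumE (g : E -> K) : \sum_e g e = g e1 + (g e2 + (g e3 + (g e4 + g e5))).
  rewrite -big_enum -(perm_big _ pe) /= !big_cons big_nil addr0; by [].
have mk b (c : K) : (if b then c else 0) = c *+ b by case: b.
have net x : 1 *+ (x == s) - 1 *+ (x == t) =
    y e1 * (v s - v p) *+ (s == x) - y e1 * (v s - v p) *+ (p == x)
    + (y e2 * (v s - v q) *+ (s == x) - y e2 * (v s - v q) *+ (q == x)
    + (y e3 * (v t - v p) *+ (t == x) - y e3 * (v t - v p) *+ (p == x)
    + (y e4 * (v t - v q) *+ (t == x) - y e4 * (v t - v q) *+ (q == x)
    + (y e5 * (v p - v q) *+ (p == x) - y e5 * (v p - v q) *+ (q == x))))).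
  rewrite -kcl big_mkcond [X in _ - X]big_mkcond -sumrB sumE !mk.
  by rewrite (branch_current _ j1) ?(branch_current _ j2) ?(branch_current _ j3)
    ?(branch_current _ j4) ?(branch_current _ j5).
(* Three independent current laws; the one at [t] is the negative of their sum. *)
have ns := net s; have np := net p; have nq := net q.
move: ns np nq; rewrite !eqxx ![_ == s]eq_sym ![t == _]eq_sym.
rewrite (negPf st) (negPf sp) (negPf sq) [p == t]eq_sym [q == t]eq_sym.
rewrite (negPf tp) (negPf tq) [q == p]eq_sym (negPf pq).
rewrite !mulr1n !mulr0n !(subr0, addr0, add0r, sub0r) => ns np nq.
apply: (bridge_kirchhoff (vp := v p) (vq := v q)) => //.
- by rewrite [RHS]np; ring.
- by rewrite [RHS]nq; ring.
Qed.
End BridgeCurrents.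

(** Lowest terms [p / q] satisfy [a = p * t] and [d = q * t], so [p] and [q] have equal size; degree
    3 makes this size 4, and [t] is constant. *)
Lemma mcmillan_coprimep (R : realType) (a d : {poly R}) :
  size a = 4%N -> size d = 4%N -> has_mcmillan_degree (a%:F / d%:F) 3 ->
  coprimep a d.
Proof.
move=> sa sd [p [q [[q0 co E] deg]]].
have d0 : d != 0 by rewrite -size_poly_eq0 sd.
have a0 : a != 0 by rewrite -size_poly_eq0 sa.
have {}E : p * d = q * a.
  move/eqP: E; rewrite eqr_div ?tofrac_eq0 // -!tofracM tofrac_eq => /eqP E.
  by rewrite -E mulrC.
have [t dE aE] := coprimep_cofactor co q0 E.
have [p0 t0] : p != 0 /\ t != 0.
  by move: a0; rewrite aE mulf_eq0 negb_or => /andP[].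
have szp : (size p + size t = 5)%N.
  move: sa; rewrite aE size_mul // => /(congr1 S); rewrite prednK //.
  by rewrite addn_gt0 size_poly_gt0 p0.
have szq : (size q + size t = 5)%N.
  move: sd; rewrite dE size_mul // => /(congr1 S); rewrite prednK //.
  by rewrite addn_gt0 size_poly_gt0 q0.
have pq : size p = size q by apply/eqP; rewrite -(eqn_add2r (size t)) szp szq.
have sp4 : size p = 4%N.
  by move: deg; rewrite -pq maxnn => ->; rewrite prednK // size_poly_gt0.
have st : size t = 1%N by apply/eqP; rewrite -(eqn_add2l (size p)) szp sp4.
have /eqP/size_poly1P[c c0 tE] := st.
by rewrite aE dE tE ![_ * c%:P]mulrC !mul_polyC coprimepZl // coprimepZr.
Qed.

Lemma realizableP (R : realType) (a d : {poly R}) : d != 0 ->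
  realizable_five_element_nsp (a%:F / d%:F) <-> realizable_law a d.
Proof.
move=> d0; split; last first.
  move=> [u1 [u2 [u3 [u4 [u5 [[p1 p2 p3 p4 p5] H]]]]]].
  exact: bridge_network_realizes p1 p2 p3 p4 p5 _ _ d0 H.
move=> [N [card5 nsp [v [f [[kcl ohm] ZE]]]]].
have [p [q [e1 [e2 [e3 [e4 [e5 [un _ pe js]]]]]]]] :=
  five_edges_bridge (terminals_distinct N) (@network_connected _ N)
    (@edge_on_simple_path _ N) card5 nsp.
have pos e : 0 < element_value (@elt _ N e) by exact: elt_gt0.
have z0 e : element_impedance (@elt _ N e) != 0.
  by rewrite -invr_eq0; apply: admittance_neq0 (pos e).
have := bridge_potential z0 ohm un pe js kcl; rewrite -ZE => H.
exists (elt e1), (elt e2), (elt e3), (elt e4), (elt e5); split=> //.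
exact/(bridge_impedance_law _ d0 (pos e1) (pos e2) (pos e3) (pos e4) (pos e5)).
Qed.

Theorem theorem3 (R : realType) (a d : {poly R})
    (size_a : size a = 4%N) (size_d : size d = 4%N)
    (a_gt0 : forall i : nat, (i < 4)%N -> 0 < a`_i)
    (d_gt0 : forall j : nat, (j < 4)%N -> 0 < d`_j)
    (degZ : has_mcmillan_degree (a%:F / d%:F) 3)
    (noZ : no_pole_or_zero_on_jR_infinity (a%:F / d%:F)) :
  realizable_five_element_nsp (a%:F / d%:F) <->
  (cond7a a d \/ cond7b a d \/ cond7c a d \/ cond7d a d) \/
  (cond8_1 a d \/ cond8_2 a d \/ cond8_3 a d \/ cond8_4 a d) \/
  (cond9_1 a d \/ cond9_2 a d) \/
  (cond10_1 a d \/ cond10_2 a d) \/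
  cond11 a d.
Proof.
have d0 : d != 0 by rewrite -size_poly_eq0 size_d.
rewrite realizableP //; apply: realizable_lawP.
by split=> //; apply: mcmillan_coprimep.
Qed.
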